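(* Let $\mathcal{S}$ be as in the context, let $A$ be a $C^*$-algebra, let $X=\{X(s)\}_{s\in\mathcal{S}}$ be a product system of $C^*$-correspondences over $A$ indexed by $\mathcal{S}$, and let $(\sigma,T)$ be a representation of $X$ on a Hilbert space $H$. Let $$\mathcal{H} = H \oplus \Big(\bigoplus_{0\neq s\in\mathcal{S}} X(s)\otimes_\sigma H\Big).$$ For $s\neq 0$ and $\xi\in X(s)\otimes_\sigma H$ (respectively $s=0$ and $\xi\in H$) write $\delta_s\cdot\xi$ for the element of $\mathcal{H}$ whose $s$-th component is $\xi$ and whose other components are $0$, and identify $h\in H$ with $\delta_0\cdot h$. There exists a contractive semigroup $\hat T=\{\hat T_s\}_{s\in\mathcal{S}}$ on $\mathcal{H}$, namely the one determined by the following rules: $\hat T_0=I_{\mathcal{H}}$ and, for $0\neq s\in\mathcal{S}$ and $t\in\mathcal{S}$, (i) $\hat T_s(\delta_t\cdot\xi)=0$ if $t\ngeq s$; (ii) $\hat T_s(\delta_s\cdot\xi)=\delta_0\cdot\tilde T_s\xi$ for $\xi\in X(s)\otimes_\sigma H$; (iii) $\hat T_s\big(\delta_t\cdot(U_{t-s,s}(x_{t-s}\otimes x_s)\otimes h)\big)=\delta_{t-s}\cdot\big(x_{t-s}\otimes\tilde T_s(x_s\otimes h)\big)$ if $t\geq s$, $t\neq s$, for $x_{t-s}\in X(t-s)$, $x_s\in X(s)$, $h\in H$; so that for all $0\neq s\in\mathcal{S}$, $x\in X(s)$ and $h\in H$, $$\hat T_s(\delta_s\cdot x\otimes h)=T_s(x)h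 .$$ If $(\sigma,S)$ is another representation of $X$ on $H$ (with the same $\sigma$), and if $\hat S$ is the corresponding contractive semigroup on $\mathcal{H}$, defined by the same rules with $S$ in place of $T$, then $$\hat T=\hat S\ \Rightarrow\ T=S .$$
   Context: $\mathbb{N}=\{0,1,2,\dots\}$. A semigroup $\Sigma$ (written additively) is commensurable if for all $s_1,\dots,s_N\in\Sigma$ there are $s_0\in\Sigma$ and $a_1,\dots,a_N\in\mathbb{N}$ with $s_i=a_is_0$ for all $i$. Throughout, $\Omega$ is a fixed set, for each $i\in\Omega$, $\mathcal{S}_i$ is a commensurable subsemigroup of $\mathbb{R}_+=[0,\infty)$ containing $0$, and $\mathcal{S}$ is the semigroup (under pointwise addition) of finitely supported functions $s:\Omega\to\mathbb{R}_+$ with $s(j)\in\mathcal{S}_j$ for all $j$. It is partially ordered by $s\le t$ iff $s(j)\le t(j)$ for all $j\in\Omega$ (and then $t-s\in\mathcal{S}$). A (Hilbert) $C^*$-correspondence over $A$ is a right Hilbert $A$-module $E$ with a left action of $A$ by adjointable operators. The balanced tensor product $E\otimes F$ of correspondences is the Hausdorff completion of the algebraic tensor product in $\langle x\otimes y,w\otimes z\rangle=\langle y,\langle x,w\rangle\cdot z\rangle$, with $a\cdot(x\otimes y)=(a\cdot x)\otimes y$ and $(x\otimes y)a=x\otimes(ya)$. A product system $X$ over $\mathcal{S}$ is a family $\{X(s)\}_{s\in\mathcal{S}}$ of $C^*$-correspondences over $A$ whose disjoint union (also denoted $X$) is a semigroup with $X(s)X(t)\subseteq X(s+t)$, such that for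 $s,t\in\mathcal{S}\setminus\{0\}$ the map $(x,y)\mapsto xy$ extends to an isomorphism of correspondences $U_{s,t}:X(s)\otimes X(t)\to X(s+t)$, $X(0)=A$, and the multiplications $X(0)\times X(s)\to X(s)$, $X(s)\times X(0)\to X(s)$ are the left and right actions of $A$. A completely contractive covariant (c.c.) representation of a correspondence $E$ on a Hilbert space $H$ is a pair $(\sigma,T)$ with $T:E\to B(H)$ linear and completely contractive, $\sigma:A\to B(H)$ a nondegenerate $*$-homomorphism, and $T(xa)=T(x)\sigma(a)$, $T(a\cdot x)=\sigma(a)T(x)$ for $x\in E$, $a\in A$. $E\otimes_\sigma H$ is the Hausdorff completion of the algebraic tensor product in $\langle x\otimes h,y\otimes g\rangle=\langle h,\sigma(\langle x,y\rangle)g\rangle$, and $\tilde T:E\otimes_\sigma H\to H$ is the contraction $\tilde T(x\otimes h)=T(x)h$. A representation $(\sigma,T)$ (or just $T$) of $X$ on $H$ is a map $T:X\to B(H)$ such that, with $T_s=T|_{X(s)}$ and $\sigma=T_0$, each $(\sigma,T_s)$ is a c.c. representation of $X(s)$ and $T(xy)=T(x)T(y)$ for all $x,y\in X$. $\tilde T_s$ denotes the contraction $X(s)\otimes_\sigma H\to H$ associated with $T_s$. A contractive semigroup over $\mathcal{S}$ on a Hilbert space is a family $\{R_s\}_{s\in\mathcal{S}}$ of contractions with $R_0=I$ and $R_sR_t=R_{s+t}$ for all $s,t\in\mathcal{S}$. *)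

(* Defs.v *)
From HB Require Import structures.
From mathcomp Require Import all_boot all_order all_algebra.
From mathcomp Require Import complex.
From mathcomp Require Import all_classical all_reals all_analysis.

Set Implicit Arguments.
Unset Strict Implicit.
Unset Printing Implicit Defensive.

Import Order.TTheory GRing.Theory Num.Theory numFieldNormedType.Exports.

Local Open Scope classical_set_scope.
Local Open Scope ring_scope.
Local Open Scope complex_scope.

Definition commensurable (R : realType) (P : set R) : Prop :=
  forall (N : nat) (s : 'I_N -> R), (forall i, P (s i)) ->
    exists2 s0 : R, P s0 & exists a : 'I_N -> nat, forall i, s i = s0 *+ a i.

Record semigroup_family (R : realType) (Omega : Type) := SemigroupFamily {
  sf_set :> Omega -> set R;
  sf_ge0 : forall i x, sf_set i x -> 0 <= x;
  sf_0 : forall i, sf_set i 0;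
  sf_add : forall i x y, sf_set i x -> sf_set i y -> sf_set i (x + y);
  sf_commensurable : forall i, commensurable (sf_set i)
}.

Section Index.
Variables (R : realType) (Omega : Type) (SS : semigroup_family R Omega).

Definition idx_pred : {pred Omega -> R} :=
  [pred s | `[< finite_set [set j | s j != 0] /\ forall j, SS j (s j) >]].

Record idx := Idx { idx_fun :> Omega -> R; _ : idx_pred idx_fun }.

HB.instance Definition _ := [isSub for idx_fun].
HB.instance Definition _ := [Choice of idx by <:].

Fact idx_pred_closed : GRing.nmod_closed idx_pred.
Proof.
split=> [|s t /asboolP[fs Ss] /asboolP[ft St]]; apply/asboolP; split.
- by rewrite (_ : [set _ | _] = set0) // -subset0 => j /=; rewrite eqxx.
- by move=> j; exact: sf_0.
- apply: (@sub_finite_set _ _ ([set j | s j != 0] `|` [set j | t j != 0])).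
    move=> j; have [s0|] := eqVneq (s j) 0; last by left.
    have [t0|] := eqVneq (t j) 0; last by right.
    by rewrite /= /GRing.add /= s0 t0 addr0 eqxx.
  by rewrite finite_setU.
- by move=> j; exact: sf_add.
Qed.

HB.instance Definition _ :=
  GRing.SubChoice_isSubNmodule.Build _ _ idx idx_pred_closed.

Definition idx_le (s t : idx) : Prop := forall j, s j <= t j.

Lemma idx0E j : (0 : idx) j = 0.
Proof. by []. Qed.

Lemma idx_addE (s t : idx) j : (s + t) j = s j + t j.
Proof. by []. Qed.

Lemma idxP (s : idx) :
  finite_set [set j | s j != 0] /\ forall j, SS j (s j).
Proof. by case: s => s /= /asboolP. Qed.

Lemma idx_ge0 (s : idx) j : 0 <= s j.
Proof. by have [_ Ss] := idxP s; exact: sf_ge0 (Ss j). Qed.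

Lemma idx_eqP (s t : idx) : (forall j, s j = t j) -> s = t.
Proof. by move=> st; apply/val_inj/funext. Qed.

Lemma idx_leP (s t : idx) : idx_le s t <-> exists r : idx, r + s = t.
Proof.
split=> [st|[r <-] j]; last first.
  by rewrite idx_addE lerDr idx_ge0.
have [fs Ss] := idxP s; have [ft St] := idxP t.
suff rP : idx_pred (fun j => t j - s j).
  by exists (Idx rP); apply: idx_eqP => j; rewrite idx_addE /= subrK.
apply/asboolP; split=> [|j].
  apply: (@sub_finite_set _ _ ([set j | s j != 0] `|` [set j | t j != 0])).
    move=> j; have [s0|] := eqVneq (s j) 0; last by left.
    have [t0|] := eqVneq (t j) 0; last by right.
    by rewrite /= s0 t0 subr0 eqxx.
  by rewrite finite_setU.
pose u (i : 'I_2) := if i == ord0 then s j else t j.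
have [|x0 Sx0 [a ha]] := @sf_commensurable _ _ SS j 2 u.
  by move=> i; rewrite /u; case: ifP.
have Sn n : SS j (x0 *+ n).
  by elim: n => [|n IH]; rewrite ?mulr0n ?mulrS; [exact: sf_0|exact: sf_add].
have sE : s j = x0 *+ a ord0 by rewrite -ha.
have tE : t j = x0 *+ a ord_max by rewrite -ha.
have [le01|lt10] := leqP (a ord0) (a ord_max).
  by rewrite tE sE -mulrnBr//; exact: Sn.
suff -> : t j - s j = 0 by exact: sf_0.
apply/eqP; rewrite subr_eq0 eq_le (st j) andbT tE sE.
by apply: ler_wpMn2l; [exact: (sf_ge0 Sx0)|exact: ltnW].
Qed.

Definition nzidx : Type := {s : idx | s != 0}.

Lemma nzidx_add_subproof (s t : nzidx) : val s + val t != 0.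
Proof.
case: s t => s s0 [t t0] /=; apply: contra s0 => /eqP st0; apply/eqP.
apply: idx_eqP => j; have /eqP : s j + t j = 0 by rewrite -idx_addE st0.
by rewrite paddr_eq0 ?idx_ge0// => /andP[/eqP].
Qed.

Definition nzidx_add (s t : nzidx) : nzidx :=
  exist _ (val s + val t) (nzidx_add_subproof s t).

Lemma nzidx_ltP (s t : nzidx) :
  (idx_le (val s) (val t) /\ t <> s) <-> exists r, nzidx_add r s = t.
Proof.
split=> [[/idx_leP[r rst] ts]|[r <-]].
  have r0 : r != 0.
    by apply/eqP => r0; apply: ts; apply/val_inj; rewrite -rst r0 add0r.
  by exists (exist _ r r0); apply/val_inj.
split; first by apply/idx_leP; exists (val r).
move=> /(congr1 val)/= rs; have /eqP[] := valP r; apply: idx_eqP => j.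
by apply: (addIr (val s j)); rewrite -idx_addE rs add0r.
Qed.

End Index.

Definition bounded_linear (R : realType) (V W : normedModType R[i])
    (f : V -> W) : Prop :=
  linear f /\ exists c : R[i], forall x, `|f x| <= c * `|x|.

Definition linear_contraction (R : realType) (V W : normedModType R[i])
    (f : V -> W) : Prop :=
  linear f /\ forall x, `|f x| <= `|x|.

Definition lin_span (K : nzRingType) (V : lmodType K) (D : set V) : set V :=
  [set w | exists n (c : 'I_n -> K) (v : 'I_n -> V),
    (forall i, D (v i)) /\ w = \sum_(i < n) c i *: v i].

(* Inner products are conjugate-linear in the first variable and linear in the
   second one. *)

HB.mixin Record CompleteNormedModule_isHilbert (R : realType) H
    & CompleteNormedModule R[i] H := {
  inner : H -> H -> R[i];
  innerDr : forall x y z, inner x (y + z) = inner x y + inner x z;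
  innerZr : forall x c y, inner x (c *: y) = c * inner x y;
  inner_conj : forall x y, inner y x = (inner x y)^*;
  inner_norm : forall x, inner x x = `|x| ^+ 2
}.

#[short(type="hilbertType")]
HB.structure Definition Hilbert (R : realType) :=
  {H of CompleteNormedModule R[i] H & CompleteNormedModule_isHilbert R H}.

(* No unit is required; the ring structures of the library are all unital. *)
HB.mixin Record CompleteNormedModule_isCStarAlgebra (R : realType) A
    & CompleteNormedModule R[i] A := {
  cmul : A -> A -> A;
  cstar : A -> A;
  cmulA : associative cmul;
  cmulDl : left_distributive cmul +%R;
  cmulDr : right_distributive cmul +%R;
  cmulZl : forall (c : R[i]) a b, cmul (c *: a) b = c *: cmul a b;
  cmulZr : forall (c : R[i]) a b, cmul a (c *: b) = c *: cmul a b;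
  cnormM : forall a b, `|cmul a b| <= `|a| * `|b|;
  cstarK : involutive cstar;
  cstarD : forall a b, cstar (a + b) = cstar a + cstar b;
  cstarZ : forall (c : R[i]) a, cstar (c *: a) = c^* *: cstar a;
  cstarM : forall a b, cstar (cmul a b) = cmul (cstar b) (cstar a);
  cnorm_star : forall a, `|cmul (cstar a) a| = `|a| ^+ 2
}.

#[short(type="cstarAlgType")]
HB.structure Definition CStarAlgebra (R : realType) :=
  {A of CompleteNormedModule R[i] A & CompleteNormedModule_isCStarAlgebra R A}.

Definition cpositive (R : realType) (A : cstarAlgType R) (a : A) : Prop :=
  exists b : A, a = cmul (cstar b) b.

HB.mixin Record CompleteNormedModule_isHilbertModule (R : realType)
    (A : cstarAlgType R) E & CompleteNormedModule R[i] E := {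
  rmul : E -> A -> E;
  ip : E -> E -> A;
  rmulDl : forall x y a, rmul (x + y) a = rmul x a + rmul y a;
  rmulDr : forall x a b, rmul x (a + b) = rmul x a + rmul x b;
  rmulZl : forall (c : R[i]) x a, rmul (c *: x) a = c *: rmul x a;
  rmulZr : forall (c : R[i]) x a, rmul x (c *: a) = c *: rmul x a;
  rmulA : forall x a b, rmul (rmul x a) b = rmul x (cmul a b);
  ipDr : forall x y z, ip x (y + z) = ip x y + ip x z;
  ipZr : forall x (c : R[i]) y, ip x (c *: y) = c *: ip x y;
  ip_rmul : forall x y a, ip x (rmul y a) = cmul (ip x y) a;
  ip_star : forall x y, ip y x = cstar (ip x y);
  ip_pos : forall x, cpositive (ip x x);
  ip_norm : forall x, `|ip x x| = `|x| ^+ 2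
}.

#[short(type="hilbertModType")]
HB.structure Definition HilbertModule (R : realType) (A : cstarAlgType R) :=
  {E of CompleteNormedModule R[i] E
      & CompleteNormedModule_isHilbertModule R A E}.

HB.mixin Record HilbertModule_isCorrespondence (R : realType)
    (A : cstarAlgType R) E & HilbertModule R A E := {
  lmul : A -> E -> E;
  lmulDl : forall a b x, lmul (a + b) x = lmul a x + lmul b x;
  lmulDr : forall a x y, lmul a (x + y) = lmul a x + lmul a y;
  lmulZl : forall (c : R[i]) a x, lmul (c *: a) x = c *: lmul a x;
  lmulZr : forall (c : R[i]) a x, lmul a (c *: x) = c *: lmul a x;
  lmulA : forall a b x, lmul (cmul a b) x = lmul a (lmul b x);
  lmul_rmul : forall a x b, lmul a (rmul x b) = rmul (lmul a x) b;
  lmul_adj : forall a x y, ip (lmul a x) y = ip x (lmul (cstar a) y)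
}.

#[short(type="corrType")]
HB.structure Definition Correspondence (R : realType) (A : cstarAlgType R) :=
  {E of HilbertModule R A E & HilbertModule_isCorrespondence R A E}.

Definition self_corr (R : realType) (A : cstarAlgType R) : Type := A.

Section SelfCorrespondence.
Variables (R : realType) (A : cstarAlgType R).

HB.instance Definition _ := CompleteNormedModule.copy (self_corr A) A.

Let self_ip (x y : self_corr A) : A := cmul (cstar x) y.

Fact self_ip_star x y : self_ip y x = cstar (self_ip x y).
Proof. by rewrite /self_ip cstarM cstarK. Qed.

Fact self_ip_pos x : cpositive (self_ip x x).
Proof. by exists x. Qed.

HB.instance Definition _ :=
  CompleteNormedModule_isHilbertModule.Build R A (self_corr A)
    (fun x y a => cmulDl x y a) (fun x a b => cmulDr x a b)
    (fun c x a => cmulZl c x a) (fun c x a => cmulZr c x a)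
    (fun x a b => esym (cmulA x a b))
    (fun x y z => cmulDr (cstar x) y z)
    (fun x c y => cmulZr c (cstar x) y)
    (fun x y a => cmulA (cstar x) y a)
    self_ip_star self_ip_pos (fun x => cnorm_star x).

Fact self_lmul_adj (a x y : A) :
  cmul (cstar (cmul a x)) y = cmul (cstar x) (cmul (cstar a) y).
Proof. by rewrite cstarM cmulA. Qed.

HB.instance Definition _ :=
  HilbertModule_isCorrespondence.Build R A (self_corr A)
    (fun a b x => cmulDl a b x) (fun a x y => cmulDr a x y)
    (fun c a x => cmulZl c a x) (fun c a x => cmulZr c a x)
    (fun a b x => esym (cmulA a b x))
    (fun a x b => cmulA a x b) self_lmul_adj.

End SelfCorrespondence.

Definition corr_iso (R : realType) (A : cstarAlgType R) (E F : corrType A)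
    (U : E -> F) : Prop :=
  [/\ linear U, bijective U,
      forall x y, ip (U x) (U y) = ip x y,
      forall a x, U (lmul a x) = lmul a (U x)
    & forall x a, U (rmul x a) = rmul (U x) a].

(* A Hausdorff completion of the algebraic tensor product in a given
   semi-inner product is determined, up to a unique isomorphism, by a complete
   space together with a bilinear map whose values have the prescribed inner
   products and a dense linear span. *)

Record balanced_tensor (R : realType) (A : cstarAlgType R) (E F : corrType A) :=
  BalancedTensor {
    bt_space :> corrType A;
    bt_tens : E -> F -> bt_space;
    bt_linearl : forall y, linear (bt_tens ^~ y);
    bt_linearr : forall x, linear (bt_tens x);
    bt_ip : forall x y w z,
      ip (bt_tens x y) (bt_tens w z) = ip y (lmul (ip x w) z);
    bt_lmul : forall a x y, lmul a (bt_tens x y) = bt_tens (lmul a x) y;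
    bt_rmul : forall x y a, rmul (bt_tens x y) a = bt_tens x (rmul y a);
    bt_dense : dense (lin_span [set v | exists x y, v = bt_tens x y])
  }.

Record rep_tensor (R : realType) (A : cstarAlgType R) (E : corrType A)
    (H : hilbertType R) (sigma : A -> H -> H) := RepTensor {
  rt_space :> hilbertType R;
  rt_tens : E -> H -> rt_space;
  rt_linearl : forall h, linear (rt_tens ^~ h);
  rt_linearr : forall x, linear (rt_tens x);
  rt_inner : forall x h y g,
    inner (rt_tens x h) (rt_tens y g) = inner h (sigma (ip x y) g);
  rt_dense : dense (lin_span [set v | exists x h, v = rt_tens x h])
}.

Record product_system (R : realType) (A : cstarAlgType R) (Omega : Type)
    (SS : semigroup_family R Omega) := ProductSystem {
  ps_fiber :> idx SS -> corrType A;
  ps_mul : forall s t, ps_fiber s -> ps_fiber t -> ps_fiber (s + t);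
  ps_unit : self_corr A -> ps_fiber 0;
  (* [r + (s + t)] and [r + s + t] are equal but not convertible, hence the
     equalities in the disjoint union of the fibers. *)
  ps_mulA : forall r s t (x : ps_fiber r) (y : ps_fiber s) (z : ps_fiber t),
    existT (fun u => ps_fiber u : Type) _ (ps_mul x (ps_mul y z)) =
    existT (fun u => ps_fiber u : Type) _ (ps_mul (ps_mul x y) z);
  (* The equality X(0) = A is an identification of correspondences. *)
  ps_unit_iso : corr_iso ps_unit;
  ps_mul0l : forall s a (x : ps_fiber s),
    existT (fun u => ps_fiber u : Type) _ (ps_mul (ps_unit a) x) =
    existT (fun u => ps_fiber u : Type) _ (lmul a x);
  ps_mul0r : forall s (x : ps_fiber s) a,
    existT (fun u => ps_fiber u : Type) _ (ps_mul x (ps_unit a)) =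
    existT (fun u => ps_fiber u : Type) _ (rmul x a);
  ps_tensor : forall s t, s != 0 -> t != 0 ->
    exists (P : balanced_tensor (ps_fiber s) (ps_fiber t))
           (U : P -> ps_fiber (s + t)),
      corr_iso U /\ forall x y, U (bt_tens P x y) = ps_mul x y
}.

Definition star_rep (R : realType) (A : cstarAlgType R) (H : hilbertType R)
    (sigma : A -> H -> H) : Prop :=
  [/\ forall a, bounded_linear (sigma a),
      forall h, linear (sigma ^~ h),
      forall a b h, sigma (cmul a b) h = sigma a (sigma b h)
    & forall a h g, inner (sigma a h) g = inner h (sigma (cstar a) g)].

Definition nondegenerate_rep (R : realType) (A : cstarAlgType R)
    (H : hilbertType R) (sigma : A -> H -> H) : Prop :=
  dense (lin_span [set v | exists a h, v = sigma a h]).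

(* The operator space structure of [E] is that of the corner [K(A, E)] of its
   linking algebra: [||x||] for [x] in [M_n(E)] is the norm of the operator
   [A^n -> E^n] of multiplication by [x], and the norm of [v] in the Hilbert
   module [E^n] is [||sum_i <v_i, v_i>|| ^ (1/2)]. Both norms are given by their
   upper bounds [c >= 0]. *)
Definition mx_corr_norm_le (R : realType) (A : cstarAlgType R) (E : corrType A)
    n (x : 'M[E]_n) (c : R[i]) : Prop :=
  forall v : 'I_n -> self_corr A,
    let w i := \sum_(j < n) rmul (x i j) (v j) in
    `|\sum_(i < n) ip (w i) (w i)| <= c ^+ 2 * `|\sum_(j < n) ip (v j) (v j)|.

Definition mx_op_norm_le (R : realType) (H : hilbertType R)
    n (T : 'I_n -> 'I_n -> H -> H) (c : R[i]) : Prop :=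
  forall h : 'I_n -> H,
    \sum_(i < n) `|\sum_(j < n) T i j (h j)| ^+ 2 <=
    c ^+ 2 * \sum_(j < n) `|h j| ^+ 2.

Definition completely_contractive (R : realType) (A : cstarAlgType R)
    (E : corrType A) (H : hilbertType R) (T : E -> H -> H) : Prop :=
  forall n (x : 'M[E]_n) (c : R[i]), 0 <= c ->
    mx_corr_norm_le x c -> mx_op_norm_le (fun i j => T (x i j)) c.

Record cc_representation (R : realType) (A : cstarAlgType R) (E : corrType A)
    (H : hilbertType R) (sigma : A -> H -> H) (T : E -> H -> H) : Prop :=
  CCRepresentation {
    cc_star_rep : star_rep sigma;
    cc_nondegenerate : nondegenerate_rep sigma;
    cc_bounded : forall x, bounded_linear (T x);
    cc_linear : forall h, linear (T ^~ h);
    cc_contractive : completely_contractive T;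
    cc_rmul : forall x a h, T (rmul x a) h = T x (sigma a h);
    cc_lmul : forall a x h, T (lmul a x) h = sigma a (T x h)
  }.

Definition representation (R : realType) (A : cstarAlgType R) (Omega : Type)
    (SS : semigroup_family R Omega) (X : product_system A SS)
    (H : hilbertType R) (sigma : A -> H -> H)
    (T : forall s, X s -> H -> H) : Prop :=
  [/\ forall a, T 0 (ps_unit X a) = sigma a,
      forall s, cc_representation sigma (T s)
    & forall s t (x : X s) (y : X t) h,
        T (s + t) (ps_mul x y) h = T s x (T t y h)].

(* [Tt] is the contraction associated with [T]; it is unique by [rt_dense]. *)
Definition tilde_map (R : realType) (A : cstarAlgType R) (E : corrType A)
    (H : hilbertType R) (sigma : A -> H -> H) (Y : rep_tensor E sigma)
    (T : E -> H -> H) (Tt : Y -> H) : Prop :=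
  linear_contraction Tt /\ forall x h, Tt (rt_tens Y x h) = T x h.

Record hilbert_sum (R : realType) (I : Type) (K : I -> hilbertType R) :=
  HilbertSum {
    hs_space :> hilbertType R;
    hs_in : forall i, K i -> hs_space;
    hs_linear : forall i, linear (@hs_in i);
    hs_inner : forall i (x y : K i), inner (hs_in x) (hs_in y) = inner x y;
    hs_orthogonal : forall i j (x : K i) (y : K j),
      i <> j -> inner (hs_in x) (hs_in y) = 0;
    hs_dense : dense (lin_span [set v | exists i (x : K i), v = hs_in x])
  }.

Definition contractive_semigroup (R : realType) (S : nmodType)
    (K : hilbertType R) (Q : S -> K -> K) : Prop :=
  [/\ forall s, linear_contraction (Q s), Q 0 = id
    & forall s t k, Q s (Q t k) = Q (s + t) k].

Section Hat.
Variables (R : realType) (A : cstarAlgType R) (Omega : Type).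
Variables (SS : semigroup_family R Omega) (X : product_system A SS).
Variables (H : hilbertType R) (sigma : A -> H -> H).
Variable Y : forall s : nzidx SS, rep_tensor (X (val s)) sigma.

(* [None] stands for the index [0] of the summand [H]. *)
Definition level (t : option (nzidx SS)) : idx SS :=
  if t is Some s then val s else 0.

Definition summand (t : option (nzidx SS)) : hilbertType R :=
  if t is Some s then Y s else H.

Variable HH : hilbert_sum summand.

Definition delta0 (h : H) : HH := hs_in HH (i := None) h.

Definition delta (s : nzidx SS) (xi : Y s) : HH :=
  hs_in HH (i := Some s) xi.

(* In rule (iii) the index [t >= s], [t <> s], is written [r + s] with
   [r = t - s]: see [nzidx_ltP]. The isomorphism [U_{r,s}] sends
   [x (x) y] to [ps_mul x y]. *)
Definition hat_rules (T : forall s, X s -> H -> H)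
    (That : idx SS -> HH -> HH) : Prop :=
  That 0 = id /\
  exists2 Tt : forall s : nzidx SS, Y s -> H,
    forall s, tilde_map (T (val s)) (Tt s)
  & forall s : nzidx SS,
    [/\ forall t (xi : summand t), ~ idx_le (val s) (level t) ->
          That (val s) (hs_in HH xi) = 0,
        forall xi : Y s, That (val s) (delta xi) = delta0 (Tt s xi)
      & forall (r : nzidx SS) (x : X (val r)) (y : X (val s)) (h : H),
          That (val s)
            (delta (s := nzidx_add r s) (rt_tens _ (ps_mul x y) h)) =
          delta (rt_tens (Y r) x (Tt s (rt_tens (Y s) y h)))].

End Hat.

Arguments delta {R A Omega SS X H sigma Y} HH s xi.
Arguments delta0 {R A Omega SS X H sigma Y} HH h.

(* Main.v *)
Require Import Defs.
From HB Require Import structures.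
From mathcomp Require Import all_boot all_order all_algebra.
From mathcomp Require Import complex.
From mathcomp Require Import all_classical all_reals all_analysis.
From mathcomp Require Import ring lra.

Set Implicit Arguments.
Unset Strict Implicit.
Unset Printing Implicit Defensive.

Import Order.TTheory GRing.Theory Num.Theory numFieldNormedType.Exports.

Local Open Scope classical_set_scope.
Local Open Scope ring_scope.
Local Open Scope complex_scope.

(** Everything rests on extending contractions defined on a total family of
    vectors. Three contractivity estimates are needed.

    [T~] is contractive: for a row [x] over [E] with Gram matrix [G], one wants
    [|sum_j T(x_j) g_j|^2 <= <g, G g>]. Complete contractivity gives the bound
    [|g|^2] when [G <= 1]. Apply it to the row [x (3 - G) / 2], whose Gram matrix
    is again at most [1]: since [(2 / (3 - t))^2 <= (4/9) (1 - t) + t] on [0, 1],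
    a bound [G + c (1 - G)] valid for all such rows improves to
    [G + (4/9) c (1 - G)]. Hence [c] can be taken to be [0]. Comparing norms in
    [A] requires that [b^* b] be positive in a C*-algebra (Kaplansky); order is
    handled through the numerical bound [lim (|s + B| - s)], and square roots
    through Visser's iteration.

    [I (x) T~] is contractive: [T~] intertwines the left actions, so this compares
    [P] with [P'] where [tau P = P' tau], [tau] a contraction, [0 <= P, P' <= 1].
    As [t = t^2 + q(t) / 4] with [q(t) = 4 t (1 - t)], and [tau P^2] is controlled
    by [|tau P z| <= |P z|], an error [c] for all such pairs improves to [c / 4].

    [T^_s] is contractive: it sends distinct summands into distinct summands, by
    contractions. *)

(** * Linear identities in modules by reflection *)

(** Complete contractivity bounds a row of [T] by the norm of the row [x], while contractivity of
    [T~] needs the finer bound by the Gram operator of [x]. The classical remedy divides the row by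
    its absolute value. Here a weak estimate, stated for all row contractions at once, is fed back
    into itself, and its constant improves geometrically; the positivity of [b^* b] and the bound on
    [I (x) T~] follow the same scheme. The constant 4/9 is the value at 0 of the convex function
    [(2 / (3 - t))^2], and the majorant is its chord over [0, 1].

    The rules prescribe values on a redundant family of elementary tensors, so their consistency is
    at stake as much as boundedness. One inequality between finite combinations settles both, and
    density gives uniqueness. The semigroup law is checked on triple products: associativity holds
    only in the disjoint union of the fibers and is carried into the Hilbert sum, whose type does
    not mention them. Finally [T = S] holds at nonzero indices because the embedding of [H] is
    isometric, and at 0 because both maps are [sigma]. *)

Inductive mexpr (K : Type) :=
  | MVar of nat | MZero | MOpp of mexpr K | MScale of K & mexpr K
  | MAdd of mexpr K & mexpr K.
Arguments MVar {K} n.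
Arguments MZero {K}.

Section ModuleReflection.
Variables (K : pzRingType) (V : lmodType K).

Fixpoint meval (env : seq V) (e : mexpr K) : V :=
  match e with
  | MVar n => nth 0 env n
  | MZero => 0
  | MOpp e => - meval env e
  | MScale c e => c *: meval env e
  | MAdd e f => meval env e + meval env f
  end.

Fixpoint mcoef (e : mexpr K) (i : nat) : K :=
  match e with
  | MVar n => if eqn n i then 1 else 0
  | MZero => 0
  | MOpp e => - mcoef e i
  | MScale c e => c * mcoef e i
  | MAdd e f => mcoef e i + mcoef f i
  end.

(** Recursion on the list of atoms makes computation produce one scalar identity per atom, left to
    [ring] or [field], possibly modulo [ii]. *)
Fixpoint same_coefs (e f : mexpr K) (env : seq V) (i : nat) : Prop :=
  if env is _ :: env' then mcoef e i = mcoef f i /\ same_coefs e f env' i.+1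
  else True.

Lemma mevalE env e :
  meval env e = \sum_(i < size env) mcoef e i *: nth 0 env i.
Proof.
elim: e => [n||e IH|c e IH|e IHe f IHf] /=.
- have [nlt|nge] := ltnP n (size env); last first.
    rewrite nth_default// big1// => i _; case: eqnP => [ni|]; last by rewrite scale0r.
    by have := ltn_ord i; rewrite -ni ltnNge nge.
  rewrite (bigD1 (Ordinal nlt))//=; case: eqnP => [_|//].
  rewrite scale1r big1 ?addr0// => i ni.
  case: eqnP => [E|_]; last by rewrite scale0r.
  by case/eqP: ni; apply/val_inj.
- by rewrite big1// => i _; rewrite scale0r.
- by rewrite IH -sumrN; apply: eq_bigr => i _; rewrite scaleNr.
- by rewrite IH scaler_sumr; apply: eq_bigr => i _; rewrite scalerA.
- by rewrite IHe IHf -big_split/=; apply: eq_bigr => i _; rewrite scalerDl.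
Qed.

Lemma meval_eq env e f : same_coefs e f env 0 -> meval env e = meval env f.
Proof.
move=> ef; rewrite !mevalE; apply: eq_bigr => -[i /= ilt] _; congr (_ *: _).
suff ok l k : same_coefs e f l k -> forall j, (j < size l)%N ->
  mcoef e (k + j) = mcoef f (k + j) by exact: (ok env 0%N ef i ilt).
elim: l k => [//|x l IH] k /= [e0 el] [_|j jl]; first by rewrite addn0.
by rewrite addnS -addSn; exact: IH.
Qed.

End ModuleReflection.

Ltac mem_atom x l :=
  lazymatch l with
  | x :: _ => constr:(true)
  | _ :: ?l' => mem_atom x l'
  | _ => constr:(false)
  end.

Ltac add_atom x l :=
  let b := mem_atom x l in
  lazymatch b with true => l | false => constr:(x :: l) end.

Ltac atoms t l :=
  lazymatch t with
  | ?x + ?y => let l := atoms x l in atoms y l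
  | - ?x => atoms x l
  | _ *: ?x => atoms x l
  | 0 => l
  | _ => add_atom t l
  end.

Ltac atom_index x l :=
  lazymatch l with
  | x :: _ => constr:(O)
  | _ :: ?l' => let n := atom_index x l' in constr:(S n)
  end.

Ltac reify K t l :=
  lazymatch t with
  | ?x + ?y => let a := reify K x l in let b := reify K y l in constr:(@MAdd K a b)
  | - ?x => let a := reify K x l in constr:(@MOpp K a)
  | ?c *: ?x => let a := reify K x l in constr:(@MScale K c a)
  | 0 => constr:(@MZero K)
  | _ => let n := atom_index t l in constr:(@MVar K n)
  end.

Ltac module_start K :=
  lazymatch goal with
  | |- @eq ?V ?x ?y =>
    let l := atoms x (@nil V) in
    let l := atoms y l in
    let a := reify K x l in
    let b := reify K y l in
    change (meval l a = meval l b);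
    apply: meval_eq; cbn [same_coefs mcoef eqn]
  end.

(** * Real-valued norms and scalar growth estimates *)

Section Norms.
Variable R : realType.
Implicit Types (V W : normedModType R[i]).

(** The norm [|x|] lies in [R[i]] and is real; its real part lives in an ordered field, within reach
    of [lra] and [nra]. *)
Definition nrm V (x : V) : R := complex.Re `|x|.

Lemma nrmE V (x : V) : `|x| = (nrm x)%:C.
Proof.
rewrite /nrm [LHS]complexE (@ger0_Im _ `|x|) ?normr_ge0//.
by rewrite mulr0 addr0.
Qed.

Lemma nrm_le V W (x : V) (y : W) : (`|x| <= `|y|) = (nrm x <= nrm y).
Proof. by rewrite !nrmE lecR. Qed.

Lemma nrm_ge0 V (x : V) : 0 <= nrm x.
Proof. by rewrite -ler0c -nrmE normr_ge0. Qed.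

Lemma nrm0 V : nrm (0 : V) = 0.
Proof. by rewrite /nrm normr0. Qed.

Lemma nrm_eq0 V (x : V) : nrm x = 0 -> x = 0.
Proof. by move=> x0; apply: normr0_eq0; rewrite nrmE x0. Qed.

Lemma nrmD V (x y : V) : nrm (x + y) <= nrm x + nrm y.
Proof. by rewrite -lecR rmorphD/= -!nrmE ler_normD. Qed.

Lemma nrmN V (x : V) : nrm (- x) = nrm x.
Proof. by rewrite /nrm normrN. Qed.

Lemma nrmB V (x y : V) : nrm (x - y) <= nrm x + nrm y.
Proof. by rewrite -(nrmN y) nrmD. Qed.

Lemma nrmBC V (x y : V) : nrm (x - y) = nrm (y - x).
Proof. by rewrite -nrmN opprB. Qed.

Lemma nrm_tri V (y x z : V) : nrm (x - z) <= nrm (x - y) + nrm (y - z).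
Proof. by apply: le_trans (nrmD _ _); rewrite addrA subrK. Qed.

Lemma nrmZ V (c : R[i]) (x : V) : nrm (c *: x) = complex.Re `|c| * nrm x.
Proof.
apply: (@complexI R); rewrite rmorphM/= -!nrmE normrZ.
by congr (_ * _); rewrite [LHS]complexE (@ger0_Im _ `|c|) ?normr_ge0.
Qed.

Lemma normcR (r : R) : `|r%:C : R[i]| = `|r|%:C.
Proof. by rewrite normc_def/= expr0n addr0 sqrtr_sqr. Qed.

Lemma nrmZr V (r : R) (x : V) : nrm (r%:C *: x) = `|r| * nrm x.
Proof. by rewrite nrmZ normcR. Qed.

Lemma nrmZr_ge0 V (r : R) (x : V) : 0 <= r -> nrm (r%:C *: x) = r * nrm x.
Proof. by move=> r0; rewrite nrmZr ger0_norm. Qed.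

Lemma ii : 'i%C * 'i%C = -1 :> R[i].
Proof. by rewrite -expr2 sqr_i. Qed.

Lemma sqr_le_mul (x y : R) : 0 <= x -> 0 <= y -> x ^+ 2 <= y ^+ 2 -> x <= y.
Proof. by move=> x0 y0; rewrite ler_pXn2r. Qed.

Lemma le_eps (x y : R) : (forall e, 0 < e -> x <= y + e) -> x <= y.
Proof. by move=> h; apply/ler_addgt0Pr. Qed.

Lemma small_pow (q e : R) : 0 <= q -> q < 1 -> 0 < e -> exists n, q ^+ n < e.
Proof.
move=> q0 q1 e0; have := @cvg_geometric R 1 q; rewrite ger0_norm// => /(_ q1).
move=> /cvgrPdist_lt/(_ e e0)[N _ /(_ N (leqnn _))].
by rewrite /geometric/= mul1r sub0r normrN ger0_norm ?exprn_ge0//; exists N.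
Qed.

Lemma one_sub_lt_bernoulli (d : R) n : 0 <= d -> 1 + n%:R * d <= (1 + d) ^+ n.
Proof.
move=> d0; elim: n => [|n IH]; first by rewrite mul0r addr0 expr0.
rewrite exprS; apply: le_trans (ler_wpM2l _ IH); last by lra.
rewrite -natr1 mulrDl mul1r; have : 0 <= n%:R * d * d by rewrite !mulr_ge0.
by nra.
Qed.

(** Bernoulli's inequality for [x / c = 1 + d] grows linearly, like the factor to be beaten. Applied
    at half the exponent and then squared, it grows quadratically. *)
Lemma le_of_pow_growth (x c a : R) : 0 <= x -> 0 <= c -> 0 <= a ->
  (forall k, x ^+ (2 ^ k) <= c ^+ (2 ^ k) * (1 + (2 ^ k)%:R * a)) -> x <= c.
Proof.
move=> x0 c0 a0 h; rewrite leNgt; apply/negP => xc.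
have [c00|cn0] := eqVneq c 0.
  by have := h 0%N; rewrite expn0 !expr1 c00 mul0r leNgt -{1}c00 xc.
have cp : 0 < c by rewrite lt0r cn0.
set d := x / c - 1; have dp : 0 < d.
  by rewrite /d subr_gt0 ltr_pdivlMr// mul1r.
(* At exponent [2 q] the hypothesis yields [(1 + q d)^2 <= 1 + 2 q a], which fails once
   [q > 2 a / d^2]. *)
pose B := 2 * a / d ^+ 2.
have [m mB] : exists m : nat, B < m%:R.
  exists (Num.truncn `|B|).+1; apply: le_lt_trans (ler_norm _) _.
  by rewrite truncnS_gt.
have h1 := h m.+1; move: h1.
set q := (2 ^ m)%N; have qm : (m <= q)%N by apply/ltnW/ltn_expl.
have qB : B < q%:R by apply: lt_le_trans mB _; rewrite ler_nat.
have xE : x = c * (1 + d) by rewrite /d addrC subrK mulrC divfK.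
rewrite expnS -/q xE exprMn ler_pM2l ?exprn_gt0// mulnC exprM natrM.
have bq := one_sub_lt_bernoulli q (ltW dp).
have qd : 2 * a < q%:R * d ^+ 2 by rewrite -ltr_pdivrMr ?exprn_gt0.
have q0 : 0 < q%:R :> R by rewrite ltr0n expn_gt0.
have sq : (1 + q%:R * d) ^+ 2 <= ((1 + d) ^+ q) ^+ 2.
  by rewrite ler_pXn2r// nnegrE ?exprn_ge0//; nra.
move=> h1; have {h1 sq} : (1 + q%:R * d) ^+ 2 <= 1 + q%:R * 2 * a by exact: le_trans h1.
have : q%:R * (2 * a) < q%:R * (q%:R * d ^+ 2) by rewrite ltr_pM2l.
by nra.
Qed.

End Norms.

Ltac module_coefs :=
  lazymatch goal with R : realType |- _ => module_start (R[i]) end; repeat split.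

Ltac module := module_coefs; ring.

(** * Linear maps as plain functions *)

Section LinearMaps.
Variables (K : pzRingType) (V W : lmodType K) (f : V -> W).
Hypothesis lf : linear f.

Lemma lin0 : f 0 = 0.
Proof.
have := lf 1 0 0; rewrite !scale1r !addr0 => /(congr1 (fun z => z - f 0)).
by rewrite subrr addrK.
Qed.

Lemma linD x y : f (x + y) = f x + f y.
Proof. by have := lf 1 x y; rewrite !scale1r. Qed.

Lemma linZ c x : f (c *: x) = c *: f x.
Proof. by have := lf c x 0; rewrite !addr0 lin0 addr0. Qed.

Lemma linN x : f (- x) = - f x.
Proof. by rewrite -scaleN1r linZ scaleN1r. Qed.

Lemma linB x y : f (x - y) = f x - f y.
Proof. by rewrite linD linN. Qed.

Lemma lin_sum I (r : seq I) (F : I -> V) :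
  f (\sum_(i <- r) F i) = \sum_(i <- r) f (F i).
Proof. by elim/big_rec2: _ => [|i y x _ <-]; [exact: lin0|exact: linD]. Qed.

End LinearMaps.

Lemma linP (K : pzRingType) (V W : lmodType K) (f : V -> W) :
  (forall x y, f (x + y) = f x + f y) -> (forall c x, f (c *: x) = c *: f x) ->
  linear f.
Proof. by move=> fD fZ c x y; rewrite fD fZ. Qed.

(** * The order of a C*-algebra through numerical bounds *)

Section CStarOrder.
Variables (R : realType) (A : cstarAlgType R).
Implicit Types (a b v w : A) (B C : A -> A).

Lemma cmulr_lin a : linear (cmul a).
Proof. by apply: linP => *; [exact: cmulDr|exact: cmulZr]. Qed.

Lemma cmull_lin b : linear (cmul ^~ b).
Proof. by apply: linP => *; [exact: cmulDl|exact: cmulZl]. Qed.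

Lemma cmul0l b : cmul 0 b = 0. Proof. exact: (lin0 (cmull_lin b)). Qed.
Lemma cmul0r a : cmul a 0 = 0. Proof. exact: (lin0 (cmulr_lin a)). Qed.
Lemma cmulNl a b : cmul (- a) b = - cmul a b.
Proof. exact: (linN (cmull_lin b)). Qed.
Lemma cmulNr a b : cmul a (- b) = - cmul a b.
Proof. exact: (linN (cmulr_lin a)). Qed.

Lemma cstar0 : cstar (0 : A) = 0.
Proof.
have := cstarD (0 : A) 0; rewrite addr0 => /(congr1 (fun z => z - cstar 0)).
by rewrite subrr addrK.
Qed.

Lemma cstarZc (c : R[i]) a : cstar (c *: a) = conjc c *: cstar a.
Proof. exact: cstarZ. Qed.

Lemma cstarN a : cstar (- a) = - cstar a.
Proof. by rewrite -scaleN1r cstarZc rmorphN rmorph1 scaleN1r. Qed.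

Lemma cstarZr (r : R) a : cstar (r%:C *: a) = r%:C *: cstar a.
Proof. by rewrite cstarZc conjc_real. Qed.

Lemma nrmM a b : nrm (cmul a b) <= nrm a * nrm b.
Proof. by rewrite -lecR rmorphM/= -!nrmE cnormM. Qed.

Lemma nrm_star_mul a : nrm (cmul (cstar a) a) = nrm a ^+ 2.
Proof. by apply: (@complexI R); rewrite rmorphXn/= -!nrmE cnorm_star. Qed.

Lemma nrm_star a : nrm (cstar a) = nrm a.
Proof.
have le b : nrm b <= nrm (cstar b).
  have [->|b0] := eqVneq (nrm b) 0; first exact: nrm_ge0.
  have bp : 0 < nrm b by rewrite lt0r b0 nrm_ge0.
  by rewrite -(ler_pM2r bp) -expr2 -nrm_star_mul nrmM.
by apply/eqP; rewrite eq_le le -{2}(cstarK a) le.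
Qed.

(** Plays the part of Cauchy-Schwarz for [A] as a module over itself: the C*-identity turns
    [|u v|^2] into the norm of [v^* u' u v]. *)
Lemma nrm_adjoint (u u' : A -> A) v :
  (forall v w, cmul (cstar (u v)) w = cmul (cstar v) (u' w)) ->
  nrm (u v) ^+ 2 <= nrm v * nrm (u' (u v)).
Proof.
by move=> uu; rewrite -nrm_star_mul uu -[leRHS]/(_ * _) -(nrm_star v) nrmM.
Qed.

Definition opb B (c : R) := forall v, nrm (B v) <= c * nrm v.

(** Self-adjoint bounded operators on [A] as a module over itself. They include the self-adjoint
    elements of the unitization, [r + a] acting as [v |-> r v + a v]. *)
Record symop B : Prop := Symop {
  so_lin : linear B;
  so_sym : forall v w, cmul (cstar (B v)) w = cmul (cstar v) (B w);
  so_bnd : exists2 c, 0 <= c & opb B c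
}.

Lemma symop_scalar (r : R) : symop (fun v => r%:C *: v).
Proof.
split.
- by apply: linP => *; rewrite ?scalerDr// !scalerA mulrC.
- by move=> v w; rewrite cstarZr cmulZl cmulZr.
- by exists `|r| => // v; rewrite nrmZr.
Qed.

Lemma symop_add B C : symop B -> symop C -> symop (fun v => B v + C v).
Proof.
move=> [lB sB [b b0 hB]] [lC sC [c c0 hC]]; split.
- apply: linP => [x y|k x]; last by rewrite (linZ lB) (linZ lC) scalerDr.
  by rewrite (linD lB) (linD lC) addrACA.
- by move=> v w; rewrite cstarD cmulDl cmulDr sB sC.
- exists (b + c); first exact: addr_ge0.
  by move=> v; apply: le_trans (nrmD _ _) _; rewrite mulrDl lerD.
Qed.

Lemma symop_comp B C : symop B -> symop C -> (forall v, B (C v) = C (B v)) ->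
  symop (fun v => B (C v)).
Proof.
move=> [lB sB [b b0 hB]] [lC sC [c c0 hC]] BC; split.
- by apply: linP => *; rewrite ?(linD lC) ?(linD lB)// (linZ lC) (linZ lB).
- by move=> v w; rewrite sB sC BC.
- exists (b * c); first exact: mulr_ge0.
  by move=> v; apply: le_trans (hB _) _; rewrite -mulrA ler_wpM2l.
Qed.

Lemma symop_scale (r : R) B : symop B -> symop (fun v => r%:C *: B v).
Proof.
move=> sB; apply: (symop_comp (symop_scalar r) sB) => v.
by rewrite (linZ (so_lin sB)).
Qed.

Lemma symop_opp B : symop B -> symop (fun v => - B v).
Proof.
move=> /(symop_scale (-1)); congr symop; apply/funext => v.
by rewrite rmorphN rmorph1 scaleN1r.
Qed.

Lemma symop_mul a : cstar a = a -> symop (cmul a).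
Proof.
move=> aa; split; first exact: cmulr_lin.
- by move=> v w; rewrite cstarM aa cmulA.
- by exists (nrm a); [exact: nrm_ge0|move=> v; exact: nrmM].
Qed.

(* [ub B m] says that the spectrum of [B] lies below [m]: the numerical bound
   [lim_(s -> +oo) (|s + B| - s)] is at most [m]. Unlike positivity of
   elements of [A], it makes sense for the non-unital operators [r + a]. *)
Definition ub B (m : R) := forall e, 0 < e ->
  exists2 s, 0 <= s & forall v, nrm (s%:C *: v + B v) <= (s + m + e) * nrm v.

Lemma ub_add B C m n : ub B m -> ub C n -> ub (fun v => B v + C v) (m + n).
Proof.
move=> hB hC e e0; have e2 : 0 < e / 2 by rewrite divr_gt0.
have [s s0 hs] := hB _ e2; have [t t0 ht] := hC _ e2.
exists (s + t); first exact: addr_ge0.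
move=> v; have -> : (s + t)%:C *: v + (B v + C v) =
    (s%:C *: v + B v) + (t%:C *: v + C v) by module.
apply: le_trans (nrmD _ _) _; apply: le_trans (lerD (hs v) (ht v)) _.
by rewrite -mulrDl ler_wpM2r ?nrm_ge0//; lra.
Qed.

Lemma ub_le B m n : m <= n -> ub B m -> ub B n.
Proof.
move=> mn hB e e0; have [s s0 hs] := hB _ e0; exists s => // v.
by apply: le_trans (hs v) _; rewrite ler_wpM2r ?nrm_ge0//; lra.
Qed.

Lemma ub_lim B m : (forall e, 0 < e -> ub B (m + e)) -> ub B m.
Proof.
move=> h e e0; have e2 : 0 < e / 2 by rewrite divr_gt0.
have [s s0 hs] := h _ e2 _ e2; exists s => // v; apply: le_trans (hs v) _.
by rewrite ler_wpM2r ?nrm_ge0//; lra.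
Qed.

Lemma ub_opb B c : opb B c -> ub B c.
Proof.
move=> hB e e0; exists 0 => // v; rewrite scale0r !add0r.
by apply: le_trans (hB v) _; rewrite ler_wpM2r ?nrm_ge0//; lra.
Qed.

Lemma ub_scalar (r : R) : ub (fun v => r%:C *: v) r.
Proof.
move=> e e0; exists `|r| => // v; rewrite -scalerDl -rmorphD/= nrmZr.
have rr : 0 <= `|r| + r by have := ler_norm (- r); rewrite normrN; lra.
by rewrite ger0_norm// ler_wpM2r ?nrm_ge0//; lra.
Qed.

Lemma ub_scale (r : R) B m : 0 <= r -> ub B m -> ub (fun v => r%:C *: B v) (r * m).
Proof.
move=> r0 hB e e0; have [->|rn0] := eqVneq r 0.
  exists 0 => // v; rewrite !scale0r addr0 nrm0 mul0r !add0r.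
  by rewrite mulr_ge0 ?nrm_ge0// ltW.
have rp : 0 < r by rewrite lt0r rn0.
have [s s0 hs] := hB (e / r) (divr_gt0 e0 rp).
exists (r * s); first exact: mulr_ge0.
move=> v; have -> : (r * s)%:C *: v + r%:C *: B v =
  r%:C *: (s%:C *: v + B v) by module.
rewrite nrmZr_ge0//; apply: le_trans (ler_wpM2l r0 (hs v)) _.
by rewrite mulrA !mulrDr mulrCA divff// mulr1.
Qed.

Lemma eq_ub B C m : (forall v, B v = C v) -> ub B m -> ub C m.
Proof. by move=> /funext->. Qed.

Lemma ub_near B C m e : opb (fun v => C v - B v) e -> ub B m -> ub C (m + e).
Proof.
move=> /ub_opb he hB; apply: eq_ub (ub_add hB he) => v.
by rewrite addrC subrK.
Qed.

Lemma complex_op_adjoint B C (z : R[i]) v w : symop B -> symop C ->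
  cmul (cstar (B v + z *: C v)) w = cmul (cstar v) (B w + conjc z *: C w).
Proof.
move=> [_ sB _] [_ sC _].
by rewrite cstarD cstarZc cmulDl cmulZl cmulDr cmulZr sB sC.
Qed.

(* [(t + iB)^*(t + iB) = t^2 + B^2 = (t - iB)^*(t - iB)], so [t + iB] and
   [t - iB] are isometric images of each other; and [t^2 - B^2] is the mean of
   their squares. *)
Lemma cayley B (t : R) v : symop B ->
  nrm ((t ^+ 2)%:C *: v - B (B v)) <= nrm ((t ^+ 2)%:C *: v + B (B v)).
Proof.
move=> sB; have lB := so_lin sB.
pose u w := t%:C *: w + 'i%C *: B w.
pose u' w := t%:C *: w + conjc 'i%C *: B w.
have ci : conjc 'i%C = - 'i%C :> R[i] by apply/eqP; rewrite eq_complex/= oppr0 !eqxx.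
have uu' w : u' (u w) = (t ^+ 2)%:C *: w + B (B w).
  by rewrite /u' /u ci (linD lB) !(linZ lB); module_coefs; ring: (ii R).
have u'u w : u (u' w) = (t ^+ 2)%:C *: w + B (B w).
  by rewrite /u' /u ci (linD lB) !(linZ lB); module_coefs; ring: (ii R).
have adj v1 w : cmul (cstar (u v1)) w = cmul (cstar v1) (u' w).
  exact: (complex_op_adjoint _ _ _ (symop_scalar t) sB).
have adj' v1 w : cmul (cstar (u' v1)) w = cmul (cstar v1) (u w).
  rewrite /u -[X in _ + X *: _]conjcK.
  exact: (complex_op_adjoint _ _ _ (symop_scalar t) sB).
have iso w : nrm (u w) = nrm (u' w).
  apply/eqP; rewrite -(@eqrXn2 _ 2) ?nrm_ge0//.
  by rewrite -!nrm_star_mul adj adj' uu' u'u.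
have -> : (t ^+ 2)%:C *: v - B (B v) = (2^-1)%:C *: (u (u v) + u' (u' v)).
  by rewrite /u' /u ci !(linD lB) !(linZ lB); module_coefs; field: (ii R).
have h1 : nrm (u (u v)) = nrm ((t ^+ 2)%:C *: v + B (B v)) by rewrite iso uu'.
have h2 : nrm (u' (u' v)) = nrm ((t ^+ 2)%:C *: v + B (B v)) by rewrite -iso u'u.
have := nrmD (u (u v)) (u' (u' v)); rewrite h1 h2 => h.
by rewrite nrmZr_ge0; lra.
Qed.

(** Up to terms of order [B^4 / t^2], [cayley] at [w = v - B^2 v / t^2] says that
    [|t^2 v - 2 B^2 v| <= t^2 |v|]. Half of this is the claim with [s = t^2 / 2]. *)
Lemma ub_opp_sqr B : symop B -> ub (fun v => - B (B v)) 0.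
Proof.
move=> sB; have lB := so_lin sB; have [c c0 hc] := so_bnd sB => e e0.
have c4 : 0 <= c ^+ 4 by rewrite exprn_ge0.
(* As [t >= 1], one has [c^4 / t^2 <= c^4 / t <= e], so the neglected terms cost at most [e |v|]. *)
pose t := 1 + c ^+ 4 / e.
have t1 : 1 <= t by rewrite lerDl divr_ge0// ltW.
have t0 : t != 0 by rewrite gt_eqF//; lra.
have tC : t%:C != 0 :> R[i] by rewrite (inj_eq (@complexI R) t 0).
exists (t ^+ 2 / 2) => [|v]; first by rewrite divr_ge0 ?sqr_ge0.
pose D w := B (B w); pose w := v - (t ^- 2)%:C *: D v.
have DZ (r : R[i]) x : D (r *: x) = r *: D x by rewrite /D !(linZ lB).
have DB x y : D (x - y) = D x - D y by rewrite /D !(linB lB).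
have Dv : nrm (D (D v)) <= c ^+ 4 * nrm v.
  have h x : nrm (D x) <= c ^+ 2 * nrm x.
    apply: le_trans (hc _) _; rewrite expr2 -mulrA ler_wpM2l//.
  apply: le_trans (h _) _; rewrite -[4%N]/(2 + 2)%N exprD -mulrA.
  by rewrite ler_wpM2l// sqr_ge0.
have := cayley t w sB; rewrite -!/(D _) => hcay.
have e1 : (t ^+ 2)%:C *: w + D w = (t ^+ 2)%:C *: v - (t ^- 2)%:C *: D (D v).
  rewrite /w DB DZ; module_coefs; field => //.
have e2 : (t ^+ 2 / 2)%:C *: v - D v =
    (2^-1)%:C *: (((t ^+ 2)%:C *: w - D w) - (t ^- 2)%:C *: D (D v)).
  rewrite /w DB DZ; module_coefs; field => //.
rewrite e2 nrmZr_ge0; last by lra.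
rewrite e1 in hcay.
have b1 := nrmB ((t ^+ 2)%:C *: w - D w) ((t ^- 2)%:C *: D (D v)).
have b2 := nrmB ((t ^+ 2)%:C *: v) ((t ^- 2)%:C *: D (D v)).
have ti0 : 0 <= t ^- 2 by rewrite invr_ge0 sqr_ge0.
rewrite nrmZr_ge0// in b1; rewrite !nrmZr_ge0 ?sqr_ge0// in b2.
have b3 : t ^- 2 * nrm (D (D v)) <= e * nrm v.
  rewrite mulrC ler_pdivrMr; last by rewrite exprn_gt0// lt0r t0; lra.
  apply: le_trans Dv _; rewrite [leRHS]mulrAC.
  rewrite ler_wpM2r ?nrm_ge0//.
  have h4 : c ^+ 4 <= e * t by rewrite /t mulrDr mulr1 mulrCA divff ?gt_eqF// mulr1; lra.
  by apply: le_trans h4 _; rewrite ler_wpM2l//; nra.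
by have := nrm_ge0 v; nra.
Qed.

Lemma ub_near_sqr B C e : symop C -> 
  opb (fun v => B v - C (C v)) e -> ub (fun v => - B v) e.
Proof.
move=> sC h; rewrite -[e]add0r.
apply: ub_near (ub_opp_sqr sC) => v.
by rewrite opprK addrC nrmBC; exact: h.
Qed.
(* Visser's iteration: [1 - visser X n] converges to the square root of
   [1 - X]. *)
Fixpoint visser (X : A -> A) n : A -> A :=
  if n is n'.+1 then
    fun v => (2^-1)%:C *: (X v + visser X n' (visser X n' v))
  else fun=> 0.

Lemma visser_lin X n : linear X -> linear (visser X n).
Proof.
move=> lX; elim: n => [|n IH] /=.
  by apply: linP => *; rewrite ?addr0 ?scaler0.
apply: linP => [x y|c x]; first by rewrite !(linD lX, linD IH); module.
by rewrite !(linZ lX, linZ IH); module.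
Qed.

Lemma visser_sym X n : symop X ->
  forall v w, cmul (cstar (visser X n v)) w = cmul (cstar v) (visser X n w).
Proof.
move=> sX; elim: n => [|n IH] v w /=; first by rewrite cstar0 cmul0l cmul0r.
by rewrite cstarZr cstarD cmulZl cmulZr cmulDl cmulDr (so_sym sX) !IH.
Qed.

Lemma visser_comm X n Z : linear Z -> (forall v, Z (X v) = X (Z v)) ->
  forall v, Z (visser X n v) = visser X n (Z v).
Proof.
move=> lZ ZX; elim: n => [|n IH] v /=; first exact: lin0.
by rewrite (linZ lZ) (linD lZ) ZX !IH.
Qed.

(** [r] is a fixed point of the scalar iteration [w |-> (2 r - r^2 + w^2) / 2], so norms that start
    at 0 never pass it. *)
Lemma visser_opb X n r : 0 <= r -> opb X (2 * r - r ^+ 2) -> opb (visser X n) r.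
Proof.
move=> r0 hX; elim: n => [|n IH] v /=.
  by rewrite nrm0 mulr_ge0 ?nrm_ge0.
rewrite nrmZr_ge0; last by lra.
have := nrmD (X v) (visser X n (visser X n v)).
have := hX v; have := IH (visser X n v); have := IH v.
have := nrm_ge0 v; have := nrm_ge0 (visser X n v) => h0 h1 h2 h3 h4.
have h5 : r * nrm (visser X n v) <= r * (r * nrm v) by rewrite ler_wpM2l.
by lra.
Qed.

(** Writing [W^2 - W'^2 = W (W - W') + (W - W') W'], each step shrinks the increment by the factor
    [(r + r) / 2]. *)
Lemma visser_cauchy X n r v : linear X -> 0 <= r -> r < 1 ->
  opb X (2 * r - r ^+ 2) ->
  nrm (visser X n.+1 v - visser X n v) <= r ^+ n * nrm v.
Proof.
move=> lX r0 r1 hX; elim: n v => [|n IH] v.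
  rewrite /= addr0 subr0 nrmZr_ge0 ?expr0; last by lra.
  have := hX v; have := mulr_ge0 (nrm_ge0 v) (sqr_ge0 (1 - r)).
  by have := nrm_ge0 v; have := nrm_ge0 (X v); lra.
set W := visser X n.+1; set W' := visser X n.
have lW : linear W by exact: visser_lin.
have -> : visser X n.+2 v - W v =
    (2^-1)%:C *: (W (W v - W' v) + (W (W' v) - W' (W' v))).
  by rewrite (linB lW) /W /W' /=; module.
rewrite nrmZr_ge0; last by lra.
have := nrmD (W (W v - W' v)) (W (W' v) - W' (W' v)).
have h1 : nrm (W (W v - W' v)) <= r * (r ^+ n * nrm v).
  by apply: le_trans (visser_opb _ r0 hX _) _; rewrite ler_wpM2l// IH.
have h2 : nrm (W (W' v) - W' (W' v)) <= r ^+ n * (r * nrm v).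
  apply: le_trans (IH _) _; rewrite ler_wpM2l ?exprn_ge0//.
  exact: visser_opb.
by rewrite exprS; lra.
Qed.

(** After rescaling to [1 - X] with [|X| < 1], Visser's iteration applies. Since [1 - 2 W + W^2] is
    [1 - X] plus twice the next increment, the error of [C^2] is read off [visser_cauchy].
    Commutation passes to [C], a polynomial in [B]. *)
Lemma approx_sqrt B e : symop B -> ub (fun v => - B v) 0 -> 0 < e ->
  exists C, [/\ symop C,
    forall Z, linear Z -> (forall v, Z (B v) = B (Z v)) ->
      forall v, Z (C v) = C (Z v)
    & opb (fun v => B v - C (C v)) e].
Proof.
move=> sB hB e0; have lB := so_lin sB.
have [s s0 hs] := hB (e / 4) ltac:(lra).
(* [T] exceeds the bound [s + e / 4] on [s - B], which makes [rho < 1]. The price is that [C^2]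
   approximates [T (1 - X) = B + e / 2]. *)
pose T := s + e / 2; have T0 : 0 < T by rewrite /T; lra.
have TC : T%:C != 0 :> R[i] by rewrite (inj_eq (@complexI R) T 0) gt_eqF.
pose X v := (T^-1)%:C *: (s%:C *: v - B v).
have sX : symop X.
  by apply/symop_scale/(symop_add (symop_scalar s))/symop_opp.
pose rho := (s + e / 4) / T.
have rho1 : rho <= 1 by rewrite ler_pdivrMr// /T; lra.
have rho1' : rho < 1 by rewrite ltr_pdivrMr// /T; lra.
have rho0 : 0 <= rho by rewrite divr_ge0// ?ltW//; lra.
pose r := 1 - Num.sqrt (1 - rho).
have rE : 2 * r - r ^+ 2 = rho.
  have := @sqr_sqrtr _ (1 - rho) ltac:(lra); rewrite /r.
  by move=> h; rewrite -[RHS]/(rho); ring: h.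
have q0 : 0 < Num.sqrt (1 - rho) by rewrite sqrtr_gt0; lra.
have q1 : Num.sqrt (1 - rho) <= 1.
  by rewrite -[leRHS]sqrtr1 ler_wsqrtr//; lra.
have r0 : 0 <= r by rewrite /r; lra.
have r1 : r < 1 by rewrite /r; lra.
have hX : opb X (2 * r - r ^+ 2).
  have Ti0 : 0 <= T^-1 by rewrite invr_ge0 ltW.
  move=> v; rewrite rE nrmZr_ge0//.
  rewrite (_ : rho * nrm v = T^-1 * ((s + e / 4) * nrm v)); last by rewrite /rho; ring.
  rewrite ler_wpM2l//.
  by have := hs v; rewrite addr0.
have [n hn] := small_pow r0 r1 (divr_gt0 e0 (mulr_gt0 (ltr0n R 4) T0)).
pose W := visser X n; have lW : linear W by exact/visser_lin/(so_lin sX).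
have sW : symop W by split=> //; [exact: visser_sym|exists r => //; exact: visser_opb].
pose C v := (Num.sqrt T)%:C *: (1%:C *: v + - W v).
exists C; split.
- exact/symop_scale/(symop_add (symop_scalar 1))/symop_opp.
- move=> Z lZ ZB v; rewrite /C !(linZ lZ, linD lZ, linN lZ).
  rewrite (visser_comm n lZ)// => w.
  by rewrite /X !(linZ lZ, linD lZ, linN lZ) ZB.
- move=> v.
  have TT : (Num.sqrt T)%:C * (Num.sqrt T)%:C = T%:C :> R[i].
    by rewrite -rmorphM/= -expr2 sqr_sqrtr// ltW.
  have -> : B v - C (C v) = - ((e / 2)%:C *: v) -
     (2 * T)%:C *: (visser X n.+1 v - visser X n v).
    have -> : C (C v) = T%:C *: (v - W v - W v + W (W v)).
      by rewrite /C !(linZ lW, linD lW, linN lW); module_coefs; ring: TT.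
    have -> : B v = (T - e / 2)%:C *: v - T%:C *: X v.
      rewrite /X scalerA -rmorphM/= mulfV ?gt_eqF// rmorph1 scale1r /T.
      by module_coefs; ring.
    by rewrite /= -/W; module_coefs; field.
  apply: le_trans (nrmB _ _) _; rewrite nrmN !nrmZr_ge0; try by lra.
  have := visser_cauchy n v (so_lin sX) r0 r1 hX.
  have : r ^+ n * (4 * T) < e by rewrite -ltr_pdivlMr// mulr_gt0.
  set x := nrm (_ - _); have := nrm_ge0 v; move: (nrm v) (r ^+ n) => N q.
  move=> N0 h1 h2; have h3 : T * x <= T * (q * N) by rewrite ler_wpM2l// ltW.
  have h4 : (q * (4 * T)) * N <= e * N by rewrite ler_wpM2r// ltW.
  by lra.
Qed.

(** If [D^2] is close to [B], then [C B C] is close to the square of [C D], which is symmetric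
    because [D] commutes with [C]. *)
Lemma conj_ub_opp B C : symop B -> symop C -> (forall v, B (C v) = C (B v)) ->
  ub (fun v => - B v) 0 -> ub (fun v => - C (B (C v))) 0.
Proof.
move=> sB sC BC hB; have [c c0 hc] := so_bnd sC.
apply: ub_lim => e e0; rewrite add0r.
have c2 : 0 < c ^+ 2 + 1 by have := sqr_ge0 c; lra.
have [D [sD Dcomm hD]] := approx_sqrt sB hB (divr_gt0 e0 c2).
have CD v : C (D v) = D (C v) by apply: Dcomm (so_lin sC) _ v => w; rewrite BC.
apply: (ub_near_sqr (C := fun v => C (D v))); first exact: symop_comp.
move=> v /=; rewrite (CD v) -(linB (so_lin sC)).
apply: le_trans (hc _) _.
apply: le_trans (ler_wpM2l c0 (hD _)) _.
apply: le_trans (ler_wpM2l c0 (ler_wpM2l (ltW (divr_gt0 e0 c2)) (hc _))) _.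
have : e / (c ^+ 2 + 1) * (c ^+ 2 + 1) = e by rewrite divfK ?gt_eqF.
have : 0 <= e / (c ^+ 2 + 1) by rewrite divr_ge0 ?(ltW c2) ?(ltW e0).
move: (e / _) => k k0 kE; have := mulr_ge0 k0 (nrm_ge0 v).
have -> : e * nrm v = k * (c ^+ 2 + 1) * nrm v by rewrite kE.
by lra.
Qed.

(* With [e^2 ~ m + C] and [d^2 ~ m - C], the operator [u = e + i d] satisfies
   [u^* u ~ 2 m], while [4 C ~ u^2 + (u^* )^2]. *)
Lemma opb_of_ub C m : symop C -> 0 <= m -> ub C m -> ub (fun v => - C v) m ->
  opb C m.
Proof.
move=> sC m0 h1 h2; have lC := so_lin sC.
pose E v := m%:C *: v + C v; pose D v := m%:C *: v + - C v.
have sE : symop E by exact: symop_add (symop_scalar m) sC.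
have sD : symop D by exact: symop_add (symop_scalar m) (symop_opp sC).
have hE : ub (fun v => - E v) 0.
  rewrite -(subrr m) addrC; apply: eq_ub (ub_add (ub_scalar (- m)) h2) => v.
  by rewrite /E; module.
have hD : ub (fun v => - D v) 0.
  rewrite -(subrr m) addrC; apply: eq_ub (ub_add (ub_scalar (- m)) h1) => v.
  by rewrite /D; module.
move=> v; apply: le_eps => r r0.
have [v0|v0] := eqVneq (nrm v) 0.
  by rewrite (nrm_eq0 v0) (lin0 lC) nrm0 mulr0 add0r ltW.
have vp : 0 < nrm v by rewrite lt0r v0 nrm_ge0.
(* The approximation errors of [e] and [d] add up to [2 k |v| = r] in the end. *)
pose k := r / (2 * nrm v).
have k0 : 0 < k by rewrite divr_gt0// mulr_gt0.
have [e [se ecomm he]] := approx_sqrt sE hE k0.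
have [d [sd dcomm hd]] := approx_sqrt sD hD k0.
have le := so_lin se; have ld := so_lin sd.
have de w : d (e w) = e (d w).
  apply: (ecomm _ ld) => x; rewrite (dcomm _ (so_lin sE))// => y.
  by rewrite /E /D !(linD lC, linN lC, linZ lC); module.
pose u w := e w + 'i%C *: d w.
pose u' w := e w + conjc 'i%C *: d w.
have ci : conjc 'i%C = - 'i%C :> R[i] by apply/eqP; rewrite eq_complex/= oppr0 !eqxx.
have adj v1 w : cmul (cstar (u v1)) w = cmul (cstar v1) (u' w).
  exact: complex_op_adjoint.
have adj' v1 w : cmul (cstar (u' v1)) w = cmul (cstar v1) (u w).
  by rewrite /u -[X in _ + X *: _]conjcK; exact: complex_op_adjoint.
have near w : nrm (e (e w) + d (d w)) <= (2 * m + 2 * k) * nrm w.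
  have -> : e (e w) + d (d w) =
     (2 * m)%:C *: w - ((E w - e (e w)) + (D w - d (d w))).
    by rewrite /E /D; module.
  apply: le_trans (nrmB _ _) _; rewrite nrmZr_ge0 ?mulr_ge0//.
  have := nrmD (E w - e (e w)) (D w - d (d w)); have := he w; have := hd w.
  by lra.
have uu' w : u' (u w) = e (e w) + d (d w).
  rewrite /u' /u ci !(linD le, linD ld, linZ le, linZ ld) de.
  by module_coefs; ring: (ii R).
have u'u w : u (u' w) = e (e w) + d (d w).
  rewrite /u' /u ci !(linD le, linD ld, linZ le, linZ ld) de.
  by module_coefs; ring: (ii R).
have K0 : 0 <= 2 * m + 2 * k by lra.
have sq (f f' : A -> A) :
    (forall v w, cmul (cstar (f v)) w = cmul (cstar v) (f' w)) ->
    (forall w, f' (f w) = e (e w) + d (d w)) ->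
    nrm (f (f v)) <= (2 * m + 2 * k) * nrm v.
  move=> ff f'f; have b w : nrm (f w) ^+ 2 <= (2 * m + 2 * k) * nrm w ^+ 2.
    apply: le_trans (nrm_adjoint _ ff) _; rewrite f'f expr2 mulrCA.
    by rewrite ler_wpM2l ?nrm_ge0.
  apply: sqr_le_mul; rewrite ?mulr_ge0 ?nrm_ge0//.
  apply: le_trans (b _) _; rewrite exprMn [X in _ <= X * _]expr2 -mulrA.
  by rewrite ler_wpM2l// b.
have h3 := sq _ _ adj uu'; have h4 := sq _ _ adj' u'u.
have CE : C v = (4^-1)%:C *: ((u (u v) + u' (u' v)) +
   ((E v - e (e v)) - (D v - d (d v))) + ((E v - e (e v)) - (D v - d (d v)))).
  rewrite /u' /u ci !(linD le, linD ld, linZ le, linZ ld) de /E /D.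
  by module_coefs; field: (ii R).
rewrite CE nrmZr_ge0; last by lra.
have h5 : nrm ((E v - e (e v)) - (D v - d (d v))) <= 2 * k * nrm v.
  have := nrmB (E v - e (e v)) (D v - d (d v)); have := he v; have := hd v.
  by lra.
have h6 := nrmD (u (u v)) (u' (u' v)).
set z := (_ - _ : A) in CE h5 *.
have h7 := nrmD (u (u v) + u' (u' v) + z) z.
have h8 := nrmD (u (u v) + u' (u' v)) z.
have kv : k * nrm v = r / 2 by rewrite /k; field.
by lra.
Qed.

End CStarOrder.

(** * Growth of log-convex sequences *)

Section LogConvex.
Variable R : realType.

(** The doubling inequality iterates to [(y 1 / y 0)^(2^k) <= y (2^k) / y 0]; roots of order [2^k]
    then erase [K] and the linear factor. *)
Lemma log_convex_growth (y : nat -> R) (K c a : R) :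
  (forall n, 0 <= y n) -> (forall n, y n ^+ 2 <= y 0%N * y (2 * n)%N) ->
  0 <= K -> 0 <= c -> 0 <= a ->
  (forall n, y n <= K * (c ^+ n * (1 + n%:R * a))) -> y 1%N <= c * y 0%N.
Proof.
move=> y0 ysq K0 c0 a0 hy.
have [y00|yn0] := eqVneq (y 0%N) 0.
  have := ysq 1%N; rewrite y00 mul0r mulr0 => h.
  by have := y0 1%N; nra.
have yp : 0 < y 0%N by rewrite lt0r yn0 y0.
have grow k : y 1%N ^+ (2 ^ k) * y 0%N <= y 0%N ^+ (2 ^ k) * y (2 ^ k)%N.
  elim: k => [|k IH]; first by rewrite expn0 !expr1 mulrC.
  rewrite -(ler_pM2r yp) expnS.
  have -> : y 1%N ^+ (2 * 2 ^ k) * y 0%N * y 0%N = (y 1%N ^+ (2 ^ k) * y 0%N) ^+ 2.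
    by rewrite mulnC exprM; ring.
  have -> : y 0%N ^+ (2 * 2 ^ k) * y (2 * 2 ^ k)%N * y 0%N =
      (y 0%N ^+ (2 ^ k)) ^+ 2 * (y 0%N * y (2 * 2 ^ k)%N).
    by rewrite [X in y 0%N ^+ X]mulnC exprM; ring.
  have h : (y 1%N ^+ (2 ^ k) * y 0%N) ^+ 2 <= (y 0%N ^+ (2 ^ k) * y (2 ^ k)%N) ^+ 2.
    by rewrite ler_pXn2r// nnegrE mulr_ge0 ?exprn_ge0.
  apply: le_trans h _; rewrite exprMn ler_wpM2l ?sqr_ge0//.
(* [K / y 0] is absorbed into the linear factor: [K (1 + q a) <= K q (1 + a)] because
   [q = 2^k >= 1]. *)
rewrite -ler_pdivrMr//; apply: (@le_of_pow_growth _ _ _ (K / y 0%N * (1 + a))) => //.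
- by rewrite divr_ge0// ltW.
- by rewrite mulr_ge0// ?divr_ge0// ?ltW//; lra.
move=> k; set q := (2 ^ k)%N.
have q1 : 1 <= q%:R :> R by rewrite ler1n expn_gt0.
rewrite expr_div_n ler_pdivrMr ?exprn_gt0//.
rewrite -(ler_pM2r yp); apply: le_trans (grow k) _.
set t := (1 + _ * _ : R).
have -> : c ^+ q * t * y 0%N ^+ q * y 0%N = y 0%N ^+ q * (c ^+ q * (t * y 0%N)).
  by ring.
rewrite -/q ler_wpM2l ?exprn_ge0//; apply: le_trans (hy q) _.
rewrite mulrCA ler_wpM2l ?exprn_ge0// /t.
have -> : (1 + q%:R * (K / y 0%N * (1 + a))) * y 0%N = y 0%N + q%:R * K * (1 + a).
  by field.
by have := mulr_ge0 K0 a0; nra.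
Qed.

End LogConvex.

(** * Positivity of [b^* b] and the positive cone *)

Section Positivity.
Variables (R : realType) (A : cstarAlgType R).
Implicit Types (a b v w : A) (B C : A -> A).

Lemma iter_sym B n : symop B ->
  forall v w, cmul (cstar (iter n B v)) w = cmul (cstar v) (iter n B w).
Proof.
move=> sB; elim: n => [//|n IH] v w.
by rewrite iterS iterSr (so_sym sB) IH.
Qed.

Lemma opb_of_growth B c t : symop B -> 0 <= c -> 0 <= t ->
  (forall n v, nrm (iter n B v) <= c ^+ n * (1 + n%:R * t) * nrm v) -> opb B c.
Proof.
move=> sB c0 t0 h v.
apply: (@log_convex_growth _ (fun n => nrm (iter n B v)) (nrm v) c t) => //.
- by move=> n; exact: nrm_ge0.
- move=> n; rewrite mul2n -addnn iterD /=.
  exact: (nrm_adjoint _ (iter_sym n sB)).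
- exact: nrm_ge0.
- by move=> n; rewrite mulrC; exact: h.
Qed.

(** [b^* b] and [b b^*] have the same spectrum away from 0. In terms of norms, [P = s + b b^*] and
    [Q = s + b^* b] satisfy [P^(n+1) v = s P^n v + b Q^n b^* v], so [P^n] exceeds [c^n] by at most a
    linear factor, which [opb_of_growth] removes. *)
Lemma ub_mul_swap b m : 0 <= m ->
  ub (cmul (cmul (cstar b) b)) m -> ub (cmul (cmul b (cstar b))) m.
Proof.
move=> m0 h e e0; have [s s0 hs] := h e e0; exists s => //.
pose c := s + m + e; have c0 : 0 < c by rewrite /c; lra.
pose P v := s%:C *: v + cmul (cmul b (cstar b)) v.
pose Q v := s%:C *: v + cmul (cmul (cstar b) b) v.
have sP : symop P.
  by apply: (symop_add (symop_scalar A s)); apply: symop_mul; rewrite cstarM cstarK.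
have Qn n v : nrm (iter n Q v) <= c ^+ n * nrm v.
  elim: n => [|n IH]; first by rewrite expr0 mul1r.
  rewrite iterS exprS -mulrA; apply: le_trans (hs _) _.
  by rewrite ler_wpM2l// ltW.
have bQ n v : cmul b (iter n Q v) = iter n P (cmul b v).
  elim: n v => [//|n IH] v; rewrite !iterSr IH /Q /P cmulDr cmulZr.
  by rewrite !cmulA.
have PD n v w : iter n P (v + w) = iter n P v + iter n P w.
  by elim: n => [//|n IH]; rewrite !iterS IH (linD (so_lin sP)).
have PZ n k v : iter n P (k *: v) = k *: iter n P v.
  by elim: n => [//|n IH]; rewrite !iterS IH (linZ (so_lin sP)).
pose a := nrm b ^+ 2 / c; have a0 : 0 <= a by rewrite divr_ge0 ?sqr_ge0// ltW.
apply: (opb_of_growth sP (ltW c0) a0) => n.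
elim: n => [|n IH] v; first by rewrite /= mul0r addr0 expr0 !mul1r.
rewrite iterSr PD PZ -cmulA -bQ.
apply: le_trans (nrmD _ _) _; rewrite nrmZr_ge0//.
have h1 : nrm (cmul b (iter n Q (cmul (cstar b) v))) <=
    nrm b * (c ^+ n * (nrm b * nrm v)).
  apply: le_trans (nrmM _ _) _; rewrite ler_wpM2l ?nrm_ge0//.
  apply: le_trans (Qn _ _) _; rewrite ler_wpM2l ?exprn_ge0 ?(ltW c0)//.
  by rewrite -(nrm_star b) nrmM.
have h2 : s * nrm (iter n P v) <= c * (c ^+ n * (1 + n%:R * a) * nrm v).
  apply: ler_pM => //; first exact: nrm_ge0.
  by rewrite /c; lra.
have ca : c * a = nrm b ^+ 2 by rewrite /a mulrC divfK// gt_eqF.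
have -> : c ^+ n.+1 * (1 + n.+1%:R * a) * nrm v =
    c * (c ^+ n * (1 + n%:R * a) * nrm v) + c ^+ n * (c * a) * nrm v.
  by rewrite exprS -natr1; ring.
by rewrite ca; lra.
Qed.

(** The vector [a^*] serves as test vector in place of a unit: [|a|^2 = |a a^*| <= c |a^*|]. *)
Lemma nrm_le_opb a c : 0 <= c -> opb (cmul a) c -> nrm a <= c.
Proof.
move=> c0 h; have [->|a0] := eqVneq (nrm a) 0; first by [].
have ap : 0 < nrm a by rewrite lt0r a0 nrm_ge0.
rewrite -(ler_pM2r ap) -expr2 -[X in X ^+ 2]nrm_star -nrm_star_mul cstarK.
by apply: le_trans (h _) _; rewrite nrm_star.
Qed.

(** Bounds the negative parts of all [b^* b] at once. Uniformity over the unit ball matters, since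
    the improvement for [b] uses the bound at another element [x]. *)
Definition lower_bound_squares (k : R) :=
  forall b, nrm b <= 1 -> ub (fun v => - cmul (cmul (cstar b) b) v) k.

Lemma lower_bound_squares_scale k b : lower_bound_squares k ->
  ub (fun v => - cmul (cmul (cstar b) b) v) (nrm b ^+ 2 * k).
Proof.
move=> h; have [b0|bn0] := eqVneq (nrm b) 0.
  rewrite b0 expr2 mul0r mul0r (nrm_eq0 b0).
  by apply: eq_ub (ub_scalar A 0) => v; rewrite scale0r cmul0r cmul0l oppr0.
have bp : 0 < nrm b by rewrite lt0r bn0 nrm_ge0.
have := h ((nrm b)^-1%:C *: b); rewrite nrmZr_ge0 ?invr_ge0 ?nrm_ge0//.
rewrite mulVf// => /(_ (lexx _)) /(ub_scale (sqr_ge0 (nrm b))).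
apply: eq_ub => v; rewrite cstarZr !cmulZl !cmulZr cmulZl scalerN !scalerA -!rmorphM/=.
by rewrite (_ : _ * _ = 1) ?rmorph1 ?scale1r//; field.
Qed.

(* With [a = b^* b] and [x = b - b a], the element [y = x^* x = a (1 - a)^2] is
   at most [4/27], hence so is [x x^*]; and [x x^* + x^* x] is a sum of two
   squares of self-adjoint elements, so [|y| <= 4/27]. Since [y <= a], lower
   bounds for [y] pass to [a]. *)
Lemma lower_bound_squares_step k : 0 <= k ->
  lower_bound_squares k -> lower_bound_squares (4 / 27 * k).
Proof.
move=> k0 hk b b1; pose a := cmul (cstar b) b.
have sa : cstar a = a by rewrite cstarM cstarK.
have a1 : nrm a <= 1 by rewrite nrm_star_mul expr_le1 ?nrm_ge0.
have sL := symop_mul sa.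
have ubL : ub (cmul a) 1.
  by apply: ub_opb => v; apply: le_trans (nrmM _ _) _; rewrite ler_wpM2r ?nrm_ge0.
pose x := b - cmul b a; pose y := cmul (cstar x) x.
have yE v : cmul y v =
    cmul a v - cmul a (cmul a v) - cmul a (cmul a v) + cmul a (cmul a (cmul a v)).
  rewrite /y /x cstarD cstarN cstarM sa.
  rewrite !(cmulDl, cmulDr, cmulNl, cmulNr) -!cmulA.
  by rewrite !(cmulA (cstar b) b) -/a; module.
have sy : cstar y = y by rewrite cstarM cstarK.
(* From [4/27 - t (1 - t)^2 = (t - 1/3)^2 (4/3 - t)]: the maximum of [t (1 - t)^2] is reached at
   1/3, and [4/3 - a] is positive as [|a| <= 1]. *)
pose c1 : R := 1 / 3; pose c2 : R := 4 / 3.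
have upy : ub (cmul y) (4 / 27).
  pose C v := (- c1)%:C *: v + cmul a v.
  pose B v := c2%:C *: v + - cmul a v.
  have sC : symop C by exact: symop_add (symop_scalar A _) sL.
  have sB : symop B by exact: symop_add (symop_scalar A _) (symop_opp sL).
  have Bpos : ub (fun v => - B v) 0.
    apply: (@ub_le _ _ _ (- c2 + 1)); first by rewrite /c2; lra.
    by apply: eq_ub (ub_add (ub_scalar A _) ubL) => v; rewrite /B; module.
  have BC v : B (C v) = C (B v).
    by rewrite /B /C !(cmulDr, cmulZr, cmulNr); module.
  have := ub_add (ub_scalar A (4 / 27)) (conj_ub_opp sB sC BC Bpos).
  rewrite addr0; apply: eq_ub => v.
  rewrite yE /B /C !(cmulDr, cmulZr, cmulNr) /c1 /c2.
  by module_coefs; field.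
have upx : ub (cmul (cmul x (cstar x))) (4 / 27) by apply: ub_mul_swap => //; lra.
pose p := x + cstar x; pose q := 'i%C *: (x - cstar x).
have sp : cstar p = p by rewrite /p cstarD cstarK addrC.
have ci : conjc 'i%C = - 'i%C :> R[i] by apply/eqP; rewrite eq_complex/= oppr0 !eqxx.
have sq : cstar q = q.
  by rewrite /q cstarZc cstarD cstarN cstarK ci; module.
have lowy : ub (fun v => - cmul y v) (4 / 27).
  have h2 : (0 : R) <= 2^-1 by lra.
  have hp := ub_scale h2 (ub_opp_sqr (symop_mul sp)).
  have hq := ub_scale h2 (ub_opp_sqr (symop_mul sq)).
  have := ub_add (ub_add upx hp) hq; rewrite mulr0 !addr0; apply: eq_ub => v.
  rewrite /y /p /q !(cmulDl, cmulDr, cmulZl, cmulZr, cmulNl, cmulNr) -!cmulA.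
  by module_coefs; field: (ii R).
have y27 : nrm y <= 4 / 27.
  have h : (0 : R) <= 4 / 27 by lra.
  by apply: nrm_le_opb => //; apply: opb_of_ub => //; exact: symop_mul.
have lowy' : ub (fun v => - cmul y v) (4 / 27 * k).
  apply: ub_le (lower_bound_squares_scale x hk).
  by rewrite -nrm_star_mul ler_wpM2r.
(* [a - y = a (2 - a) a] is positive, so the upper bound on [- y] passes to [- a]. *)
pose B v := 2%:C *: v + - cmul a v.
have sB : symop B by exact: symop_add (symop_scalar A _) (symop_opp sL).
have Bpos : ub (fun v => - B v) 0.
  apply: (@ub_le _ _ _ (- 2 + 1)); first by lra.
  by apply: eq_ub (ub_add (ub_scalar A _) ubL) => v; rewrite /B; module.
have BC v : B (cmul a v) = cmul a (B v).
  by rewrite /B !(cmulDr, cmulZr, cmulNr).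
have := ub_add lowy' (conj_ub_opp sB sL BC Bpos).
rewrite addr0; apply: eq_ub => v.
by rewrite -/a yE /B !(cmulDr, cmulZr, cmulNr); module.
Qed.

Lemma ub_opp_star_mul b : ub (fun v => - cmul (cmul (cstar b) b) v) 0.
Proof.
have h n : lower_bound_squares ((4 / 27) ^+ n).
  elim: n => [|n IH]; last first.
    by rewrite exprS; apply: lower_bound_squares_step IH; rewrite exprn_ge0//; lra.
  rewrite expr0 => {}b b1; apply: ub_opb => v; rewrite nrmN.
  apply: le_trans (nrmM _ _) _; rewrite ler_wpM2r ?nrm_ge0//.
  by rewrite nrm_star_mul expr_le1 ?nrm_ge0.
have N0 : 0 < nrm b ^+ 2 + 1 by have := sqr_ge0 (nrm b); lra.
apply: ub_lim => e e0; rewrite add0r.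
have q0 : (0 : R) <= 4 / 27 by lra.
have q1 : 4 / 27 < 1 :> R by lra.
have [n hn] := small_pow q0 q1 (divr_gt0 e0 N0).
apply: ub_le (lower_bound_squares_scale b (h n)).
have : (4 / 27) ^+ n * (nrm b ^+ 2 + 1) <= e by rewrite -ler_pdivlMr// ltW.
by have := exprn_ge0 n q0; lra.
Qed.

(** [cpositive] asks for a factorization and is not visibly stable under sums. This form is plainly
    a cone, and it contains every [b^* b] by the lemma above. *)
Definition cpos a := cstar a = a /\ ub (fun v => - cmul a v) 0.

Lemma cpos_star_mul b : cpos (cmul (cstar b) b).
Proof. by split; [rewrite cstarM cstarK|exact: ub_opp_star_mul]. Qed.

Lemma cpos_cpositive a : cpositive a -> cpos a.
Proof. by move=> [b ->]; exact: cpos_star_mul. Qed.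

Lemma cposD a b : cpos a -> cpos b -> cpos (a + b).
Proof.
move=> [sa ha] [sb hb]; split; first by rewrite cstarD sa sb.
have := ub_add ha hb; rewrite addr0; apply: eq_ub => v.
by rewrite cmulDl opprD.
Qed.

Lemma cposZ (r : R) a : 0 <= r -> cpos a -> cpos (r%:C *: a).
Proof.
move=> r0 [sa /(ub_scale r0) ha]; split; first by rewrite cstarZr sa.
by move: ha; rewrite mulr0; apply: eq_ub => v; rewrite cmulZl scalerN.
Qed.

Lemma cpos0 : cpos 0.
Proof. by rewrite -(cmul0r (cstar 0)); exact: cpos_star_mul. Qed.

Lemma cpos_sum I (r : seq I) (F : I -> A) :
  (forall i, cpos (F i)) -> cpos (\sum_(i <- r) F i).
Proof. by move=> h; elim/big_ind: _ => //; [exact: cpos0|exact: cposD]. Qed.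

Lemma nrm_le_cpos a b : cpos a -> cpos (b - a) -> nrm a <= nrm b.
Proof.
move=> [sa ha] [_ hb]; apply: nrm_le_opb; first exact: nrm_ge0.
have bb : ub (cmul b) (nrm b) by apply: ub_opb => v; exact: nrmM.
apply: opb_of_ub; [exact: symop_mul|exact: nrm_ge0| |].
  have := ub_add bb hb; rewrite addr0; apply: eq_ub => v.
  by rewrite cmulDl cmulNl; module.
exact: ub_le (nrm_ge0 b) ha.
Qed.

(** [r - a] is only an operator, but its approximate root [C] sends [v] into [A], and
    [v^* (r - a) v] is close to the square of [C v]. *)
Lemma cpos_conj a (r : R) v : cstar a = a -> nrm a <= r ->
  cpos (r%:C *: cmul (cstar v) v - cmul (cstar v) (cmul a v)).
Proof.
move=> sa ar; have sL := symop_mul sa.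
pose B v := r%:C *: v + - cmul a v.
have sB : symop B by exact: symop_add (symop_scalar A r) (symop_opp sL).
have hL : ub (cmul a) r.
  by apply: ub_opb => w; apply: le_trans (nrmM _ _) _; rewrite ler_wpM2r ?nrm_ge0.
have Bpos : ub (fun v => - B v) 0.
  rewrite -(subrr r) addrC; apply: eq_ub (ub_add (ub_scalar A (- r)) hL) => w.
  by rewrite /B; module.
have -> : r%:C *: cmul (cstar v) v - cmul (cstar v) (cmul a v) =
  cmul (cstar v) (B v) by rewrite cmulDr cmulZr cmulNr.
split; first by rewrite cstarM cstarK (so_sym sB).
have N0 : 0 < nrm v ^+ 2 + 1 by have := sqr_ge0 (nrm v); lra.
apply: ub_lim => e e0; rewrite add0r.
have [C [sC _ hC]] := approx_sqrt sB Bpos (divr_gt0 e0 N0).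
have [_ hp] := cpos_star_mul (C v).
rewrite -[e]add0r; apply: ub_near hp => w.
rewrite (so_sym sC) opprK addrC -cmulNl -cmulDl -cmulNr -cmulDr.
apply: le_trans (nrmM _ _) _; rewrite ler_wpM2r ?nrm_ge0//.
apply: le_trans (nrmM _ _) _; rewrite nrm_star nrmBC.
apply: le_trans (ler_wpM2l (nrm_ge0 v) (hC v)) _.
have eE : e / (nrm v ^+ 2 + 1) * (nrm v ^+ 2 + 1) = e by rewrite divfK ?gt_eqF.
have : 0 <= e / (nrm v ^+ 2 + 1) by rewrite divr_ge0 ?(ltW N0) ?(ltW e0).
by move: eE; move: (e / _) => k <- k0; lra.
Qed.

End Positivity.
(** * Extension of contractions from a total family *)

Section Closure.
Variable R : realType.
Implicit Types (V W : normedModType R[i]).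

Definition comb I V (g : I -> V) (r : seq (R[i] * I)) : V :=
  \sum_(p <- r) p.1 *: g p.2.

Lemma comb_cat I V (g : I -> V) r s : comb g (r ++ s) = comb g r + comb g s.
Proof. by rewrite /comb big_cat. Qed.

Definition scale_comb I (c : R[i]) (r : seq (R[i] * I)) :=
  [seq (c * p.1, p.2) | p <- r].

Lemma comb_scale I V (g : I -> V) c r : comb g (scale_comb c r) = c *: comb g r.
Proof. by rewrite /comb big_map scaler_sumr; apply: eq_bigr => p _; rewrite scalerA. Qed.

Lemma comb_lin I V W (g : I -> V) (f : V -> W) r : linear f ->
  f (comb g r) = comb (f \o g) r.
Proof.
move=> lf; rewrite /comb (lin_sum lf); apply: eq_bigr => p _.
by rewrite (linZ lf).
Qed.

Definition cspan I V (g : I -> V) (v : V) :=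
  forall e : R, 0 < e -> exists r, nrm (v - comb g r) < e.

Lemma cspan_lim I V (g : I -> V) v :
  (forall e, 0 < e -> exists a, cspan g a /\ nrm (v - a) < e) -> cspan g v.
Proof.
move=> h e e0; have e2 : 0 < e / 2 by rewrite divr_gt0.
have [a [/(_ _ e2)[r hr] va]] := h _ e2; exists r.
by have := nrm_tri a v (comb g r); lra.
Qed.

Lemma cspan_comb I V (g : I -> V) r : cspan g (comb g r).
Proof. by move=> e e0; exists r; rewrite subrr nrm0. Qed.

Lemma cspan_gen I V (g : I -> V) i : cspan g (g i).
Proof. by have := cspan_comb g [:: (1, i)]; rewrite /comb big_seq1 scale1r. Qed.

Lemma cspan0 I V (g : I -> V) : cspan g 0.
Proof. by have := cspan_comb g [::]; rewrite /comb big_nil. Qed.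

Lemma cspanD I V (g : I -> V) v w : cspan g v -> cspan g w -> cspan g (v + w).
Proof.
move=> hv hw e e0; have e2 : 0 < e / 2 by rewrite divr_gt0.
have [r hr] := hv _ e2; have [s hs] := hw _ e2; exists (r ++ s).
rewrite comb_cat opprD addrACA.
by have := nrmD (v - comb g r) (w - comb g s); lra.
Qed.

Lemma cspanZ I V (g : I -> V) c v : cspan g v -> cspan g (c *: v).
Proof.
move=> hv e e0; set k := complex.Re `|c|.
have k0 : 0 <= k by rewrite -ler0c /k -(nrmE (c : R[i]^o)) normr_ge0.
have k1 : 0 < k + 1 by lra.
have [r hr] := hv _ (divr_gt0 e0 k1); exists (scale_comb c r).
rewrite comb_scale -scalerBr nrmZ -/k.
have : nrm (v - comb g r) * (k + 1) < e by rewrite -ltr_pdivlMr.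
by have := nrm_ge0 (v - comb g r); lra.
Qed.

Lemma cspan_sum I V (g : I -> V) J (s : seq J) (F : J -> V) :
  (forall j, cspan g (F j)) -> cspan g (\sum_(j <- s) F j).
Proof. by move=> h; elim/big_ind: _ => //; [exact: cspan0|exact: cspanD]. Qed.

Lemma dense_nrm V (D : set V) (v : V) (e : R) : dense D -> 0 < e ->
  exists2 a, D a & nrm (v - a) < e.
Proof.
move=> /(_ (ball v e%:C)) h e0; have e0C : 0 < e%:C :> R[i] by rewrite ltcR.
have [||a [va Da]] := h.
- by exists v; exact: ballxx.
- exact: ball_open.
- exists a => //; move: va; rewrite -ball_normE /ball_/=.
  by rewrite nrmE ltcR.
Qed.

Lemma dense_cspan I V (g : I -> V) (D : set V) :
  dense (lin_span D) -> (forall v, D v -> cspan g v) -> forall v, cspan g v.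
Proof.
move=> dD h v; apply: cspan_lim => e e0.
have [_ [n [c [u [Du ->]]]] ve] := dense_nrm v dD e0.
eexists; split; last exact: ve.
by apply: cspan_sum => i; exact/cspanZ/h.
Qed.

Lemma bounded_linear_nrm V W (f : V -> W) : bounded_linear f ->
  exists2 c, 0 <= c & forall x, nrm (f x) <= c * nrm x.
Proof.
move=> [_ [[a b] hc]]; exists `|a| => // x.
have := hc x; rewrite !nrmE lecE => /andP[_ /=]; rewrite mulr0 subr0 => h.
by apply: le_trans h _; rewrite ler_wpM2r ?nrm_ge0 ?ler_norm.
Qed.

Lemma linear_contraction_nrm V W (f : V -> W) :
  linear_contraction f <-> linear f /\ forall x, nrm (f x) <= nrm x.
Proof. by split=> -[lf hf]; split=> // x; have := hf x; rewrite nrm_le. Qed.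

Lemma linear_contraction_bounded V W (f : V -> W) :
  linear_contraction f -> bounded_linear f.
Proof. by move=> [lf hf]; split=> //; exists 1 => x; rewrite mul1r. Qed.

Lemma eq_on_cspan I V W (g : I -> V) (f1 f2 : V -> W) :
  bounded_linear f1 -> bounded_linear f2 -> (forall i, f1 (g i) = f2 (g i)) ->
  forall v, cspan g v -> f1 v = f2 v.
Proof.
move=> b1 b2 h v hv; have [l1 _] := b1; have [l2 _] := b2.
have [c c0 hc] := bounded_linear_nrm b1; have [d d0 hd] := bounded_linear_nrm b2.
apply/eqP; rewrite -subr_eq0; apply/eqP/nrm_eq0/le_anti.
rewrite nrm_ge0 andbT; apply: le_eps => e e0; rewrite add0r.
have k0 : 0 < c + d + 1 by lra.
have [r hr] := hv _ (divr_gt0 e0 k0).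
have -> : f1 v - f2 v = f1 (v - comb g r) - f2 (v - comb g r).
  rewrite (linB l1) (linB l2) !(comb_lin _ _ l1, comb_lin _ _ l2).
  have -> : comb (f1 \o g) r = comb (f2 \o g) r.
    by apply: eq_bigr => p _ /=; rewrite h.
  by module.
have : nrm (v - comb g r) * (c + d + 1) < e by rewrite -ltr_pdivlMr.
have := nrmB (f1 (v - comb g r)) (f2 (v - comb g r)).
have := hc (v - comb g r); have := hd (v - comb g r).
by have := nrm_ge0 (v - comb g r); lra.
Qed.

(** The inequality on combinations gives consistency together with the bound: a combination that
    vanishes on [g] vanishes on [w]. The map is the closure [rel] of the graph, total by
    completeness of [W]. *)
Lemma contraction_extension I V (W : completeNormedModType R[i])
    (g : I -> V) (w : I -> W) :
  (forall v, cspan g v) -> (forall r, nrm (comb w r) <= nrm (comb g r)) ->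
  exists2 f : V -> W, linear_contraction f & forall i, f (g i) = w i.
Proof.
move=> dg hw; pose rel v y := forall e : R, 0 < e ->
  exists r, nrm (v - comb g r) < e /\ nrm (y - comb w r) < e.
have rel_ex v : exists y, rel v y.
  pose B (e : R) : set W := [set y | exists2 r, nrm (v - comb g r) < e & y = comb w r].
  pose F := filter_from [set e : R | 0 < e] B.
  have FF : ProperFilter F.
    apply: filter_from_proper; last first.
      by move=> e e0; have [r hr] := dg v e e0; exists (comb w r), r.
    apply: filter_from_filter; first by exists 1 => /=.
    move=> e d e0 d0; exists (Num.min e d); first by rewrite /= lt_min e0.
    by move=> y [r]; rewrite lt_min => /andP[h1 h2] ->; split; exists r.
  have cF : cauchy F.
    apply: cauchy_exP => e e0.
    have [eps eps0 eE] : exists2 eps : R, 0 < eps & e = eps%:C.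
      exists (complex.Re e); last by rewrite RRe_real// gtr0_real.
      by move: e0; rewrite ltcE => /andP[].
    have e2 : 0 < eps / 2 by rewrite divr_gt0.
    have [r hr] := dg v _ e2; exists (comb w r); exists (eps / 2) => //.
    move=> y [s hs ->]; rewrite -ball_normE /ball_/= nrmE eE ltcR.
    have -> : comb w r - comb w s = comb w (r ++ scale_comb (-1) s).
      by rewrite comb_cat comb_scale scaleN1r.
    apply: le_lt_trans (hw _) _; rewrite comb_cat comb_scale scaleN1r.
    by have := nrm_tri v (comb g r) (comb g s); rewrite (nrmBC _ v); lra.
  have [y Fy] : exists y : W, F --> y by exists (lim F); exact: (cauchy_cvg F cF).
  exists y => e e0; have e0C : 0 < e%:C :> R[i] by rewrite ltcR.
  have [d d0 hd] : F (ball y e%:C) by apply: Fy; exact: nbhsx_ballx.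
  have m0 : 0 < Num.min d e by rewrite lt_min d0.
  have [r hr] := dg v _ m0; move: hr; rewrite lt_min => /andP[h1 h2].
  exists r; split=> //; have : ball y e%:C (comb w r) by apply: hd; exists r.
  by rewrite -ball_normE /ball_/= nrmE ltcR.
have relD v1 y1 v2 y2 c : rel v1 y1 -> rel v2 y2 -> rel (c *: v1 + v2) (c *: y1 + y2).
  move=> h1 h2 e e0; set k := complex.Re `|c|.
  have k0 : 0 <= k by rewrite -ler0c /k -(nrmE (c : R[i]^o)) normr_ge0.
  have k1 : 0 < k + 1 by lra.
  have [r [hr hr']] := h1 _ (divr_gt0 (divr_gt0 e0 (ltr0n R 2)) k1).
  have [s [hs hs']] := h2 _ (divr_gt0 e0 (ltr0n R 2)).
  exists (scale_comb c r ++ s); rewrite !comb_cat !comb_scale.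
  have aux (U : normedModType R[i]) (a b a' b' : U) :
      nrm (a - a') < e / 2 / (k + 1) -> nrm (b - b') < e / 2 ->
      nrm (c *: a + b - (c *: a' + b')) < e.
    move=> h3 h4.
    have -> : c *: a + b - (c *: a' + b') = c *: (a - a') + (b - b') by module.
    apply: le_lt_trans (nrmD _ _) _; rewrite nrmZ -/k.
    have : nrm (a - a') * (k + 1) < e / 2 by rewrite -ltr_pdivlMr.
    by have := nrm_ge0 (a - a'); lra.
  by split; exact: aux.
have rel_le v y : rel v y -> nrm y <= nrm v.
  move=> h; apply: le_eps => e e0; have [r [h1 h2]] := h _ (divr_gt0 e0 (ltr0n R 2)).
  have := hw r; have := nrmD (y - comb w r) (comb w r); rewrite subrK.
  have := nrmD (comb g r - v) v; rewrite subrK nrmBC.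
  by lra.
have rel_uniq v y z : rel v y -> rel v z -> y = z.
  move=> hy hz; apply/eqP; rewrite -subr_eq0; apply/eqP/nrm_eq0/le_anti.
  rewrite nrm_ge0 andbT; have := relD _ _ _ _ (-1) hz hy.
  rewrite !scaleN1r addNr addrC => /rel_le; by rewrite nrm0.
have [f hf] := choice rel_ex; exists f.
  apply/linear_contraction_nrm; split=> [c x y|x]; last exact: rel_le.
  by apply: (rel_uniq (c *: x + y)) => //; exact: relD.
move=> i; apply: (rel_uniq (g i)) => // e e0; exists [:: (1, i)].
by rewrite /comb !big_seq1 !scale1r !subrr !nrm0.
Qed.

End Closure.

(** * Real parts of inner products and Young's inequality *)

Section RealInner.
Variables (R : realType) (H : hilbertType R).
Implicit Types x y z : H.

Definition ipr x y : R := complex.Re (inner x y).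

Lemma inner_lin x : linear (inner x : H -> R[i]^o).
Proof. by apply: linP => [y z|c y]; [exact: innerDr|exact: innerZr]. Qed.

Lemma innerDl x y z : inner (x + y) z = inner x z + inner y z.
Proof. by rewrite inner_conj innerDr rmorphD/= -!inner_conj. Qed.

Lemma innerZl (c : R[i]) x y : inner (c *: x) y = conjc c * inner x y.
Proof. by rewrite inner_conj innerZr rmorphM/= -inner_conj. Qed.

Lemma inner0r x : inner x 0 = 0.
Proof. exact: lin0 (inner_lin x). Qed.

Lemma inner_sumr x I (r : seq I) (F : I -> H) :
  inner x (\sum_(i <- r) F i) = \sum_(i <- r) inner x (F i).
Proof.
by elim/big_rec2: _ => [|i y z _ <-]; [exact: inner0r|exact: innerDr].
Qed.

Lemma inner_suml x I (r : seq I) (F : I -> H) :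
  inner (\sum_(i <- r) F i) x = \sum_(i <- r) inner (F i) x.
Proof.
rewrite inner_conj inner_sumr rmorph_sum/=; apply: eq_bigr => i _.
by rewrite -inner_conj.
Qed.

Lemma iprxx x : ipr x x = nrm x ^+ 2.
Proof. by rewrite /ipr inner_norm nrmE -rmorphXn. Qed.

Lemma iprC x y : ipr x y = ipr y x.
Proof. by rewrite /ipr inner_conj; case: (inner _ _). Qed.

Lemma iprDr x y z : ipr x (y + z) = ipr x y + ipr x z.
Proof. by rewrite /ipr innerDr; case: (inner _ _) => a b; case: (inner _ _). Qed.

Lemma iprZr x (r : R) y : ipr x (r%:C *: y) = r * ipr x y.
Proof. by rewrite /ipr innerZr; case: (inner _ _) => a b /=; rewrite mul0r subr0. Qed.

Lemma nrm_sqr_comb (a b : R) x y :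
  nrm (a%:C *: x + b%:C *: y) ^+ 2 =
  a ^+ 2 * nrm x ^+ 2 + 2 * (a * b) * ipr x y + b ^+ 2 * nrm y ^+ 2.
Proof.
rewrite -!iprxx iprDr !iprZr !(iprC (_ + _)) !iprDr !iprZr (iprC y x).
by ring.
Qed.

Lemma nrm0_inner x : inner x x = 0 -> x = 0.
Proof.
move=> h; apply: nrm_eq0; have := iprxx x; rewrite /ipr h /=.
by move=> /esym/eqP; rewrite sqrf_eq0 => /eqP.
Qed.

End RealInner.

Lemma young (R : realType) (a b l : R) : 0 < l ->
  (a + b) ^+ 2 <= (1 + l) * a ^+ 2 + (1 + l^-1) * b ^+ 2.
Proof.
move=> l0; rewrite -subr_ge0.
rewrite (_ : _ - _ = (l * a - b) ^+ 2 / l) ?divr_ge0 ?sqr_ge0 ?(ltW l0)//.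
by field; rewrite gt_eqF.
Qed.

Lemma nrm_young (R : realType) (V : normedModType R[i]) (x y : V) (l : R) :
  0 < l -> nrm (x + y) ^+ 2 <= (1 + l) * nrm x ^+ 2 + (1 + l^-1) * nrm y ^+ 2.
Proof.
move=> l0; apply: le_trans (young _ _ l0).
by rewrite ler_pXn2r ?nnegrE ?addr_ge0 ?nrm_ge0 ?nrmD.
Qed.

(** The constant is crude; it only serves to rescale rows and Gram operators below 1. *)
Lemma nrm_sqr_sum_bounded (R : realType) (V : normedModType R[i]) (I Z : Type)
    (s : seq I) (w : I -> Z -> V) (N : I -> Z -> R) :
  (forall i z, 0 <= N i z) ->
  (forall i, exists2 c, 0 <= c & forall z, nrm (w i z) ^+ 2 <= c * N i z) ->
  exists2 K, 0 <= K &
    forall z, nrm (\sum_(i <- s) w i z) ^+ 2 <= K * \sum_(i <- s) N i z.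
Proof.
move=> N0 hw; elim: s => [|i s [K K0 hK]].
  by exists 0 => // z; rewrite !big_nil nrm0 mulr0 expr0n.
have [c c0 hc] := hw i; exists (2 * K + 2 * c); first lra.
move=> z; rewrite !big_cons.
apply: le_trans (nrm_young _ _ ltr01) _; rewrite invr1.
have S0 : 0 <= \sum_(j <- s) N j z by apply: sumr_ge0.
have := mulr_ge0 K0 (N0 i z); have := mulr_ge0 c0 S0.
by have := hK z; have := hc z; lra.
Qed.

(** * Hilbert modules, representations and their tensor products *)

Section HilbertModuleFacts.
Variables (R : realType) (A : cstarAlgType R) (E : corrType A).
Implicit Types (x y z : E) (a b : A).

Lemma ip_lin x : linear (ip x : E -> A).
Proof. by apply: linP => [y z|c y]; [exact: ipDr|exact: ipZr]. Qed.

Lemma ipDl x y z : ip (x + y) z = ip x z + ip y z.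
Proof. by rewrite ip_star ipDr cstarD -!ip_star. Qed.

Lemma ipZl (c : R[i]) x z : ip (c *: x) z = conjc c *: ip x z.
Proof. by rewrite ip_star ipZr cstarZc -ip_star. Qed.

Lemma ipZrl (r : R) x z : ip (r%:C *: x) z = r%:C *: ip x z.
Proof. by rewrite ipZl conjc_real. Qed.

Lemma ipNl x z : ip (- x) z = - ip x z.
Proof. by rewrite -scaleN1r ipZl rmorphN rmorph1 scaleN1r. Qed.

Lemma ip_rmull x a y : ip (rmul x a) y = cmul (cstar a) (ip x y).
Proof. by rewrite ip_star ip_rmul cstarM -ip_star. Qed.

Lemma rmull_lin a : linear (fun x => rmul x a).
Proof. by apply: linP => *; [exact: rmulDl|exact: rmulZl]. Qed.

Lemma rmulr_lin x : linear (rmul x : A -> E).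
Proof. by apply: linP => *; [exact: rmulDr|exact: rmulZr]. Qed.

Lemma lmulr_lin a : linear (lmul a : E -> E).
Proof. by apply: linP => *; [exact: lmulDr|exact: lmulZr]. Qed.

Lemma lmull_lin x : linear (fun a : A => lmul a x).
Proof. by apply: linP => *; [exact: lmulDl|exact: lmulZl]. Qed.

Lemma ip_suml x I (r : seq I) (F : I -> E) :
  ip (\sum_(i <- r) F i) x = \sum_(i <- r) ip (F i) x.
Proof.
elim/big_rec2: _ => [|i y z _ <-]; last exact: ipDl.
by rewrite ip_star (lin0 (ip_lin x)) cstar0.
Qed.

Lemma nrm_ip x : nrm (ip x x) = nrm x ^+ 2.
Proof. by apply: (@complexI R); rewrite rmorphXn/= -!nrmE ip_norm. Qed.

Lemma cpos_ip x : cpos (ip x x).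
Proof. exact/cpos_cpositive/ip_pos. Qed.

End HilbertModuleFacts.

Section StarRep.
Variables (R : realType) (A : cstarAlgType R) (H : hilbertType R).
Variables (sigma : A -> H -> H) (hs : star_rep sigma).

Lemma star_rep_lin a : linear (sigma a).
Proof. by case: hs => /(_ a)[]. Qed.

Lemma star_rep_linl h : linear (sigma ^~ h).
Proof. by case: hs. Qed.

Lemma star_repM a b h : sigma (cmul a b) h = sigma a (sigma b h).
Proof. by case: hs. Qed.

Variables (E : corrType A) (Y : rep_tensor E sigma).

(** The prescribed inner products force the balance relation: the difference [d] is orthogonal to
    every elementary tensor, hence to itself. *)
Lemma rt_rmul x a h : rt_tens Y (rmul x a) h = rt_tens Y x (sigma a h).
Proof.
apply/eqP; rewrite -subr_eq0; apply/eqP/nrm0_inner.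
set d := _ - _; have orth z k : inner (rt_tens Y z k) d = 0.
  by rewrite (linB (inner_lin _)) !rt_inner ip_rmul star_repM subrr.
have -> : inner d d = inner (rt_tens Y (rmul x a) h) d -
    inner (rt_tens Y x (sigma a h)) d.
  by rewrite {1}/d innerDl -scaleN1r innerZl rmorphN rmorph1 mulN1r.
by rewrite !orth subrr.
Qed.

Lemma rt_total v : cspan (fun p : E * H => rt_tens Y p.1 p.2) v.
Proof.
apply: (dense_cspan (@rt_dense _ _ _ _ _ Y)) => {}v [x [h ->]].
exact: (cspan_gen (fun p : E * H => rt_tens Y p.1 p.2) (x, h)).
Qed.

Lemma rt_nrm_bounded x : exists2 c, 0 <= c &
  forall h, nrm (rt_tens Y x h) ^+ 2 <= c * nrm h ^+ 2.
Proof.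
case: hs => /(_ (ip x x)) b _ _ _; have [c c0 hc] := bounded_linear_nrm b.
exists c => // h; have -> : nrm (rt_tens Y x h) ^+ 2 = ipr h (sigma (ip x x) h).
  by rewrite -iprxx /ipr rt_inner.
set k := sigma _ h.
have cs : ipr h k <= nrm h * nrm k.
  have [h0|hn0] := eqVneq (nrm h) 0.
    by rewrite (nrm_eq0 h0) iprC /ipr inner0r nrm0 mul0r.
  have hp : 0 < nrm h by rewrite lt0r hn0 nrm_ge0.
  have := sqr_ge0 (nrm ((nrm k)%:C *: h + (- nrm h)%:C *: k)).
  rewrite nrm_sqr_comb => h1; have [k0|kn0] := eqVneq (nrm k) 0.
    by rewrite (nrm_eq0 k0) /ipr inner0r nrm0 mulr0.
  have kp : 0 < nrm k by rewrite lt0r kn0 nrm_ge0.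
  have := mulr_gt0 hp kp; nra.
by apply: le_trans cs _; have := hc h; have := nrm_ge0 h; rewrite -/k; nra.
Qed.

End StarRep.
(** * Contractivity of the associated map *)

Section AssociatedContraction.
Variables (R : realType) (A : cstarAlgType R) (E : corrType A).
Variables (H : hilbertType R) (sigma : A -> H -> H) (T : E -> H -> H).
Hypothesis hT : cc_representation sigma T.
Variable Y : rep_tensor E sigma.

Local Notation hs := (cc_star_rep hT).

Lemma rep_linr x : linear (T x).
Proof. by case: (cc_bounded hT x). Qed.

Lemma rep_linl h : linear (T ^~ h).
Proof. exact: cc_linear hT h. Qed.

Section Rows.
Variable n : nat.
Implicit Types (x : 'I_n -> E) (f g r : 'I_n -> H) (v : 'I_n -> A).

Definition sqn g : R := \sum_i nrm (g i) ^+ 2.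
Definition dot f g : R := \sum_i ipr (f i) (g i).
Definition row_tens x g : Y := \sum_i rt_tens Y (x i) (g i).
Definition row_rep x g : H := \sum_i T (x i) (g i).
Definition gram x g : 'I_n -> H := fun i => \sum_j sigma (ip (x i) (x j)) (g j).
Definition row_mul x v : E := \sum_i rmul (x i) (v i).
Definition lincomb (a : R) f (b : R) g : 'I_n -> H :=
  fun i => a%:C *: f i + b%:C *: g i.

Lemma sqn_ge0 g : 0 <= sqn g.
Proof. by apply: sumr_ge0 => i _; rewrite sqr_ge0. Qed.

Lemma sqn_lincomb a f b g :
  sqn (lincomb a f b g) = a ^+ 2 * sqn f + 2 * (a * b) * dot f g + b ^+ 2 * sqn g.
Proof.
rewrite /sqn /dot !mulr_sumr -!big_split/=; apply: eq_bigr => i _.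
exact: nrm_sqr_comb.
Qed.

Lemma row_tens_lincomb x a f b g :
  row_tens x (lincomb a f b g) = a%:C *: row_tens x f + b%:C *: row_tens x g.
Proof.
rewrite /row_tens !scaler_sumr -big_split/=; apply: eq_bigr => i _.
by rewrite !(linD (rt_linearr Y _), linZ (rt_linearr Y _)).
Qed.

Lemma row_rep_lincomb x a f b g :
  row_rep x (lincomb a f b g) = a%:C *: row_rep x f + b%:C *: row_rep x g.
Proof.
rewrite /row_rep !scaler_sumr -big_split/=; apply: eq_bigr => i _.
by rewrite !(linD (rep_linr _), linZ (rep_linr _)).
Qed.

Lemma dot_gram x f g : dot f (gram x g) = ipr (row_tens x f) (row_tens x g).
Proof.
rewrite /dot /ipr /row_tens inner_suml raddf_sum/=; apply: eq_bigr => i _.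
congr (complex.Re _); rewrite !inner_sumr; apply: eq_bigr => j _.
by rewrite rt_inner.
Qed.

Lemma sqn_young f g l : 0 < l ->
  sqn (lincomb 1 f 1 g) <= (1 + l) * sqn f + (1 + l^-1) * sqn g.
Proof.
move=> l0; rewrite /sqn !mulr_sumr -big_split/=; apply: ler_sum => i _.
by rewrite /lincomb rmorph1 !scale1r; exact: nrm_young.
Qed.

Lemma row_tens_bounded x : exists2 K : R, 0 <= K &
  forall g, nrm (row_tens x g) ^+ 2 <= K * sqn g.
Proof.
apply: nrm_sqr_sum_bounded => [i g|i]; first exact: sqr_ge0.
have [c c0 hc] := rt_nrm_bounded hs Y (x i).
by exists c => // g; exact: hc.
Qed.

(** [G <= 1] in two guises: on [A^n], where complete contractivity tests it, and on [H^n], where the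
    estimate takes place. Carrying both along avoids deriving the second from positivity of matrices
    over [A]. *)
Definition row_contraction x :=
  (forall v, cpos (\sum_i cmul (cstar (v i)) (v i) - ip (row_mul x v) (row_mul x v)))
  /\ forall g, nrm (row_tens x g) ^+ 2 <= sqn g.

(* The row [x (3 - <x, x>) / 2]: one Newton step towards the polar part of
   [x]. *)
Definition newton x : 'I_n -> E :=
  fun j => (3 / 2)%:C *: x j - (2^-1)%:C *: \sum_i rmul (x i) (ip (x i) (x j)).

Definition newton_arg x g : 'I_n -> H := lincomb (3 / 2) g (- 2^-1) (gram x g).

Lemma row_tens_newton x g : row_tens (newton x) g = row_tens x (newton_arg x g).
Proof.
rewrite /newton_arg row_tens_lincomb {1 2}/row_tens /newton.
under eq_bigr => j _.
  rewrite (linB (rt_linearl Y _)) !(linZ (rt_linearl Y _)) (lin_sum (rt_linearl Y _)).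
  under eq_bigr => i _ do rewrite (rt_rmul hs).
  over.
rewrite sumrB -!scaler_sumr exchange_big/= rmorphN scaleNr; congr (_ - _ *: _).
by rewrite /row_tens /gram; apply: eq_bigr => i _; rewrite (lin_sum (rt_linearr Y _)).
Qed.

Lemma row_rep_newton x g : row_rep (newton x) g = row_rep x (newton_arg x g).
Proof.
rewrite /newton_arg row_rep_lincomb {1 2}/row_rep /newton.
under eq_bigr => j _.
  rewrite (linB (rep_linl _)) !(linZ (rep_linl _)) (lin_sum (rep_linl _)).
  under eq_bigr => i _ do rewrite (cc_rmul hT).
  over.
rewrite sumrB -!scaler_sumr exchange_big/= rmorphN scaleNr; congr (_ - _ *: _).
by rewrite /row_rep /gram; apply: eq_bigr => i _; rewrite (lin_sum (rep_linr _)).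
Qed.

(* The moments [<g, G^k g>], [k <= 3], of the Gram operator [G]: they satisfy
   the inequalities [G^2 <= G], [G^3 <= G^2] and [G (1 - G)^2 >= 0]. *)
Lemma gram_moments x g : row_contraction x ->
  let N0 := sqn g in let N1 := nrm (row_tens x g) ^+ 2 in
  let N2 := sqn (gram x g) in let N3 := nrm (row_tens x (gram x g)) ^+ 2 in
  [/\ dot g (gram x g) = N1, ipr (row_tens x g) (row_tens x (gram x g)) = N2,
      N3 <= N2, N1 <= N0 & 0 <= N1 - 2 * N2 + N3].
Proof.
move=> [_ hx] N0 N1 N2 N3.
have e1 : dot g (gram x g) = N1 by rewrite dot_gram iprxx.
have e2 : ipr (row_tens x g) (row_tens x (gram x g)) = N2.
  rewrite iprC -dot_gram /N2 /sqn /dot; apply: eq_bigr => i _; exact: iprxx.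
split=> //; try exact: hx.
have := sqr_ge0 (nrm (row_tens x (lincomb 1 g (- 1) (gram x g)))).
by rewrite row_tens_lincomb nrm_sqr_comb e2 -/N1 -/N2 -/N3; lra.
Qed.

Lemma newton_moments x g : row_contraction x ->
  let N0 := sqn g in let N1 := nrm (row_tens x g) ^+ 2 in
  let N2 := sqn (gram x g) in let N3 := nrm (row_tens x (gram x g)) ^+ 2 in
  sqn (newton_arg x g) = 9 / 4 * N0 - 3 / 2 * N1 + N2 / 4 /\
  nrm (row_tens x (newton_arg x g)) ^+ 2 = 9 / 4 * N1 - 3 / 2 * N2 + N3 / 4.
Proof.
move=> hx; have [e1 e2 _ _ _] := gram_moments g hx => N0 N1 N2 N3; split.
  by rewrite sqn_lincomb e1 -/N1 -/N0 -/N2; lra.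
by rewrite row_tens_lincomb nrm_sqr_comb e2 -/N1 -/N2 -/N3; lra.
Qed.

(** Rests on [1 - t (3 - t)^2 / 4 = (3/4) (1 - t)^2 + (1/4) (1 - t)^3] at [t = G], where the cube is
    the hypothesis applied to [(1 - G) v], respectively [(1 - G) g]. *)
Lemma row_contraction_newton x : row_contraction x -> row_contraction (newton x).
Proof.
move=> hx; have [hA hH] := hx; split=> [v|g]; last first.
  rewrite row_tens_newton; have [_ ->] := newton_moments g hx.
  have [_ _ h1 h2 h3] := gram_moments g hx.
  have [e1 e2 _ _ _] := gram_moments g hx.
  have h4 := hH (lincomb 1 g (- 1) (gram x g)).
  have h5 := sqn_ge0 (lincomb 1 g (- 1) (gram x g)); move: h4 h5.
  rewrite row_tens_lincomb nrm_sqr_comb e2 sqn_lincomb e1.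
  by lra.
set z := row_mul x v; set th := \sum_i rmul (x i) (ip (x i) z).
have zE : row_mul (newton x) v = (3 / 2)%:C *: z - (2^-1)%:C *: th.
  rewrite /row_mul /newton.
  under eq_bigr => j _.
    rewrite (linB (rmull_lin _)) !(linZ (rmull_lin _)) (lin_sum (rmull_lin _)).
    under eq_bigr => i _ do rewrite rmulA -ip_rmul.
    over.
  rewrite sumrB -!scaler_sumr exchange_big/=; congr (_ - _ *: _).
  by apply: eq_bigr => i _; rewrite -(lin_sum (rmulr_lin _)) -(lin_sum (ip_lin _)).
pose w i := v i - ip (x i) z.
have xw : row_mul x w = z - th.
  by rewrite /row_mul /w -sumrB; apply: eq_bigr => i _; rewrite (linB (rmulr_lin _)).
have h1 : \sum_i cmul (cstar (v i)) (ip (x i) z) = ip z z.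
  by rewrite {2}/z ip_suml; apply: eq_bigr => i _; rewrite ip_rmull.
have h2 : \sum_i cmul (ip z (x i)) (v i) = ip z z.
  rewrite {3}/z (lin_sum (ip_lin z)); apply: eq_bigr => i _.
  by rewrite ip_rmul.
have h3 : \sum_i cmul (ip z (x i)) (ip (x i) z) = ip z th.
  by rewrite (lin_sum (ip_lin z)); apply: eq_bigr => i _; rewrite ip_rmul.
have h3' : ip th z = ip z th.
  rewrite -h3 ip_suml; apply: eq_bigr => i _.
  by rewrite ip_rmull -ip_star.
have sw : \sum_i cmul (cstar (w i)) (w i) =
  \sum_i cmul (cstar (v i)) (v i) - ip z z - ip z z + ip z th.
  rewrite -{1}h1 -{1}h2 -h3 -!sumrB -big_split/=; apply: eq_bigr => i _.
  rewrite /w cstarD cstarN -ip_star !(cmulDl, cmulDr, cmulNl, cmulNr).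
  by module.
have := cposD (cposZ (r := 3 / 4) ltac:(lra)
  (cpos_sum (index_enum 'I_n) (fun i => cpos_star_mul (w i))))
  (cposZ (r := 4^-1) ltac:(lra) (hA w)).
congr cpos; rewrite sw xw zE !(ipDr, ipDl, linN (ip_lin _), ipNl, ipZr, ipZrl, h3').
by module_coefs; field.
Qed.

Definition row_bound (c : R) := forall x g, row_contraction x ->
  nrm (row_rep x g) ^+ 2 <=
    nrm (row_tens x g) ^+ 2 + c * (sqn g - nrm (row_tens x g) ^+ 2).

(* Neumann series for the inverse of [(3 - G) / 2]. *)
Lemma newton_arg_dense x f N : row_contraction x ->
  exists g r, f = lincomb 1 (newton_arg x g) 1 r /\ sqn r <= 9^-1 ^+ N * sqn f.
Proof.
move=> hx; elim: N => [|N [g [r [fE hr]]]].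
  exists (fun=> 0), f; split; last by rewrite expr0 mul1r.
  apply/funext => i; rewrite /lincomb /newton_arg /lincomb /gram.
  rewrite big1 => [|j _]; last by rewrite (lin0 (star_rep_lin hs _)).
  by rewrite !scaler0 !addr0 scaler0 add0r rmorph1 scale1r.
(* The new remainder is [G r / 3], since [r = (3 - G)/2 (2 r / 3) + G r / 3]; with [|G r| <= |r|]
   this gives the ratio 1/9. *)
exists (lincomb 1 g (2 / 3) r), (lincomb 3^-1 (gram x r) 0 r); split.
  rewrite {1}fE; apply/funext => i.
  have -> : lincomb 1 (newton_arg x (lincomb 1 g (2 / 3) r)) 1
      (lincomb 3^-1 (gram x r) 0 r) i =
    1%:C *: ((3 / 2)%:C *: (1%:C *: g i + (2 / 3)%:C *: r i) +
     (- 2^-1)%:C *: (1%:C *: gram x g i + (2 / 3)%:C *: gram x r i)) +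
     1%:C *: (3^-1%:C *: gram x r i + 0%:C *: r i).
    rewrite /lincomb /newton_arg /lincomb; congr (_ *: (_ + _ *: _) + _).
    rewrite /gram !scaler_sumr -big_split/=; apply: eq_bigr => j _.
    by rewrite !(linD (star_rep_lin hs _), linZ (star_rep_lin hs _)).
  by rewrite /lincomb /newton_arg /lincomb; module_coefs; field.
have [_ e2 h1 h2 h3] := gram_moments r hx.
rewrite sqn_lincomb (exprS 9^-1) -(mulrA 9^-1); move: hr; set q := _ ^+ N * _ => hr.
by lra.
Qed.

Lemma row_bound_step c : 0 <= c -> c <= 1 -> row_bound c -> row_bound (4 / 9 * c).
Proof.
move=> c0 c1 hc x f hx; set c' := 4 / 9 * c.
pose Q h : R := nrm (row_tens x h) ^+ 2 + c' * (sqn h - nrm (row_tens x h) ^+ 2).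
have hH := hx.2.
have Q0 h : 0 <= Q h.
  by rewrite /Q; have := hH h; have := sqr_ge0 (nrm (row_tens x h)); rewrite /c'; nra.
have Qsq h : Q h <= sqn h by rewrite /Q; have := hH h; rewrite /c'; nra.
have Tsq h : nrm (row_rep x h) ^+ 2 <= sqn h.
  by apply: le_trans (hc _ _ hx) _; have := hH h; nra.
have Qyoung h r l : 0 < l -> Q (lincomb 1 h 1 r) <= (1 + l) * Q h + (1 + l^-1) * Q r.
  move=> l0; have := sqn_young h r l0.
  have := nrm_young (row_tens x h) (row_tens x r) l0.
  rewrite /Q row_tens_lincomb rmorph1 !scale1r; set a := nrm (_ + _) ^+ 2.
  by rewrite /c'; nra.
(* The chord inequality cleared of denominators: [1 - t (3 - t)^2 / 4 <= (4/9) (1 - t) (3 - t)^2 /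
   4], the difference being [t (1 - t) (21 - 5 t) / 36]. *)
have newt g : nrm (row_rep x (newton_arg x g)) ^+ 2 <= Q (newton_arg x g).
  rewrite -row_rep_newton; apply: le_trans (hc _ _ (row_contraction_newton hx)) _.
  rewrite row_tens_newton /Q.
  have [-> ->] := newton_moments g hx.
  have [_ _ h1 h2 h3] := gram_moments g hx.
  by rewrite /c'; nra.
(* So far only the range of [(3 - G)/2] is covered. Young's inequality reaches [f] at the cost of a
   factor [(1 + l)^2] and a multiple of the remainder; [N] goes to infinity before [l] goes to 0. *)
rewrite -/(Q f); have key l N : 0 < l ->
    nrm (row_rep x f) ^+ 2 <= (1 + l) ^+ 2 * Q f +
     ((1 + l) * (1 + l^-1) + (1 + l^-1)) * (9^-1 ^+ N * sqn f).
  move=> l0; have [g [r [fE hr]]] := newton_arg_dense f N hx.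
  have li0 : 0 < l^-1 by rewrite invr_gt0.
  have b1 : nrm (row_rep x f) ^+ 2 <=
     (1 + l) * Q (newton_arg x g) + (1 + l^-1) * sqn r.
    rewrite {1}fE row_rep_lincomb rmorph1 !scale1r.
    apply: le_trans (nrm_young _ _ l0) _; apply: lerD; rewrite ler_wpM2l//; lra.
  have b2 : Q (newton_arg x g) <= (1 + l) * Q f + (1 + l^-1) * sqn r.
    have gE : newton_arg x g = lincomb 1 f 1 (lincomb (- 1) r 0 r).
      apply/funext => i; rewrite {2}/lincomb fE /lincomb; module.
    have rE : sqn (lincomb (- 1) r 0 r) = sqn r by rewrite sqn_lincomb; lra.
    rewrite {1}gE; apply: le_trans (Qyoung _ _ _ l0) _.
    rewrite lerD2l ler_wpM2l//; first by lra.
    by apply: le_trans (Qsq _) _; rewrite rE.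
  apply: le_trans b1 _.
  have l1 : 0 <= 1 + l by lra.
  have b3 := ler_wpM2l l1 b2.
  have k0 : 0 <= (1 + l) * (1 + l^-1) + (1 + l^-1).
    by rewrite addr_ge0// ?mulr_ge0//; lra.
  by have := ler_wpM2l k0 hr; lra.
have key2 l : 0 < l -> nrm (row_rep x f) ^+ 2 <= (1 + l) ^+ 2 * Q f.
  move=> l0; apply: le_eps => e e0.
  have li0 : 0 < l^-1 by rewrite invr_gt0.
  set k := (1 + l) * (1 + l^-1) + (1 + l^-1) in key.
  have k0 : 0 <= k by rewrite addr_ge0// ?mulr_ge0//; lra.
  have M0 : 0 < k * sqn f + 1 by have := mulr_ge0 k0 (sqn_ge0 f); lra.
  have q0 : (0 : R) <= 9^-1 by lra.
  have q1 : 9^-1 < 1 :> R by lra.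
  have [N hN] := small_pow q0 q1 (divr_gt0 e0 M0).
  have := key l N l0; rewrite -/k; move: hN; rewrite ltr_pdivlMr//.
  by have := exprn_ge0 N q0; lra.
apply: le_eps => e e0; pose d := 3 * Q f + 1 + e.
have d0 : 0 < d by rewrite /d; have := Q0 f; lra.
pose l := e / d; have l0 : 0 < l by rewrite divr_gt0.
have l1 : l <= 1 by rewrite ler_pdivrMr// /d; have := Q0 f; lra.
have lE : l * (3 * Q f + 1 + e) = e by rewrite /l divfK// gt_eqF.
have := key2 l l0; have := Q0 f; have := mulr_ge0 (ltW l0) (Q0 f) => h1 h2.
have h3 : l * (l * Q f) <= l * Q f by rewrite ler_piMl.
by have := mulr_ge0 (ltW l0) (ltW e0); lra.
Qed.

Lemma row_bound1 : row_bound 1.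
Proof.
move=> x g hx; have [i0 _|none] := pickP (@predT 'I_n); last first.
  by rewrite /row_rep /row_tens /sqn !big_pred0 ?nrm0//; lra.
(* Complete contractivity concerns square matrices, so the row is placed at index [i0] and completed
   by zero rows. *)
pose M : 'M[E]_n := \matrix_(i, j) if i == i0 then x j else 0.
have hM : mx_corr_norm_le M 1.
  move=> v; pose w i := \sum_(j < n) rmul (M i j) (v j).
  change (`|\sum_i ip (w i) (w i)| <= 1 ^+ 2 * `|\sum_j ip (v j) (v j)|).
  rewrite expr1n mul1r nrm_le.
  have w0 : w i0 = row_mul x v.
    by rewrite /w /row_mul; apply: eq_bigr => j _; rewrite mxE eqxx.
  have wi i : i != i0 -> w i = 0.
    move=> /negbTE ii0; rewrite /w big1// => j _; rewrite mxE ii0.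
    exact: lin0 (rmull_lin _).
  rewrite (bigD1 i0)//= big1 ?addr0 => [|i /wi ->]; last first.
    by rewrite (lin0 (ip_lin _)).
  rewrite w0; apply: nrm_le_cpos; first exact: cpos_ip.
  exact: hx.1.
have := cc_contractive hT (ler01 : 0 <= 1 :> R[i]) hM g.
rewrite expr1n mul1r => h.
have {h} : nrm (row_rep x g) ^+ 2 <= sqn g; last by lra.
rewrite -lecR; apply: le_trans (_ : _ <= \sum_(j < n) `|g j| ^+ 2) _; last first.
  by rewrite rmorph_sum/=; apply: ler_sum => i _; rewrite nrmE rmorphXn.
apply: le_trans h; rewrite (bigD1 i0)//=.
have -> : `|\sum_(j < n) T (M i0 j) (g j)| ^+ 2 = (nrm (row_rep x g) ^+ 2)%:C :> R[i].
  rewrite nrmE rmorphXn/= /row_rep.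
  by under eq_bigr => j _ do rewrite mxE eqxx.
by rewrite lerDl sumr_ge0// => i _; rewrite exprn_ge0.
Qed.

Lemma row_contraction_rep x g : row_contraction x ->
  nrm (row_rep x g) <= nrm (row_tens x g).
Proof.
move=> hx; apply: sqr_le_mul; rewrite ?nrm_ge0//; apply: le_eps => e e0.
have q0 : (0 : R) <= 4 / 9 by lra.
have q1 : 4 / 9 < 1 :> R by lra.
have h k : row_bound ((4 / 9) ^+ k).
  elim: k => [|k IH]; first exact: row_bound1.
  rewrite exprS; apply: row_bound_step; rewrite ?exprn_ge0 ?exprn_ile1//.
  exact: ltW.
have M0 : 0 < sqn g + 1 by have := sqn_ge0 g; lra.
have [k] := small_pow q0 q1 (divr_gt0 e0 M0); rewrite ltr_pdivlMr// => hk.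
apply: le_trans (h k _ g hx) _; rewrite lerD2l.
have := exprn_ge0 k q0; have := sqr_ge0 (nrm (row_tens x g)); nra.
Qed.

(** Entries are added one at a time through [|y + z|^2 <= 2 |y|^2 + 2 |z|^2], which holds in [A]
    because [ip (y - z) (y - z)] is positive. *)
Lemma row_bounded_module (x : 'I_n -> E) (s : seq 'I_n) :
  exists2 K : R, 0 <= K & forall v : 'I_n -> A,
    let z := \sum_(i <- s) rmul (x i) (v i) in
    cpos (K%:C *: \sum_(i <- s) cmul (cstar (v i)) (v i) - ip z z).
Proof.
elim: s => [|i s [K K0 hK]].
  exists 0 => // v /=; rewrite !big_nil (lin0 (ip_lin _)) subr0 scaler0.
  exact: cpos0.
pose k := nrm (ip (x i) (x i)); have k0 : 0 <= k by exact: nrm_ge0.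
exists (2 * K + 2 * k); first lra.
move=> v /=; rewrite !big_cons; set S := \sum_(j <- s) _; set z := \sum_(j <- s) _.
set y := rmul _ _; set a := cmul _ _.
have sa : cstar (ip (x i) (x i)) = ip (x i) (x i) by rewrite -ip_star.
have h1 := cpos_conj (v i) sa (lexx k).
have yy : ip y y = cmul (cstar (v i)) (cmul (ip (x i) (x i)) (v i)).
  by rewrite /y ip_rmull ip_rmul.
rewrite -yy -/a in h1.
have h2 := hK v; rewrite /= -/z -/S in h2.
have pS : cpos S by apply: cpos_sum => j; exact: cpos_star_mul.
have pa : cpos a by exact: cpos_star_mul.
have h3 := cpos_ip (y - z).
have K2 : 0 <= 2 * K by lra.
have k2 : 0 <= 2 * k by lra.
have r2 : (0 : R) <= 2 by lra.
have := cposD (cposD (cposD (cposZ r2 h1) (cposZ r2 h2)) h3)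
  (cposD (cposZ K2 pa) (cposZ k2 pS)).
congr cpos; rewrite !(ipDr, ipDl, ipNl, linN (ip_lin _)).
by module.
Qed.

Lemma row_contraction_scale x :
  exists2 l : R, 0 < l & row_contraction (fun i => l%:C *: x i).
Proof.
have [K K0 hK] := row_bounded_module x (index_enum 'I_n).
have [k k0 hk] := row_tens_bounded x.
(* Square roots are avoided: [M >= 1] gives [K / M^2 <= K / M <= 1], and likewise for [k]. *)
pose M := 1 + K + k; have M1 : 1 <= M by rewrite /M; lra.
have M0 : 0 < M by lra.
have Mi : 0 < M^-1 by rewrite invr_gt0.
have MM : M^-1 * M = 1 by rewrite mulVf// gt_eqF.
have l1 : M^-1 * M^-1 <= M^-1 by rewrite ger_pMr// invf_le1.
exists M^-1 => //; split=> [v|g].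
  set l := M^-1.
  have -> : row_mul (fun i => l%:C *: x i) v = l%:C *: row_mul x v.
    by rewrite /row_mul scaler_sumr; apply: eq_bigr => i _; rewrite rmulZl.
  rewrite ipZr ipZrl; set S := \sum_i _.
  have pS : cpos S by apply: cpos_sum => j; exact: cpos_star_mul.
  have l2 : 0 <= l * l by rewrite mulr_ge0// ltW.
  have l3 : 0 <= 1 - l * l * K.
    have lK : l * l * K <= l * K by apply: ler_wpM2r => //; exact: l1.
    have : l * K <= 1 by rewrite -MM ler_wpM2l ?(ltW Mi)// /M; lra.
    by lra.
  have := cposD (cposZ l2 (hK v)) (cposZ l3 pS).
  by congr cpos; rewrite /= -/S -/(row_mul x v); module.
have -> : row_tens (fun i => M^-1%:C *: x i) g = M^-1%:C *: row_tens x g.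
  rewrite /row_tens scaler_sumr; apply: eq_bigr => i _.
  by rewrite (linZ (rt_linearl Y _)).
rewrite nrmZr_ge0 ?(ltW Mi)// exprMn expr2.
have h := hk g.
have h1 : M^-1 * M^-1 * nrm (row_tens x g) ^+ 2 <= M^-1 * nrm (row_tens x g) ^+ 2.
  by rewrite ler_wpM2r// sqr_ge0.
apply: le_trans h1 _.
have h2 : M^-1 * nrm (row_tens x g) ^+ 2 <= M^-1 * (k * sqn g).
  by rewrite ler_wpM2l// ltW.
apply: le_trans h2 _; rewrite mulrA.
have : M^-1 * k <= 1 by rewrite -MM ler_wpM2l ?(ltW Mi)// /M; lra.
by have := sqn_ge0 g; nra.
Qed.

Lemma row_rep_le x g : nrm (row_rep x g) <= nrm (row_tens x g).
Proof.
have [l l0 hl] := row_contraction_scale x.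
have := row_contraction_rep g hl.
have -> : row_tens (fun i => l%:C *: x i) g = l%:C *: row_tens x g.
  rewrite /row_tens scaler_sumr; apply: eq_bigr => i _.
  by rewrite (linZ (rt_linearl Y _)).
have -> : row_rep (fun i => l%:C *: x i) g = l%:C *: row_rep x g.
  rewrite /row_rep scaler_sumr; apply: eq_bigr => i _.
  by rewrite (linZ (rep_linl _)).
by rewrite !nrmZr_ge0 ?(ltW l0)// ler_pM2l.
Qed.

End Rows.

Lemma tilde_map_exists : exists Tt : Y -> H, tilde_map T Tt.
Proof.
have [|Tt cT hTt] := @contraction_extension _ _ _ _
    (fun p : E * H => rt_tens Y p.1 p.2) (fun p => T p.1 p.2) (@rt_total _ _ _ _ _ Y).
  move=> r; rewrite /comb !(big_tnth _ _ r).
  have := row_rep_le (fun i => (tnth (in_tuple r) i).1 *: (tnth (in_tuple r) i).2.1)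
    (fun i => (tnth (in_tuple r) i).2.2).
  rewrite /row_rep /row_tens.
  under eq_bigr => i _ do rewrite (linZ (rep_linl _)).
  by under [X in _ <= nrm X -> _]eq_bigr => i _ do rewrite (linZ (rt_linearl Y _)).
by exists Tt; split=> // x h; exact: (hTt (x, h)).
Qed.

End AssociatedContraction.

Lemma tilde_map_uniq (R : realType) (A : cstarAlgType R) (E : corrType A)
    (H : hilbertType R) (sigma : A -> H -> H) (Y : rep_tensor E sigma)
    (T : E -> H -> H) (T1 T2 : Y -> H) :
  tilde_map T T1 -> tilde_map T T2 -> T1 = T2.
Proof.
move=> [c1 h1] [c2 h2]; apply/funext => v.
apply: (eq_on_cspan (linear_contraction_bounded c1) (linear_contraction_bounded c2) _
  (rt_total v)) => p; by rewrite h1 h2.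
Qed.
(** * Tensoring with the associated contraction *)

Lemma geometric_limit (R : realType) (V : completeNormedModType R[i])
    (u : nat -> V) (r : R) : 0 <= r -> r < 1 ->
  (forall n, nrm (u n.+1 - u n) <= r ^+ n) ->
  exists l, forall e, 0 < e -> exists N, forall n, (N <= n)%N -> nrm (l - u n) < e.
Proof.
move=> r0 r1 hu; have r1' : 0 < 1 - r by lra.
have tele N k : nrm (u (N + k)%N - u N) * (1 - r) <= r ^+ N.
  suff : nrm (u (N + k)%N - u N) * (1 - r) <= r ^+ N - r ^+ (N + k).
    by have := exprn_ge0 (N + k) r0; lra.
  elim: k => [|k IH]; first by rewrite addn0 !subrr nrm0 mul0r.
  rewrite addnS exprS; have := nrm_tri (u (N + k)%N) (u (N + k).+1) (u N).
  move/(ler_wpM2r (ltW r1')); have := ler_wpM2r (ltW r1') (hu (N + k)%N).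
  by move: IH; lra.
have cauchy_tail e : 0 < e -> exists N, forall n, (N <= n)%N -> nrm (u N - u n) < e.
  move=> e0; have [N hN] := small_pow r0 r1 (mulr_gt0 e0 r1').
  exists N => n Nn; rewrite nrmBC -(ltr_pM2r r1').
  by apply: le_lt_trans hN; rewrite -(subnKC Nn).
have cF : cauchy (u @ \oo).
  apply: cauchy_exP => e e0.
  have [eps eps0 eE] : exists2 eps : R, 0 < eps & e = eps%:C.
    exists (complex.Re e); last by rewrite RRe_real// gtr0_real.
    by move: e0; rewrite ltcE => /andP[].
  have [N hN] := cauchy_tail _ eps0; exists (u N), N => // n Nn.
  by rewrite /= -ball_normE /ball_/= nrmE eE ltcR hN.
exists (lim (u @ \oo)) => e e0; have e2 : 0 < e / 2 by rewrite divr_gt0.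
have e2C : 0 < (e / 2)%:C :> R[i] by rewrite ltcR.
have [M _ hM] := (cauchy_cvg _ cF : u @ \oo --> lim (u @ \oo)) _ (nbhsx_ballx _ _ e2C).
have [N hN] := cauchy_tail _ (divr_gt0 e2 (ltr0n R 2)).
exists (maxn M N) => n; rewrite geq_max => /andP[Mn Nn].
have : ball (lim (u @ \oo)) (e / 2)%:C (u n) by exact: hM.
by rewrite -ball_normE /ball_/= nrmE ltcR; lra.
Qed.

(** * Square roots in the algebra and positive functionals *)

Section StarSqrt.
Variables (R : realType) (A : cstarAlgType R).
Implicit Types (x w : A).

Fixpoint visser_elt x n : A :=
  if n is n'.+1 then
    (2^-1)%:C *: (x + cmul (visser_elt x n') (visser_elt x n'))
  else 0.

Lemma visser_eltE x n v : visser (cmul x) n v = cmul (visser_elt x n) v.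
Proof.
elim: n v => [|n IH] v /=; first by rewrite cmul0l.
by rewrite !IH cmulA -cmulDl cmulZl.
Qed.

(** In the unitization [1 - w] is a square root of [1 - x]. Visser's iteration runs inside [A],
    whose completeness makes the root exact. *)
Lemma star_sqrt x : cstar x = x -> nrm x < 1 ->
  exists2 w, cstar w = w & w + w - cmul w w = x.
Proof.
move=> sx x1; have x0 := nrm_ge0 x.
pose q := Num.sqrt (1 - nrm x).
have q0 : 0 < q by rewrite sqrtr_gt0; lra.
have q1 : q <= 1 by rewrite -[leRHS]sqrtr1 ler_wsqrtr//; lra.
have qq : q ^+ 2 = 1 - nrm x by rewrite sqr_sqrtr//; lra.
pose r := 1 - q; have r0 : 0 <= r by rewrite /r; lra.
have r1 : r < 1 by rewrite /r; lra.
have hX : opb (cmul x) (2 * r - r ^+ 2).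
  by move=> v; apply: le_trans (nrmM _ _) _; rewrite ler_wpM2r ?nrm_ge0// /r; lra.
pose u := visser_elt x.
have us n : cstar (u n) = u n.
  elim: n => [|n IH] /=; first exact: cstar0.
  by rewrite cstarZr cstarD cstarM sx -/(u n) IH.
have u1 n : nrm (u n) <= 1.
  apply: nrm_le_opb => // v; rewrite -visser_eltE.
  apply: le_trans (visser_opb _ r0 hX v) _.
  by rewrite ler_wpM2r ?nrm_ge0// ltW.
have [|w hw] := geometric_limit (u := u) r0 r1.
  move=> n; apply: nrm_le_opb => [|v]; first exact: exprn_ge0.
  rewrite cmulDl cmulNl -!visser_eltE.
  exact: visser_cauchy (cmulr_lin x) r0 r1 hX.
exists w.
  apply/eqP; rewrite -subr_eq0; apply/eqP/nrm_eq0/le_anti; rewrite nrm_ge0 andbT.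
  apply: le_eps => e e0; have [N hN] := hw _ (divr_gt0 e0 (ltr0n R 2)).
  have := hN N (leqnn _) => h.
  have h' : nrm (cstar w - u N) < e / 2.
    by rewrite -{1}us -cstarN -cstarD nrm_star.
  by have := nrm_tri (u N) (cstar w) w; rewrite (nrmBC (u N) w); lra.
apply/eqP; rewrite -subr_eq0; apply/eqP/nrm_eq0/le_anti; rewrite nrm_ge0 andbT.
apply: le_eps => e e0; pose k := nrm w + 4; have k0 : 0 < k.
  by rewrite /k; have := nrm_ge0 w; lra.
have [N hN] := hw _ (divr_gt0 e0 k0).
set d := e / k; have dk : d * k = e by rewrite /d divfK// gt_eqF.
have h0 := hN N (leqnn _); have h1 := hN N.+1 (leqnSn _).
have -> : w + w - cmul w w - x = 2%:C *: (w - u N.+1) -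
    cmul w (w - u N) - cmul (w - u N) (u N).
  have -> : u N.+1 = (2^-1)%:C *: (x + cmul (u N) (u N)) by [].
  by rewrite !(cmulDl, cmulDr, cmulNl, cmulNr); module_coefs; field.
have b1 := nrmB (2%:C *: (w - u N.+1) - cmul w (w - u N)) (cmul (w - u N) (u N)).
have b2 := nrmB (2%:C *: (w - u N.+1)) (cmul w (w - u N)).
have b3 := nrmM w (w - u N); have b4 := nrmM (w - u N) (u N).
rewrite nrmZr_ge0 in b2; last by lra.
have b5 : nrm w * nrm (w - u N) <= nrm w * d by rewrite ler_wpM2l ?nrm_ge0// ltW.
have b6 : nrm (w - u N) * nrm (u N) <= nrm (w - u N) * 1.
  by rewrite ler_wpM2l ?nrm_ge0.
have d0 : 0 < d by rewrite divr_gt0.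
rewrite -/d in h0 h1; rewrite /k in dk; lra.
Qed.

(** [N] stands for the value of [phi] at a unit, and the last hypothesis for [phi ((1 - w)^2) >= 0].
    With [(1 - w)^2 = 1 - a / l] and [l] slightly above [|a|], it reads [phi a <= l N]. *)
Lemma functional_bound (phi : A -> R) (N : R) :
  (forall a b, phi (a + b) = phi a + phi b) ->
  (forall (r : R) a, phi (r%:C *: a) = r * phi a) ->
  (forall w, cstar w = w -> 0 <= N - 2 * phi w + phi (cmul w w)) ->
  forall a, cstar a = a -> phi a <= nrm a * N.
Proof.
move=> phiD phiZ phi_sqr a sa.
have phi0 : phi 0 = 0 by have := phiZ 0 0; rewrite scaler0 mul0r.
have N0 : 0 <= N by have := phi_sqr 0 (cstar0 A); rewrite cmul0l phi0; lra.
apply: le_eps => e e0; have N1 : 0 < N + 1 by lra.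
pose d := e / (N + 1); have d0 : 0 < d by rewrite divr_gt0.
have dE : d * (N + 1) = e by rewrite /d divfK// gt_eqF.
pose l := nrm a + d; have l0 : 0 < l by rewrite /l; have := nrm_ge0 a; lra.
have [||w sw wE] := @star_sqrt (l^-1%:C *: a).
- by rewrite cstarZr sa.
- rewrite nrmZr_ge0 ?invr_ge0 ?(ltW l0)// mulrC ltr_pdivrMr// mul1r /l; lra.
have := phi_sqr w sw.
have -> : cmul w w = w + w + (- l^-1)%:C *: a.
  by rewrite rmorphN scaleNr -wE; module.
rewrite !phiD phiZ => h.
have h1 : l * (l^-1 * phi a) <= l * N by rewrite ler_wpM2l ?(ltW l0)//; lra.
by move: h1; rewrite mulrA divff ?gt_eqF// mul1r /l; lra.
Qed.

End StarSqrt.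

(** * The left action on [E (x) H] *)

Section LeftAction.
Variables (R : realType) (A : cstarAlgType R) (E : corrType A).
Variables (H : hilbertType R) (sigma : A -> H -> H) (hs : star_rep sigma).
Variables (Y : rep_tensor E sigma) (n : nat) (h : 'I_n -> H).
Implicit Type z : 'I_n -> E.

Local Notation tens z := (row_tens Y z h).
Definition lact (a : A) z : 'I_n -> E := fun l => lmul a (z l).

Lemma tens_lin : linear (fun z => tens z).
Proof.
apply: linP => [z z'|c z]; rewrite /row_tens.
  by rewrite -big_split; apply: eq_bigr => l _; rewrite (linD (rt_linearl Y _)).
by rewrite scaler_sumr; apply: eq_bigr => l _; rewrite (linZ (rt_linearl Y _)).
Qed.

Lemma lact_adj a z z' : ipr (tens (lact a z)) (tens z') =
  ipr (tens z) (tens (lact (cstar a) z')).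
Proof.
rewrite /ipr /row_tens !inner_suml; congr complex.Re; apply: eq_bigr => l _.
rewrite !inner_sumr; apply: eq_bigr => k _.
by rewrite !rt_inner lmul_adj.
Qed.

(** For fixed [xi], the form [a |-> <xi, a xi>] is a positive functional whose value at a unit would
    be [|xi|^2]; its positivity is [|xi - w xi|^2 >= 0]. *)
Lemma lact_form_le a z : cstar a = a ->
  ipr (tens z) (tens (lact a z)) <= nrm a * nrm (tens z) ^+ 2.
Proof.
apply: (@functional_bound _ _ (fun b => ipr (tens z) (tens (lact b z)))).
- move=> b c; rewrite -iprDr -(linD tens_lin); congr (ipr _ (row_tens Y _ h)).
  by apply/funext => l; exact: lmulDl.
- move=> r b; rewrite -iprZr -(linZ tens_lin); congr (ipr _ (row_tens Y _ h)).
  by apply/funext => l; exact: lmulZl.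
- move=> w sw; have -> : lact (cmul w w) z = lact (cstar w) (lact w z).
    by apply/funext => l; rewrite /lact lmulA sw.
  rewrite -lact_adj iprxx.
  have := sqr_ge0 (nrm (1%:C *: tens z + (- 1)%:C *: tens (lact w z))).
  by rewrite nrm_sqr_comb; lra.
Qed.

End LeftAction.

(** * Comparison of intertwined operators between 0 and 1 *)

Section Intertwining.
Variables (R : realType) (V V' : lmodType R[i]).
Variables (f : V -> V -> R) (f' : V' -> V' -> R) (tau : V -> V').

(** Degenerate forms are allowed, because matrices over [E] represent tensors without uniqueness and
    no quotient is taken. *)
Record sip (U : lmodType R[i]) (s : U -> U -> R) : Prop := Sip {
  sip_addr : forall x y z, s x (y + z) = s x y + s x z;
  sip_scaler : forall (r : R) x y, s x (r%:C *: y) = r * s x y;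
  sip_sym : forall x y, s x y = s y x;
  sip_ge0 : forall x, 0 <= s x x
}.

Record unit_op (U : lmodType R[i]) (s : U -> U -> R) (P : U -> U) : Prop := UnitOp {
  uo_lin : linear P;
  uo_sym : forall x y, s (P x) y = s x (P y);
  uo_ge0 : forall x, 0 <= s x (P x);
  uo_le1 : forall x, s x (P x) <= s x x
}.

Definition logistic (U : lmodType R[i]) (P : U -> U) x := 4%:C *: (P x - P (P x)).

(** No roots of [P] are taken: [t (1 - t) = (1 - t) t (1 - t) + t (1 - t) t], and
    [1 - 4 t (1 - t) = (1 - 2 t)^2]. *)
Lemma logistic_unit_op (U : lmodType R[i]) (s : U -> U -> R) P :
  sip s -> unit_op s P -> unit_op s (logistic P).
Proof.
move=> [sD sZ sC s0] [lP sP P0 P1].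
have sN x y : s x (- y) = - s x y.
  by rewrite -scaleN1r -(rmorph1 (real_complex R)) -rmorphN sZ mulN1r.
have sDl x y z : s (x + y) z = s x z + s y z by rewrite sC sD !(sC z).
have sNl x y : s (- x) y = - s x y by rewrite sC sN sC.
have sZl (r : R) x y : s (r%:C *: x) y = r * s x y by rewrite sC sZ sC.
split.
- apply: linP => [x y|c x]; rewrite /logistic.
    by rewrite !(linD lP); module.
  by rewrite !(linZ lP); module.
- by move=> x y; rewrite /logistic !(sD, sDl, sN, sNl, sZ, sZl) !sP.
- move=> x; rewrite /logistic sZ sD sN.
  have := P0 (x - P x); have := P1 (P x).
  by rewrite (linB lP) !(sD, sDl, sN, sNl) !sP; lra.
- move=> x; rewrite /logistic sZ sD sN.
  have := s0 (x - 2%:C *: P x).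
  by rewrite !(sD, sDl, sN, sNl, sZ, sZl) !sP; lra.
Qed.

Hypotheses (hf : sip f) (hf' : sip f').
Hypothesis tau_le : forall z, f' (tau z) (tau z) <= f z z.

(* The identity [t = t^2 + (1/4) (4 t (1 - t))] trades an error [c] for
   [c / 4], because the logistic map preserves [0, 1]. *)
Lemma intertwining_step k P P' : unit_op f P -> unit_op f' P' ->
  (forall z, tau (P z) = P' (tau z)) ->
  (forall r z, tau (r%:C *: z) = r%:C *: tau z) ->
  (forall x y, tau (x - y) = tau x - tau y) ->
  forall z, f' (tau z) (P' (tau z)) <= f z (P z) + 4^-1 ^+ k * f z z.
Proof.
move=> hP hP' PP tauZ tauB; elim: k P P' hP hP' PP => [|k IH] P P' hP hP' PP z.
  rewrite expr0 mul1r; have := tau_le z; have := uo_le1 hP' (tau z).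
  by have := uo_ge0 hP z; lra.
have := IH _ _ (logistic_unit_op hf hP) (logistic_unit_op hf' hP').
have split_form (U : lmodType R[i]) (s : U -> U -> R) Q x : sip s -> unit_op s Q ->
    s x (logistic Q x) = 4 * (s x (Q x) - s (Q x) (Q x)).
  move=> [sD sZ sC _] [_ sQ _ _]; rewrite /logistic sZ sD -scaleN1r.
  by rewrite -(rmorph1 (real_complex R)) -rmorphN sZ mulN1r sQ.
move=> /(_ _ z); rewrite (split_form _ _ _ _ hf hP) (split_form _ _ _ _ hf' hP').
rewrite exprS => h; have {}h := h ltac:(by move=> w; rewrite /logistic tauZ tauB !PP).
by have := tau_le (P z); rewrite PP; lra.
Qed.

Lemma intertwining_le P P' : unit_op f P -> unit_op f' P' ->
  (forall z, tau (P z) = P' (tau z)) ->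
  (forall r z, tau (r%:C *: z) = r%:C *: tau z) ->
  (forall x y, tau (x - y) = tau x - tau y) ->
  forall z, f' (tau z) (P' (tau z)) <= f z (P z).
Proof.
move=> hP hP' PP tauZ tauB z; apply: le_eps => e e0.
have fz := sip_ge0 hf z; have f1 : 0 < f z z + 1 by lra.
have q0 : (0 : R) <= 4^-1 by lra.
have q1 : 4^-1 < 1 :> R by lra.
have [k] := small_pow q0 q1 (divr_gt0 e0 f1); rewrite ltr_pdivlMr// => hk.
have := intertwining_step k hP hP' PP tauZ tauB z.
by have := exprn_ge0 k q0; lra.
Qed.

End Intertwining.

(** * The estimate for the tensored map *)

Section TensorContraction.
Variables (R : realType) (A : cstarAlgType R) (F E G : corrType A).
Variables (H : hilbertType R) (sigma : A -> H -> H).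
Variables (S : F -> H -> H) (T : E -> H -> H) (mu : F -> E -> G).
Hypotheses (hS : cc_representation sigma S) (hT : cc_representation sigma T).
Hypothesis ip_mu : forall x y x' y', ip (mu x y) (mu x' y') = ip y (lmul (ip x x') y').
Variables (YF : rep_tensor F sigma) (YE : rep_tensor E sigma).
Variable YG : rep_tensor G sigma.
Variable n : nat.
Implicit Types (x : 'I_n -> F) (y : 'I_n -> E) (h : 'I_n -> H).

Lemma dot_sip : sip (@dot R H n).
Proof.
split=> [f g k|r f g|f g|f].
- by rewrite /dot -big_split/=; apply: eq_bigr => i _; rewrite -iprDr.
- by rewrite /dot mulr_sumr; apply: eq_bigr => i _; rewrite -iprZr.
- by apply: eq_bigr => i _; exact: iprC.
- by apply: sumr_ge0 => i _; rewrite iprxx sqr_ge0.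
Qed.

Lemma dotxx (f : 'I_n -> H) : dot f f = sqn f.
Proof. by apply: eq_bigr => i _; exact: iprxx. Qed.

(* Elements of [E (x)_sigma H] to the power [n] are represented by matrices [z]
   over [E], the vectors [h] being fixed: the Gram operator of [x] then acts on
   [z] alone, and [T~] becomes [z |-> (sum_l T (z k l) (h l))_k]. *)
Lemma tensor_contraction x y h :
  nrm (\sum_k rt_tens YF (x k) (T (y k) (h k))) <=
  nrm (\sum_k rt_tens YG (mu (x k) (y k)) (h k)).
Proof.
pose V : lmodType R[i] := 'I_n -> 'I_n -> E.
pose xi (z : V) k : YE := row_tens YE (z k) h.
pose f (z z' : V) : R := \sum_k ipr (xi z k) (xi z' k).
pose om k (z : V) : YG := row_tens YG (fun l => mu (x k) (z k l)) h.
pose Om z : YG := \sum_k om k z.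
pose tau (z : V) : 'I_n -> H := fun k => row_rep T (z k) h.
have xiD z z' k : xi (z + z') k = xi z k + xi z' k by exact: (linD (tens_lin YE h)).
have xiZ c z k : xi (c *: z) k = c *: xi z k by exact: (linZ (tens_lin YE h)).
have hf : sip f.
  split=> [z z' z''|r z z'|z z'|z]; rewrite /f.
  - by rewrite -big_split/=; apply: eq_bigr => k _; rewrite xiD iprDr.
  - by rewrite mulr_sumr; apply: eq_bigr => k _; rewrite xiZ iprZr.
  - by apply: eq_bigr => k _; exact: iprC.
  - by apply: sumr_ge0 => k _; rewrite iprxx sqr_ge0.
have om_form k j z z' : ipr (om k z) (om j z') =
    ipr (xi z k) (row_tens YE (lact (ip (x k) (x j)) (z' j)) h).
  rewrite /ipr /om /xi /row_tens !inner_suml; congr complex.Re.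
  apply: eq_bigr => l _; rewrite !inner_sumr; apply: eq_bigr => m _.
  by rewrite !rt_inner ip_mu.
pose G0 (z : V) : V := fun k l => \sum_j lmul (ip (x k) (x j)) (z j l).
have xiG z k : xi (G0 z) k = \sum_j row_tens YE (lact (ip (x k) (x j)) (z j)) h.
  rewrite /xi /row_tens exchange_big/=; apply: eq_bigr => l _.
  by rewrite (lin_sum (rt_linearl YE _)).
have ipr_sumr (U : hilbertType R) (u : U) (w : 'I_n -> U) :
    ipr u (\sum_k w k) = \sum_k ipr u (w k).
  by rewrite /ipr inner_sumr raddf_sum.
have fG z z' : f z (G0 z') = ipr (Om z) (Om z').
  rewrite (iprC (Om z)) ipr_sumr; apply: eq_bigr => k _.
  rewrite xiG ipr_sumr (iprC (Om z')) ipr_sumr; apply: eq_bigr => j _.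
  by rewrite om_form.
have [K K0 hK] : exists2 K : R, 0 <= K & forall z, nrm (Om z) ^+ 2 <= K * f z z.
  have [||K K0 hK] := @nrm_sqr_sum_bounded _ _ _ V (index_enum 'I_n) om
    (fun k z => ipr (xi z k) (xi z k)).
  - by move=> k z; rewrite iprxx sqr_ge0.
  - move=> k; exists (nrm (ip (x k) (x k))); first exact: nrm_ge0.
    move=> z; rewrite -iprxx om_form iprxx; apply: lact_form_le.
    by rewrite -ip_star.
  - by exists K.
have [K' K'0 hK'] := row_tens_bounded hS YF x.
(* [c] dominates the Gram operator of [x] both over [E] and on [H^n], so that [P] and [P'] lie
   between 0 and 1. *)
pose c := K + K' + 1; have c0 : 0 < c by rewrite /c; lra.
have ci0 : 0 <= c^-1 by rewrite invr_ge0 ltW.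
have cc : c^-1 * c = 1 by rewrite mulVf// gt_eqF.
pose P (z : V) : V := c^-1%:C *: G0 z.
pose P' (g : 'I_n -> H) : 'I_n -> H := c^-1%:C *: gram sigma x g.
have fP z z' : f z (P z') = c^-1 * ipr (Om z) (Om z') by rewrite (sip_scaler hf) fG.
have dP g g' : dot g (P' g') = c^-1 * ipr (row_tens YF x g) (row_tens YF x g').
  by rewrite (sip_scaler dot_sip) (dot_gram YF).
have uP : unit_op f P.
  split.
  - apply: linP => [z z'|b z]; rewrite /P; apply/funext => k; apply/funext => l.
      rewrite -[LHS]/(c^-1%:C *: G0 (z + z') k l).
      rewrite -[RHS]/(c^-1%:C *: G0 z k l + c^-1%:C *: G0 z' k l) -scalerDr.
      congr (_ *: _); rewrite /G0 -big_split/=; apply: eq_bigr => j _.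
      exact: lmulDr.
    rewrite -[LHS]/(c^-1%:C *: G0 (b *: z) k l).
    rewrite -[RHS]/(b *: (c^-1%:C *: G0 z k l)) scalerA mulrC -scalerA.
    congr (_ *: _); rewrite /G0 scaler_sumr; apply: eq_bigr => j _.
    exact: lmulZr.
  - by move=> z z'; rewrite (sip_sym hf) !fP iprC.
  - by move=> z; rewrite fP iprxx mulr_ge0// sqr_ge0.
  - move=> z; rewrite fP iprxx; have fz := sip_ge0 hf z.
    have h1 : nrm (Om z) ^+ 2 <= c * f z z.
      by apply: le_trans (hK z) _; rewrite ler_wpM2r// /c; lra.
    by have := ler_wpM2l ci0 h1; rewrite [leRHS]mulrA cc mul1r.
have hs := cc_star_rep hT.
have uP' : unit_op (@dot R H n) P'.
  split.
  - apply: linP => [g g'|b g]; rewrite /P'; apply/funext => k.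
      rewrite -[LHS]/(c^-1%:C *: gram sigma x (g + g') k).
      rewrite -[RHS]/(c^-1%:C *: gram sigma x g k + c^-1%:C *: gram sigma x g' k).
      rewrite -scalerDr.
      congr (_ *: _); rewrite /gram -big_split/=; apply: eq_bigr => j _.
      exact: linD (star_rep_lin hs _) _ _.
    rewrite -[LHS]/(c^-1%:C *: gram sigma x (b *: g) k).
    rewrite -[RHS]/(b *: (c^-1%:C *: gram sigma x g k)) scalerA mulrC -scalerA.
    congr (_ *: _); rewrite /gram scaler_sumr; apply: eq_bigr => j _.
    exact: linZ (star_rep_lin hs _) _ _.
  - by move=> g g'; rewrite (sip_sym dot_sip) !dP iprC.
  - by move=> g; rewrite dP iprxx mulr_ge0// sqr_ge0.
  - move=> g; rewrite dP iprxx dotxx; have gz := sqn_ge0 g.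
    have h1 : nrm (row_tens YF x g) ^+ 2 <= c * sqn g.
      by apply: le_trans (hK' g) _; rewrite ler_wpM2r// /c; lra.
    by have := ler_wpM2l ci0 h1; rewrite [leRHS]mulrA cc mul1r.
have tau_le z : dot (tau z) (tau z) <= f z z.
  rewrite dotxx; apply: ler_sum => k _; rewrite iprxx.
  by rewrite ler_pXn2r ?nnegrE ?nrm_ge0//; exact: (row_rep_le hT YE (z k) h).
have tauG z : tau (G0 z) = gram sigma x (tau z).
  apply/funext => k; rewrite /tau /gram /row_rep.
  under [RHS]eq_bigr => j _ do rewrite (lin_sum (star_rep_lin hs _)).
  rewrite exchange_big/=; apply: eq_bigr => l _.
  rewrite (lin_sum (rep_linl hT _)); apply: eq_bigr => j _.
  exact: cc_lmul hT _ _ _.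
have tauZ (r : R) z : tau (r%:C *: z) = r%:C *: tau z.
  apply/funext => k; rewrite /tau /row_rep -[RHS]/(r%:C *: row_rep T (z k) h).
  rewrite /row_rep scaler_sumr; apply: eq_bigr => l _.
  exact: linZ (rep_linl hT _) _ _.
have tauB z z' : tau (z - z') = tau z - tau z'.
  apply/funext => k; rewrite -[RHS]/(row_rep T (z k) h - row_rep T (z' k) h).
  rewrite /tau /row_rep -sumrB; apply: eq_bigr => l _.
  exact: linB (rep_linl hT _) _ _.
(* The diagonal matrix of [y] represents the family of the [y k (x) h k]. *)
pose z0 : V := fun k l => if k == l then y k else 0.
have := intertwining_le hf dot_sip tau_le uP uP' _ tauZ tauB z0.
rewrite fP dP !iprxx => hle; have {}hle := hle ltac:(by move=> z; rewrite tauZ tauG).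
(* The off-diagonal zeros must disappear under [mu]; its inner products alone ensure this. *)
have mu0 u : mu u 0 = 0.
  apply: nrm_eq0; apply/eqP; rewrite -sqrf_eq0 -nrm_ip ip_mu.
  by rewrite (lin0 (lmulr_lin _)) (lin0 (ip_lin _)) nrm0.
have tz : row_tens YF x (tau z0) = \sum_k rt_tens YF (x k) (T (y k) (h k)).
  apply: eq_bigr => k _; congr rt_tens; rewrite /tau /row_rep (bigD1 k)//=.
  rewrite big1 ?addr0 /z0 ?eqxx// => l /negbTE lk.
  by rewrite eq_sym lk (lin0 (rep_linl hT _)).
have oz : Om z0 = \sum_k rt_tens YG (mu (x k) (y k)) (h k).
  apply: eq_bigr => k _; rewrite /om /row_tens (bigD1 k)//=.
  rewrite big1 ?addr0 /z0 ?eqxx// => l /negbTE lk.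
  by rewrite eq_sym lk mu0 (lin0 (rt_linearl YG _)).
rewrite -tz -oz; apply: sqr_le_mul; rewrite ?nrm_ge0//.
have cp : 0 < c^-1 by rewrite invr_gt0.
by rewrite -(ler_pM2l cp).
Qed.

End TensorContraction.
(** * Products of fibers *)

Section Totality.
Variables (R : realType).

Lemma cspan_image (I J : Type) (V W : normedModType R[i]) (g : I -> V)
    (g' : J -> W) (f : V -> W) (c : R) : linear f ->
  0 <= c -> (forall v, nrm (f v) <= c * nrm v) -> (forall i, cspan g' (f (g i))) ->
  forall v, cspan g v -> cspan g' (f v).
Proof.
move=> lf c0 hc h v hv; apply: cspan_lim => e e0.
have c1 : 0 < c + 1 by lra.
have [r hr] := hv _ (divr_gt0 e0 c1); exists (f (comb g r)); split.
  by rewrite (comb_lin _ _ lf); apply: cspan_sum => p; exact/cspanZ/h.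
rewrite -(linB lf); apply: le_lt_trans (hc _) _.
have : nrm (v - comb g r) * (c + 1) < e by rewrite -ltr_pdivlMr.
by have := nrm_ge0 (v - comb g r); lra.
Qed.

Variables (A : cstarAlgType R) (H : hilbertType R) (sigma : A -> H -> H).
Hypothesis hs : star_rep sigma.

Lemma rt_nrm (E : corrType A) (Y : rep_tensor E sigma) x h :
  nrm (rt_tens Y x h) <= nrm x * nrm h.
Proof.
apply: sqr_le_mul; rewrite ?mulr_ge0 ?nrm_ge0//.
have := @functional_bound _ _ (fun a => ipr h (sigma a h)) (nrm h ^+ 2) _ _ _ (ip x x).
rewrite nrm_ip -exprMn => h1; rewrite -iprxx /ipr rt_inner; apply: h1.
- by move=> a b; rewrite (linD (star_rep_linl hs h)) iprDr.
- by move=> r a; rewrite (linZ (star_rep_linl hs h)) iprZr.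
- move=> w sw; rewrite (star_repM hs).
  have -> : ipr h (sigma w (sigma w h)) = nrm (sigma w h) ^+ 2.
    by case: hs => _ _ _ ad; rewrite -iprxx /ipr ad sw.
  have := sqr_ge0 (nrm (1%:C *: h + (- 1)%:C *: sigma w h)).
  by rewrite nrm_sqr_comb; lra.
- by rewrite -ip_star.
Qed.

Lemma rt_total_of (E : corrType A) (Y : rep_tensor E sigma) I (a : I -> E) :
  (forall x, cspan a x) ->
  forall v, cspan (fun p : I * H => rt_tens Y (a p.1) p.2) v.
Proof.
move=> ha; apply: (dense_cspan (@rt_dense _ _ _ _ _ Y)) => v [x [h ->]].
apply: (@cspan_image _ _ _ _ _ _ (fun x => rt_tens Y x h) (nrm h) _ _ _ _ _ (ha x)).
- exact: rt_linearl.
- exact: nrm_ge0.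
- by move=> z; rewrite mulrC; exact: rt_nrm.
- by move=> i; exact: (cspan_gen (fun p : I * H => rt_tens Y (a p.1) p.2) (i, h)).
Qed.

End Totality.

Section Products.
Variables (R : realType) (A : cstarAlgType R) (Omega : Type).
Variables (SS : semigroup_family R Omega) (X : product_system A SS).

Lemma ps_mul_ip s t (x x' : X s) (y y' : X t) : s != 0 -> t != 0 ->
  ip (ps_mul x y) (ps_mul x' y') = ip y (lmul (ip x x') y').
Proof.
move=> s0 t0; have [P [U [[_ _ Uip _ _] hU]]] := ps_tensor X s0 t0.
by rewrite -!hU Uip bt_ip.
Qed.

Lemma ps_mul_lin s t (x : X s) : s != 0 -> t != 0 ->
  linear (ps_mul x : X t -> X (s + t)).
Proof.
move=> s0 t0; have [P [U [[lU _ _ _ _] hU]]] := ps_tensor X s0 t0.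
apply: linP => [y y'|c y]; rewrite -!hU.
  by rewrite (linD (bt_linearr P x)) (linD lU).
by rewrite (linZ (bt_linearr P x)) (linZ lU).
Qed.

Lemma ps_mul_total s t (w : X (s + t)) : s != 0 -> t != 0 ->
  cspan (fun p : X s * X t => ps_mul p.1 p.2) w.
Proof.
move=> s0 t0; have [P [U [[lU [V UK VK] Uip _ _] hU]]] := ps_tensor X s0 t0.
rewrite -(VK w).
have dP : forall v : P, cspan (fun p : X s * X t => bt_tens P p.1 p.2) v.
  apply: (dense_cspan (@bt_dense _ _ _ _ P)) => v [x [y ->]].
  exact: (cspan_gen (fun p : X s * X t => bt_tens P p.1 p.2) (x, y)).
apply: (@cspan_image _ _ _ _ _ _ _ U 1 lU ler01 _ _ _ (dP (V w))).
  move=> v; rewrite mul1r; apply: sqr_le_mul; rewrite ?nrm_ge0//.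
  by rewrite -!nrm_ip Uip.
move=> [x y] /=; rewrite hU.
exact: (cspan_gen (fun p : X s * X t => ps_mul p.1 p.2) (x, y)).
Qed.

(** With [1 - a / l = (1 - w)^2] for [a = <x, x>], the difference [l <y, y> - <x y, x y>] equals
    [l <y - w y, y - w y>]. As [l >= 1], [l] itself is a bound. *)
Lemma ps_mul_bounded s t (x : X s) : s != 0 -> t != 0 ->
  exists2 c, 0 <= c & forall y : X t, nrm (ps_mul x y) <= c * nrm y.
Proof.
move=> s0 t0; pose a := ip x x; pose l := nrm a + 1.
have sa : cstar a = a by rewrite -ip_star.
have l1 : 1 <= l by rewrite lerDr nrm_ge0.
have l0 : 0 < l by lra.
have [||w sw wE] := @star_sqrt _ _ (l^-1%:C *: a).
- by rewrite cstarZr sa.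
- rewrite nrmZr_ge0 ?invr_ge0 ?(ltW l0)// mulrC ltr_pdivrMr// mul1r /l; lra.
exists l => [|y]; first exact: ltW.
apply: sqr_le_mul; rewrite ?mulr_ge0 ?nrm_ge0 ?(ltW l0)//.
have -> : (l * nrm y) ^+ 2 = l * (l * nrm y ^+ 2) by ring.
rewrite -!nrm_ip; apply: le_trans (_ : _ <= l * nrm (ip y y)) _; last first.
  by rewrite ler_peMl// mulr_ge0 ?nrm_ge0 ?(ltW l0).
rewrite -nrmZr_ge0 ?(ltW l0)//; apply: nrm_le_cpos; first exact: cpos_ip.
have -> : l%:C *: ip y y - ip (ps_mul x y) (ps_mul x y) =
    l%:C *: ip (y - lmul w y) (y - lmul w y).
  have aE : lmul a y = l%:C *: (lmul w y + lmul w y - lmul w (lmul w y)).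
    have -> : a = l%:C *: (w + w - cmul w w).
      by rewrite wE scalerA -rmorphM/= divff ?gt_eqF// scale1r.
    have ly := lmull_lin y.
    by rewrite (linZ ly) (linB ly) (linD ly) lmulA.
  have wadj z : ip (lmul w y) z = ip y (lmul w z) by rewrite lmul_adj sw.
  rewrite ps_mul_ip// -/a aE !(ipDr, ipDl, ipNl, ipZr, linN (ip_lin _)) !wadj.
  by module.
by apply: cposZ; [exact: ltW|exact: cpos_ip].
Qed.

Lemma ps_mul3_total r s t (w : X (r + (s + t))) : r != 0 -> s != 0 -> t != 0 ->
  s + t != 0 ->
  cspan (fun p : X r * (X s * X t) => ps_mul p.1 (ps_mul p.2.1 p.2.2)) w.
Proof.
move=> r0 s0 t0 st0; apply: cspan_lim => e e0.
have [l hl] := ps_mul_total w r0 st0 e0; eexists; split; last exact: hl.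
apply: cspan_sum => -[c [x z]] /=; apply: cspanZ.
have [b b0 hb] := ps_mul_bounded x r0 st0.
apply: (@cspan_image _ _ _ _ _ _ _ _ b _ _ hb _ _ (ps_mul_total z s0 t0)) => //.
  exact: ps_mul_lin.
move=> [y y'] /=.
exact: (cspan_gen (fun p : X r * (X s * X t) => ps_mul p.1 (ps_mul p.2.1 p.2.2))
  (x, (y, y'))).
Qed.

End Products.
(** * The contractive semigroup *)

Section OrthogonalSums.
Variables (R : realType) (K : hilbertType R).

Lemma pythagoras (J : eqType) (L : seq J) (v : J -> K) : uniq L ->
  (forall i j, i != j -> inner (v i) (v j) = 0) ->
  nrm (\sum_(j <- L) v j) ^+ 2 = \sum_(j <- L) nrm (v j) ^+ 2.
Proof.
move=> uL orth; elim: L uL => [|i L IH] /=; first by rewrite !big_nil nrm0 expr0n.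
move=> /andP[iL uL]; rewrite !big_cons -(IH uL).
have := nrm_sqr_comb 1 1 (v i) (\sum_(j <- L) v j).
rewrite rmorph1 !scale1r => ->.
have -> : ipr (v i) (\sum_(j <- L) v j) = 0.
  rewrite /ipr inner_sumr big1_seq// => j /andP[_ jL]; apply: orth.
  by apply: contraNneq iL => ->.
by ring.
Qed.

Lemma sum_by_fiber (J : eqType) (T : Type) (V : nmodType) (l : T -> J)
    (r : seq T) (F : T -> V) :
  \sum_(p <- r) F p =
  \sum_(j <- undup (map l r)) \sum_(p <- r | l p == j) F p.
Proof.
suff fib (L : seq J) : uniq L -> {subset map l r <= L} ->
    \sum_(p <- r) F p = \sum_(j <- L) \sum_(p <- r | l p == j) F p.
  by apply: fib; [exact: undup_uniq|move=> j; rewrite mem_undup].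
move=> uL; elim: r => [|p r IH] sub.
  by rewrite big_nil big1// => j _; rewrite big_nil.
rewrite big_cons IH; last by move=> j jr; apply: sub; rewrite inE jr orbT.
have lpL : l p \in L by apply: sub; rewrite mem_head.
rewrite (bigD1_seq (l p))//= [RHS](bigD1_seq (l p))//= big_cons eqxx addrA.
congr (_ + _); apply: eq_bigr => j; rewrite eq_sym big_cons => /negbTE->.
by [].
Qed.

End OrthogonalSums.

Section Hat.
Variables (R : realType) (A : cstarAlgType R) (Omega : Type).
Variables (SS : semigroup_family R Omega) (X : product_system A SS).
Variables (H : hilbertType R) (sigma : A -> H -> H).
Variable Y : forall s : nzidx SS, rep_tensor (X (val s)) sigma.
Variable HH : hilbert_sum (summand Y).
Variable T : forall s : idx SS, X s -> H -> H.
Hypothesis hT : representation sigma T.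

Lemma rep_cc s : cc_representation sigma (@T s).
Proof. by case: hT. Qed.

Lemma nzidx_neq0 (s : nzidx SS) : val s != 0.
Proof. by case: s. Qed.

Lemma nzidx_addIr (r r' s : nzidx SS) : nzidx_add r s = nzidx_add r' s -> r = r'.
Proof.
move=> /(congr1 val)/= rs; apply/val_inj/idx_eqP => j.
by apply: (addIr (val s j)); rewrite -!idx_addE rs.
Qed.

Lemma nzidx_add_neq (r s : nzidx SS) : nzidx_add r s <> s.
Proof. by have [_ h] := proj2 (nzidx_ltP s (nzidx_add r s)) (ex_intro _ r erefl). Qed.

Lemma idx_le_add (r s : nzidx SS) : idx_le (val s) (val (nzidx_add r s)).
Proof. by apply/idx_leP; exists (val r). Qed.

Lemma idx_le_refl (s : idx SS) : idx_le s s.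
Proof. by move=> j. Qed.

Lemma nzidx_not_le0 (s : nzidx SS) : ~ idx_le (val s) 0.
Proof.
move=> h; have /eqP[] := nzidx_neq0 s; apply: idx_eqP => j.
by apply/eqP; rewrite eq_le (h j) idx_ge0.
Qed.

Lemma level_inj (t t' : option (nzidx SS)) : level t = level t' -> t = t'.
Proof.
case: t t' => [t|] [t'|] //=.
- by move=> tt; congr Some; exact: val_inj.
- by move=> t0; have /eqP := nzidx_neq0 t.
- by move=> t0; have /eqP := nzidx_neq0 t'; rewrite /= -t0.
Qed.

Lemma rep_star : star_rep sigma.
Proof. exact: cc_star_rep (rep_cc 0). Qed.

Lemma rt_products_total (r s : nzidx SS) (v : Y (nzidx_add r s)) :
  cspan (fun p : (X (val r) * X (val s)) * H =>
    rt_tens (Y (nzidx_add r s)) (ps_mul p.1.1 p.1.2) p.2) v.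
Proof.
apply: (rt_total_of rep_star (a := fun p : X (val r) * X (val s) =>
  ps_mul p.1 p.2 : X (val (nzidx_add r s)))) => x.
exact: ps_mul_total (nzidx_neq0 r) (nzidx_neq0 s).
Qed.

(** This is [I (x) T~] read through [U_{r,s}]. Scalars are moved into the vectors of [H], so that
    [tensor_contraction] is the extension inequality. *)
Lemma lift_exists (r s : nzidx SS) :
  exists2 f : Y (nzidx_add r s) -> Y r, linear_contraction f &
    forall x y h, f (rt_tens (Y (nzidx_add r s)) (ps_mul x y) h) =
      rt_tens (Y r) x (T y h).
Proof.
have [|f cf hf] := @contraction_extension _ _ _ _ _
  (fun p : (X (val r) * X (val s)) * H => rt_tens (Y r) p.1.1 (T p.1.2 p.2))
  (@rt_products_total r s).
  move=> l; rewrite /comb !(big_tnth _ _ l).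
  pose p k := tnth (in_tuple l) k.
  have := tensor_contraction (rep_cc (val r)) (rep_cc (val s))
    (fun x y x' y' => ps_mul_ip x x' y y' (nzidx_neq0 r) (nzidx_neq0 s))
    (Y r) (Y s) (Y (nzidx_add r s))
    (fun k => (p k).2.1.1) (fun k => (p k).2.1.2) (fun k => (p k).1 *: (p k).2.2).
  under eq_bigr => k _ do
    rewrite (linZ (rep_linr (rep_cc (val s)) _)) (linZ (rt_linearr (Y r) _)).
  by under [X in _ <= nrm X -> _]eq_bigr => k _ do
    rewrite (linZ (rt_linearr (Y (nzidx_add r s)) _)).
by exists f => // x y h; exact: (hf ((x, y), h)).
Qed.

Lemma hs_nrm t (xi : summand Y t) : nrm (hs_in HH xi) = nrm xi.
Proof.
apply/eqP; rewrite -(@eqrXn2 _ 2) ?nrm_ge0//.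
by rewrite -!iprxx /ipr hs_inner.
Qed.

Lemma inner0l (K : hilbertType R) (x : K) : inner 0 x = 0.
Proof. by rewrite inner_conj inner0r conjc0. Qed.

Section OneIndex.
Variables (s : nzidx SS) (Tt : Y s -> H).
Hypothesis hTt : tilde_map (@T (val s)) Tt.

(** One constructor per rule. Rule (iii) is given on product tensors only, so [hat_contraction] is
    also what makes the prescription consistent. *)
Inductive hat_gen : Type :=
  | HatBelow t (xi : summand Y t) of ~ idx_le (val s) (level t)
  | HatSame of Y s
  | HatAbove (r : nzidx SS) of X (val r) & X (val s) & H.

Definition hat_level (i : hat_gen) : option (nzidx SS) :=
  match i with
  | HatBelow t _ _ => t
  | HatSame _ => Some s
  | HatAbove r _ _ _ => Some (nzidx_add r s)
  end.

Definition hat_src (i : hat_gen) : HH :=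
  match i with
  | HatBelow t xi _ => hs_in HH xi
  | HatSame xi => delta HH s xi
  | HatAbove r x y h =>
      delta HH (nzidx_add r s) (rt_tens (Y (nzidx_add r s)) (ps_mul x y) h)
  end.

Definition hat_dst (i : hat_gen) : HH :=
  match i with
  | HatBelow _ _ _ => 0
  | HatSame xi => delta0 HH (Tt xi)
  | HatAbove r x y h => delta HH r (rt_tens (Y r) x (T y h))
  end.

(* On the summand of index [t] the prescribed values are those of the
   contraction [k], whose range lies in the summand whose level is lower by
   [s]. *)
Definition hat_summand_spec t (k : summand Y t -> HH) : Prop :=
  [/\ linear k, forall xi, nrm (k xi) <= nrm xi,
      forall i, hat_level i = t ->
        exists xi, hat_src i = hs_in HH xi /\ hat_dst i = k xi
    & forall xi, k xi = 0 \/ exists r (eta : summand Y r),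
        level t = level r + val s /\ k xi = hs_in HH eta].

Lemma hat_on_summand t : exists k : summand Y t -> HH, hat_summand_spec k.
Proof.
have [le|nle] := pselect (idx_le (val s) (level t)); last first.
  exists (fun=> 0); split.
  - by apply: linP => *; rewrite ?addr0 ?scaler0.
  - by move=> xi; rewrite nrm0 nrm_ge0.
  - move=> i; case: i => [t' xi n|xi|r x y h] /= E.
    + by move: xi n; rewrite E => xi n; exists xi.
    + by case: nle; rewrite -E; exact: idx_le_refl.
    + by case: nle; rewrite -E; exact: idx_le_add.
  - by move=> xi; left.
case: t le => [u|] /= le; last by case: (nzidx_not_le0 le).
have [cT hT'] := hTt; have /linear_contraction_nrm[lT nT] := cT.
have [us|us] := pselect (u = s).
  rewrite us in le *; exists (fun xi => delta0 HH (Tt xi)); split.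
  - apply: linP => [x y|c x]; rewrite /delta0.
      by rewrite (linD lT) (linD (hs_linear HH (i := None))).
    by rewrite (linZ lT) (linZ (hs_linear HH (i := None))).
  - by move=> xi; rewrite hs_nrm; exact: nT.
  - move=> i; case: i => [t' xi n|xi|r x y h] /= E.
    + by case: n; rewrite E.
    + by exists xi.
    + by case: E => /nzidx_add_neq.
  - by move=> xi; right; exists None, (Tt xi); split=> //=; rewrite add0r.
have [r ru] := proj1 (nzidx_ltP s u) (conj le us).
rewrite -ru {u le us ru} in nT *.
have [f /linear_contraction_nrm[lf nf] hf] := lift_exists r s.
exists (fun xi => delta HH r (f xi)); split.
- apply: linP => [x y|c x]; rewrite /delta.
    by rewrite (linD lf) (linD (hs_linear HH (i := Some r))).
  by rewrite (linZ lf) (linZ (hs_linear HH (i := Some r))).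
- by move=> xi; rewrite hs_nrm; exact: nf.
- move=> i; case: i => [t' xi n|xi|r' x y h] /= E.
  + by case: n; rewrite E; exact: idx_le_add.
  + by case: E => /esym/nzidx_add_neq.
  + have rr : r' = r by apply: (@nzidx_addIr _ _ s); exact: Some_inj E.
    move: x; rewrite rr => x; eexists; split; first reflexivity.
    by rewrite hf.
- by move=> xi; right; exists (Some r), (f xi).
Qed.

Lemma hat_src_total v : cspan hat_src v.
Proof.
apply: (dense_cspan (@hs_dense _ _ _ HH)) => {}v [t [xi ->]].
have [le|nle] := pselect (idx_le (val s) (level t)); last first.
  exact: (cspan_gen hat_src (HatBelow xi nle)).
case: t xi le => [u|] xi /= le; last by case: (nzidx_not_le0 le).
have [us|us] := pselect (u = s).
  by move: xi; rewrite us => xi; exact: (cspan_gen hat_src (HatSame xi)).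
have [r ru] := proj1 (nzidx_ltP s u) (conj le us).
move: xi; rewrite -ru => xi.
apply: (@cspan_image _ _ _ _ _ _ hat_src (hs_in HH (i := Some (nzidx_add r s))) 1
  _ ler01 _ _ _ (rt_products_total xi)).
- exact: hs_linear.
- by move=> z; rewrite mul1r hs_nrm.
- by move=> [[x y] h]; exact: (cspan_gen hat_src (HatAbove x y h)).
Qed.

Lemma hat_contraction l : nrm (comb hat_dst l) <= nrm (comb hat_src l).
Proof.
pose k t := projT1 (cid (hat_on_summand t)).
have kP t : hat_summand_spec (k t) := projT2 (cid (hat_on_summand t)).
have fiber t : exists xi : summand Y t,
    \sum_(p <- l | hat_level p.2 == t) p.1 *: hat_src p.2 = hs_in HH xi /\
    \sum_(p <- l | hat_level p.2 == t) p.1 *: hat_dst p.2 = k t xi.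
  have [lk _ hk _] := kP t; have lh := hs_linear HH (i := t).
  elim: l => [|[c i] l [xi [IH1 IH2]]].
    by exists 0; rewrite !big_nil (lin0 lk) (lin0 lh).
  rewrite !big_cons; case: eqP => [/hk[eta [e1 e2]]|_]; last by exists xi.
  exists (c *: eta + xi); rewrite IH1 IH2 /= e1 e2.
  by rewrite (linD lk) (linZ lk) (linD lh) (linZ lh).
pose xi t := projT1 (cid (fiber t)).
have xi1 t : \sum_(p <- l | hat_level p.2 == t) p.1 *: hat_src p.2 = hs_in HH (xi t).
  by have [] := projT2 (cid (fiber t)).
have xi2 t : \sum_(p <- l | hat_level p.2 == t) p.1 *: hat_dst p.2 = k t (xi t).
  by have [] := projT2 (cid (fiber t)).
rewrite /comb !(sum_by_fiber (fun p : R[i] * hat_gen => hat_level p.2)).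
under eq_bigr => t _ do rewrite xi2.
under [X in _ <= nrm X]eq_bigr => t _ do rewrite xi1.
apply: sqr_le_mul; rewrite ?nrm_ge0// !pythagoras ?undup_uniq//; last first.
- move=> t t' tt; have [_ _ _ /(_ (xi t))] := kP t.
  have [_ _ _ /(_ (xi t'))] := kP t'.
  case=> [->|[r' [eta' [l' ->]]]]; first by rewrite inner0r.
  case=> [->|[r [eta [l0 ->]]]]; first by rewrite inner0l.
  (* All levels drop by the same [val s], so equal targets would come from equal sources. *)
  apply: hs_orthogonal => rr; case/eqP: tt; apply: level_inj.
  by rewrite l0 l' rr.
- by move=> t t' /eqP tt; exact: hs_orthogonal.
apply: ler_sum => t _; rewrite hs_nrm ler_pXn2r ?nnegrE ?nrm_ge0//.
by have [_ nk _ _] := kP t.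
Qed.

Lemma hat_exists : exists2 f : HH -> HH, linear_contraction f &
  forall i, f (hat_src i) = hat_dst i.
Proof. exact: contraction_extension hat_src_total hat_contraction. Qed.

End OneIndex.

Lemma hs_in_contraction t : linear_contraction (hs_in HH (i := t)).
Proof.
by apply/linear_contraction_nrm; split=> [|x]; [exact: hs_linear|rewrite hs_nrm].
Qed.

Lemma linear_contraction_comp (V W U : normedModType R[i]) (f : W -> U) (g : V -> W) :
  linear_contraction f -> linear_contraction g -> linear_contraction (f \o g).
Proof.
move=> [lf nf] [lg ng]; split=> [c x y|x] /=; first by rewrite lg lf.
exact: le_trans (nf _) (ng _).
Qed.

Lemma bounded_linear_comp (V W U : normedModType R[i]) (f : W -> U) (g : V -> W) :
  bounded_linear f -> linear_contraction g -> bounded_linear (f \o g).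
Proof.
move=> bf [lg ng]; have [lf _] := bf; have [c c0 hc] := bounded_linear_nrm bf.
split=> [k x y|] /=; first by rewrite lg lf.
exists c%:C => x; rewrite !nrmE -(rmorphM (real_complex R)) lecR/=.
apply: le_trans (hc _) _; rewrite ler_wpM2l// -nrm_le; exact: ng.
Qed.

Lemma hs_ext (f1 f2 : HH -> HH) : bounded_linear f1 -> bounded_linear f2 ->
  (forall t (xi : summand Y t), f1 (hs_in HH xi) = f2 (hs_in HH xi)) -> f1 = f2.
Proof.
move=> b1 b2 h; apply/funext => v.
apply: (eq_on_cspan b1 b2 (g := fun p : {t & summand Y t} => hs_in HH (projT2 p))).
  by move=> p; exact: h.
apply: (dense_cspan (@hs_dense _ _ _ HH)) => {}v [t [xi ->]].
exact: (cspan_gen (fun p : {t & summand Y t} => hs_in HH (projT2 p)) (existT _ t xi)).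
Qed.

Lemma existT_inj (I : Type) (P : I -> Type) (i : I) (x y : P i) :
  existT P i x = existT P i y -> x = y.
Proof.
move=> E; have := projT2_eq E.
by rewrite (Prop_irrelevance (projT1_eq E) erefl).
Qed.

(** [ps_mulA] equates pairs in the disjoint union; [delta] sends both members into the single space
    [HH], where the equality needs no cast. *)
Lemma delta_transport (t t' : nzidx SS) (x : X (val t)) (x' : X (val t')) h :
  existT (fun u => X u : Type) (val t) x = existT (fun u => X u : Type) (val t') x' ->
  delta HH t (rt_tens (Y t) x h) = delta HH t' (rt_tens (Y t') x' h).
Proof.
move=> E; have tt' : t = t' by apply/val_inj; exact: projT1_eq E.
move: x' E; rewrite -tt' => x' E.
by rewrite (existT_inj (P := fun u => X u : Type) E).
Qed.

Definition hat_family (Tt : forall s : nzidx SS, Y s -> H)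
    (F : nzidx SS -> HH -> HH) : Prop :=
  forall s,
  [/\ linear_contraction (F s),
      forall t (xi : summand Y t), ~ idx_le (val s) (level t) -> F s (hs_in HH xi) = 0,
      forall xi : Y s, F s (delta HH s xi) = delta0 HH (Tt s xi)
    & forall (r : nzidx SS) (x : X (val r)) (y : X (val s)) h,
        F s (delta HH (nzidx_add r s) (rt_tens (Y (nzidx_add r s)) (ps_mul x y) h)) =
        delta HH r (rt_tens (Y r) x (T y h))].

Lemma hat_family_exists : exists (Tt : forall s : nzidx SS, Y s -> H) F,
  (forall s, tilde_map (@T (val s)) (Tt s)) /\ hat_family Tt F.
Proof.
pose ex s := cid (tilde_map_exists (rep_cc (val s)) (Y s)).
pose Tt s := projT1 (ex s); have hTt s : tilde_map (@T (val s)) (Tt s) := projT2 (ex s).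
pose exF s := cid2 (hat_exists (hTt s)).
exists Tt, (fun s => s2val (exF s)); split=> // s.
have cF := s2valP (exF s); have hF := s2valP' (exF s); split=> //.
- by move=> t xi n; exact: (hF (HatBelow xi n)).
- by move=> xi; exact: (hF (HatSame xi)).
- by move=> r x y h; exact: (hF (HatAbove x y h)).
Qed.

Section Family.
Variables (Tt : forall s : nzidx SS, Y s -> H) (F : nzidx SS -> HH -> HH).
Hypothesis hTt : forall s, tilde_map (@T (val s)) (@Tt s).
Hypothesis hF : hat_family Tt F.

Lemma hat_family_contraction s : linear_contraction (F s).
Proof. by have [] := hF s. Qed.

Lemma hat_family_mul (u v : nzidx SS) k : F u (F v k) = F (nzidx_add u v) k.
Proof.
have cF := hat_family_contraction.
suff -> : F (nzidx_add u v) = F u \o F v by [].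
apply: hs_ext; first exact: linear_contraction_bounded.
  exact/linear_contraction_bounded/linear_contraction_comp.
have cL t := linear_contraction_comp (cF (nzidx_add u v)) (hs_in_contraction t).
have cR t :=
  linear_contraction_comp (linear_contraction_comp (cF u) (cF v)) (hs_in_contraction t).
have [_ belowu sameu aboveu] := hF u; have [_ belowv samev abovev] := hF v.
have [_ below same above] := hF (nzidx_add u v).
have repM s t (x : X s) (y : X t) h : T (ps_mul x y) h = T x (T y h).
  by case: hT => _ _; exact.
have zero (W : normedModType R[i]) : linear_contraction (fun _ : W => 0 : HH).
  by split=> [c x y|x]; rewrite ?normr0 ?normr_ge0// scaler0 addr0.
move=> t xi.
(* If the level is not above [u + v], both sides vanish: it is not above [v], or it equals [v] and
   drops to 0, or it is [r + v] with [r] not above [u]. *)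
have [le|nle] := pselect (idx_le (val (nzidx_add u v)) (level t)); last first.
  rewrite below//=; have [lev|nlev] := pselect (idx_le (val v) (level t)); last first.
    by rewrite belowv// (lin0 (proj1 (cF u))).
  case: t xi nle lev => [w|] xi nle lev; last by case: (nzidx_not_le0 lev).
  have [wv|wv] := pselect (w = v).
    move: xi {lev nle}; rewrite wv => xi; rewrite samev belowu//.
    exact: nzidx_not_le0.
  have [r rw] := proj1 (nzidx_ltP v w) (conj lev wv).
  move: xi nle {lev wv}; rewrite -rw => xi nle.
  have nler : ~ idx_le (val u) (level (Some r)).
    move=> /idx_leP[q qu]; apply: nle; apply/idx_leP; exists q.
    by rewrite /= addrA qu.
  apply/esym; apply: (eq_on_cspan (linear_contraction_bounded (cR _))
    (linear_contraction_bounded (zero _)) _ (rt_products_total xi)) => -[[x y] h] /=.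
  by rewrite abovev belowu.
case: t xi le => [w|] xi le; last by case: (nzidx_not_le0 le).
have [wuv|wuv] := pselect (w = nzidx_add u v).
  move: xi {le}; rewrite wuv => xi.
  apply: (eq_on_cspan (linear_contraction_bounded (cL _))
    (linear_contraction_bounded (cR _)) _ (rt_products_total xi)) => -[[x y] h] /=.
  rewrite same abovev sameu; congr delta0.
  have [_ ->] := hTt (nzidx_add u v); have [_ ->] := hTt u.
  exact: repM.
have [r rw] := proj1 (nzidx_ltP _ w) (conj le wuv).
move: xi {le wuv}; rewrite -rw => xi.
(* Above [u + v] the law is tested on triple products, bracketed as [w' (x y)] for [F (u + v)] and
   as [(w' x) y] for [F u] after [F v]. *)
have tot := @rt_total_of _ _ _ _ rep_star _ (Y (nzidx_add r (nzidx_add u v))) _ _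
  (fun x => ps_mul3_total x (nzidx_neq0 r) (nzidx_neq0 u) (nzidx_neq0 v)
     (nzidx_neq0 (nzidx_add u v))).
apply: (eq_on_cspan (linear_contraction_bounded (cL _))
  (linear_contraction_bounded (cR _)) _ (tot xi)) => -[[w' [x y]] h] /=.
rewrite above.
have -> : hs_in HH (i := Some (nzidx_add r (nzidx_add u v)))
    (rt_tens (Y (nzidx_add r (nzidx_add u v))) (ps_mul w' (ps_mul x y)) h) =
  delta HH (nzidx_add (nzidx_add r u) v)
    (rt_tens (Y (nzidx_add (nzidx_add r u) v)) (ps_mul (ps_mul w' x) y) h).
  by apply: delta_transport; exact: ps_mulA.
by rewrite abovev aboveu repM.
Qed.

Definition hat (s : idx SS) : HH -> HH :=
  if insub s is Some u then F u else id.

Lemma hat0 : hat 0 = id.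
Proof. by rewrite /hat insubN// eqxx. Qed.

Lemma hat_nz (u : nzidx SS) : hat (val u) = F u.
Proof. by rewrite /hat valK. Qed.

Lemma nzidx_cases (s : idx SS) : s = 0 \/ exists u : nzidx SS, s = val u.
Proof.
by have [->|s0] := eqVneq s 0; [left|right; exists (exist _ s s0)].
Qed.

Lemma hat_semigroup : contractive_semigroup hat.
Proof.
split=> [s||s t k].
- have [->|[u ->]] := nzidx_cases s; last first.
    by rewrite hat_nz; exact: hat_family_contraction.
  by rewrite hat0; split.
- exact: hat0.
- have [->|[u ->]] := nzidx_cases s; first by rewrite hat0 add0r.
  have [->|[v ->]] := nzidx_cases t; first by rewrite hat0 addr0.
  by rewrite !hat_nz hat_family_mul -hat_nz.
Qed.

Lemma hat_satisfies_rules : hat_rules T hat.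
Proof.
split; first exact: hat0.
exists Tt; first exact: hTt.
move=> s; rewrite hat_nz; have [cF below same above] := hF s; split=> //.
by move=> r x y h; rewrite above; have [_ ->] := hTt s.
Qed.

Lemma hat_rules_uniq (Q : idx SS -> HH -> HH) :
  (forall s, bounded_linear (Q s)) -> hat_rules T Q -> Q = hat.
Proof.
move=> bQ [Q0 [Tt' hTt' rQ]]; apply/funext => s.
have [->|[u ->]] := nzidx_cases s; first by rewrite hat0.
have TT : Tt' u = @Tt u by exact: tilde_map_uniq (hTt' u) (hTt u).
rewrite hat_nz; have [cF below same above] := hF u.
have [belowQ sameQ aboveQ] := rQ u.
have bF := linear_contraction_bounded cF.
apply: hs_ext => // t xi.
have [le|nle] := pselect (idx_le (val u) (level t)); last by rewrite below// belowQ.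
case: t xi le => [w|] xi le; last by case: (nzidx_not_le0 le).
have [wu|wu] := pselect (w = u).
  move: xi {le}; rewrite wu => xi.
  by have := sameQ xi; rewrite TT -same.
have [r rw] := proj1 (nzidx_ltP _ w) (conj le wu).
move: xi {le wu}; rewrite -rw => xi.
apply: (eq_on_cspan (bounded_linear_comp (bQ (val u)) (hs_in_contraction _))
  (bounded_linear_comp bF (hs_in_contraction _)) _ (rt_products_total xi)).
move=> [[x y] h] /=.
have := aboveQ r x y h; rewrite /delta => ->; have := above r x y h; rewrite /delta => ->.
by rewrite TT; have [_ ->] := hTt u.
Qed.

End Family.

Lemma hat_rules_delta (That : idx SS -> HH -> HH) (s : nzidx SS) x h :
  hat_rules T That ->
  That (val s) (delta HH s (rt_tens (Y s) x h)) = delta0 HH (T x h).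
Proof.
by move=> [_ [Tt hTt /(_ s)[_ -> _]]]; have [_ ->] := hTt s.
Qed.

Lemma delta0_inj : injective (delta0 HH).
Proof.
move=> h k hk; apply/eqP; rewrite -subr_eq0; apply/eqP/nrm_eq0.
rewrite -(hs_nrm (t := None)) (linB (hs_linear HH (i := None))).
by rewrite -!/(delta0 HH _) hk subrr nrm0.
Qed.

End Hat.

Theorem proposition2p1 (R : realType) (Omega : Type)
    (SS : semigroup_family R Omega) (A : cstarAlgType R)
    (X : product_system A SS) (H : hilbertType R) (sigma : A -> H -> H)
    (T : forall s : idx SS, X s -> H -> H)
    (Y : forall s : nzidx SS, rep_tensor (X (val s)) sigma)
    (HH : hilbert_sum (summand Y))
    (hT : representation sigma T) :
  exists That : idx SS -> HH -> HH,
    [/\ contractive_semigroup That,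
        hat_rules T That,
        forall Q : idx SS -> HH -> HH,
          (forall s, bounded_linear (Q s)) -> hat_rules T Q -> Q = That,
        forall (s : nzidx SS) (x : X (val s)) (h : H),
          That (val s) (delta HH s (rt_tens (Y s) x h)) =
          delta0 HH (T (val s) x h)
      & forall (S : forall s : idx SS, X s -> H -> H)
               (Shat : idx SS -> HH -> HH),
          representation sigma S ->
          contractive_semigroup Shat -> hat_rules S Shat ->
          That = Shat -> T = S].
Proof.
have [Tt [F [hTt hF]]] := hat_family_exists HH hT.
have rules := hat_satisfies_rules hTt hF.
exists (hat F); split=> //.
- exact: hat_semigroup hT _ _ hTt hF.
- by move=> Q; exact: hat_rules_uniq hT _ _ hTt hF Q.
- by move=> s x h; exact: hat_rules_delta.
move=> S Shat hS _ rulesS E.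
apply: functional_extensionality_dep => s; apply/funext => x; apply/funext => h.
have [s0|s0] := eqVneq s 0; last first.
  apply: (@delta0_inj _ _ _ _ _ _ _ _ HH).
  have e1 := hat_rules_delta (s := exist _ s s0) x h rules.
  have e2 := hat_rules_delta (s := exist _ s s0) x h rulesS.
  by rewrite -[LHS]e1 E -[RHS]e2.
(* At index 0 both semigroups are the identity and carry no information; there [ps_unit] is onto and
   both representations restrict to [sigma]. *)
case: hT => T0 _ _; case: hS => S0 _ _.
move: x; rewrite s0 => x.
have [_ [V _ VK] _ _ _] := ps_unit_iso X.
by rewrite -(VK x) T0 S0.
Qed.
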